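(* Let $p$ be a prime congruent to $5$ or $11$ modulo $12$ and let $k=p+1$. Then the reduction modulo $p$ of the polynomial $P[\mathscr{C}_k\theta_H](j)$ splits over $\mathbb{F}_{p^2}$ into linear factors. Moreover, over $\mathbb{F}_p$ this polynomial factors as a product of irreducible quadratic factors only if its degree $n_k$ is even, and as $(j+1728)$ times a product of irreducible quadratic factors if its degree $n_k$ is odd. (Here ''if $n_k$ is even'' and ''if $n_k$ is odd'' are the hypotheses of the two cases, and ''only'' means that no other factors occur.)
   Context: $M_k$ is the $\mathbb{Q}$-vector space of modular forms of weight $k$ for $\mathrm{SL}_2(\mathbb{Z})$ with rational $q$-expansion, $q=e^{2\pi i\tau}$. $E_k=1-\frac{2k}{B_k}\sum_{n\ge1}\bigl(\sum_{d\mid n}d^{k-1}\bigr)q^n$ is the Eisenstein series, $\Delta=\frac{1}{1728}(E_4^3-E_6^2)=q\prod_{n\ge1}(1-q^n)^{24}$, and $j=E_4^3/\Delta$. Every even $k\ge4$ is written uniquely as $k=12n_k+4a_k+6b_k$ with $n_k\in\mathbb{Z}_{\ge0}$, $a_k\in\{0,1,2\}$, $b_k\in\{0,1\}$. For $f\in M_k$, $P[f]\in\mathbb{Q}[j]$ is the unique polynomial (of degree $\le n_k$) with $\frac{f(\tau)}{\Delta(\tau)^{n_k}E_4(\tau)^{a_k}E_6(\tau)^{b_k}}=P[f](j(\tau))$. For a power series $f(q)$ and even $k\ge4$, $\mathscr{C}_kf$ is the unique modular form of weight $k$ for $\mathrm{SL}_2(\mathbb{Z})$ with $\mathscr{C}_kf-f=\mathcal{O}(q^{n_k+1})$.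 The theta series of the hexagonal lattice is $\theta_H=\sum_{m,n\in\mathbb{Z}}q^{m^2+n^2+mn}$; $P[\mathscr{C}_k\theta_H]$ has integer coefficients, so it can be reduced modulo $p$. Empty products are $1$. *)

(* Defs.v *)
From HB Require Import structures.
From mathcomp Require Import all_boot all_order all_algebra all_field.
From mathcomp Require Import finmap complex zify lra.
From mathcomp Require Import all_classical all_reals all_analysis.

Set Implicit Arguments.
Unset Strict Implicit.
Unset Printing Implicit Defensive.

Import Order.TTheory GRing.Theory Num.Theory.
Import numFieldNormedType.Exports.

Local Open Scope ring_scope.
Local Open Scope complex_scope.
Local Open Scope classical_set_scope.

(* The ascription to numClosedFieldType makes the library's norm and topology
   on an abstract numeric field available on R[i]. *)
Definition CC (R : realType) : numClosedFieldType := R[i].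

(* The exponents in k = 12 n_k + 4 a_k + 6 b_k, for k even and k >= 4: the
   parity of k / 2 is b_k, and k / 2 - 3 b_k = 6 n_k + 2 a_k. *)
Definition bk (k : nat) : nat := odd k./2.
Definition ak (k : nat) : nat := ((k./2 - 3 * bk k)./2 %% 3)%N.
Definition nk (k : nat) : nat := ((k - (4 * ak k + 6 * bk k)) %/ 12)%N.

Lemma weight_decomp (k : nat) : ~~ odd k -> (4 <= k)%N ->
  [/\ k = (12 * nk k + 4 * ak k + 6 * bk k)%N, (ak k <= 2)%N & (bk k <= 1)%N].
Proof. by move=> k_even k_ge4; rewrite /nk /ak /bk; split; lia. Qed.

Lemma weight_decomp_uniq (k n a b : nat) :
  k = (12 * n + 4 * a + 6 * b)%N -> (a <= 2)%N -> (b <= 1)%N ->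
  [/\ nk k = n, ak k = a & bk k = b].
Proof.
move=> -> a2 b1.
have bE : bk (12 * n + 4 * a + 6 * b)%N = b by rewrite /bk; lia.
have aE : ak (12 * n + 4 * a + 6 * b)%N = a by rewrite /ak bE; lia.
by split=> //; rewrite /nk aE bE; lia.
Qed.

(* [:: B_0; ...; B_(n-1)], from
   \sum_(i <= m) 'C(m.+1, i) B_i = (m == 0). *)
Fixpoint bernoulli_seq (n : nat) : seq rat :=
  if n is m.+1 then
    let s := bernoulli_seq m in
    rcons s (((m == 0)%N%:R - \sum_(i < m) 'C(m.+1, i)%:R * s`_i) / m.+1%:R)
  else [::].

Definition bernoulli (n : nat) : rat := (bernoulli_seq n.+1)`_n.

Definition eisenstein_coef (k n : nat) : rat :=
  if n == 0%N then 1
  else - ((2 * k)%:R / bernoulli k) * (\sum_(d <- divisors n) d ^ k.-1)%:R.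

Definition hexagonal_vectors (N : nat) : set (int * int) :=
  [set v | v.1 ^+ 2 + v.2 ^+ 2 + v.1 * v.2 = N%:Z].

Lemma finite_hexagonal_vectors (N : nat) : finite_set (hexagonal_vectors N).
Proof.
pose box (ij : 'I_(2 * N).+1 * 'I_(2 * N).+1) : int * int :=
  (ij.1%:Z - N%:Z, ij.2%:Z - N%:Z).
apply: (@sub_finite_set _ _ (box @` setT)); last exact: finite_image.
have bound (x y : int) : x ^+ 2 + y ^+ 2 + x * y = N%:Z ->
    - N%:Z <= x /\ x <= N%:Z.
  move=> xyN; have sq_ge0 := sqr_ge0 (x + 2 * y).
  have N_ge0 : 0 <= N%:Z by [].
  have x2le : 3 * (x * x) <= 4 * N%:Z by lra.
  clear xyN sq_ge0 y; move: N%:Z N_ge0 x2le => M M_ge0 x2le.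
  by split; nia.
move=> [x y]; rewrite /hexagonal_vectors /= => xyN.
have [x1 x2] := bound x y xyN.
have [y1 y2] : - N%:Z <= y /\ y <= N%:Z.
  by apply: (bound y x); rewrite [y * x]mulrC [y ^+ 2 + _]addrC.
have ltx : (absz (x + N%:Z)%R < (2 * N).+1)%N by lia.
have lty : (absz (y + N%:Z)%R < (2 * N).+1)%N by lia.
exists (Ordinal ltx, Ordinal lty) => //; rewrite /box /=.
by congr pair; lia.
Qed.

(* The coefficient of q ^ N in the theta series of the hexagonal lattice. *)
Definition thetaH (N : nat) : nat := #|` fset_set (hexagonal_vectors N) |%fset.

Definition upper_half_plane (R : realType) : set (CC R) :=
  [set tau | 0 < complex.Im tau].

(* e ^ (2 pi i tau) *)
Definition qpar (R : realType) (tau : CC R) : CC R :=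
  (expR (- (2 * pi * complex.Im tau)))%:C *
  (cos (2 * pi * complex.Re tau) +i* sin (2 * pi * complex.Re tau)).

Definition has_qexpansion (R : realType) (f : CC R -> CC R) (c : nat -> CC R) :=
  forall tau, upper_half_plane tau ->
    series (fun n => c n * qpar tau ^+ n) @ \oo --> f tau.

(* f is a function on CC R, but only its values on the upper half-plane are
   constrained.  Holomorphy at the cusp is the existence of a q-expansion
   without negative powers of q. *)
Definition modular_form (R : realType) (k : nat) (f : CC R -> CC R) : Prop :=
  [/\ forall tau, upper_half_plane tau -> derivable f tau 1,
      forall (a b c d : int) tau, a * d - b * c = 1 -> upper_half_plane tau ->
        f ((a%:~R * tau + b%:~R) / (c%:~R * tau + d%:~R))
          = (c%:~R * tau + d%:~R) ^+ k * f tau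
    & exists c, has_qexpansion f c].

(* The space M_k. *)
Definition rational_modular_form (R : realType) (k : nat) (f : CC R -> CC R) :=
  modular_form k f /\
  exists c : nat -> rat, has_qexpansion f (fun n => ratr (c n)).

Definition Eis (R : realType) (k : nat) (tau : CC R) : CC R :=
  limn (series (fun n => ratr (eisenstein_coef k n) * qpar tau ^+ n)).

Definition Delta (R : realType) (tau : CC R) : CC R :=
  (Eis 4 tau ^+ 3 - Eis 6 tau ^+ 2) / 1728%:R.

Definition jinv (R : realType) (tau : CC R) : CC R :=
  Eis 4 tau ^+ 3 / Delta tau.

(* f is the form C_k g, for the power series g = \sum_n g_n q ^ n. *)
Definition is_Ck (R : realType) (k : nat) (g : nat -> CC R)
    (f : CC R -> CC R) : Prop :=
  modular_form k f /\
  exists2 c, has_qexpansion f c & forall n, (n <= nk k)%N -> c n = g n.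

(* P is the polynomial P[f].  The defining identity is one of meromorphic
   functions, so it is required where the denominator does not vanish. *)
Definition is_jpoly (R : realType) (k : nat) (f : CC R -> CC R)
    (P : {poly rat}) : Prop :=
  [/\ rational_modular_form k f,
      (size P <= (nk k).+1)%N
    & forall tau, upper_half_plane tau ->
        let D := Delta tau ^+ nk k * Eis 4 tau ^+ ak k * Eis 6 tau ^+ bk k in
        D != 0 -> f tau / D = (map_poly ratr P).[jinv tau]].

Definition reduce_mod (p : nat) (Q : {poly int}) : {poly 'F_p} :=
  map_poly intr Q.

Definition irreducible_quadratic (F : fieldType) (g : {poly F}) : Prop :=
  size g = 3%N /\ irreducible_poly g.

(* Main.v *)
(** Expanding at q -> 0+ along the imaginary axis, the coefficients of P are
    determined by a congruence of power series in q, which shows that they are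
    integers.  The theta series satisfies the Kaneko-Zagier differential equation of
    weight 1: its coefficients form an identity for sums of sigma(m) over
    4 m + s ^ 2 = D, proved by an involution on the triples (d, e, s) with d e = m,
    and the derivatives of E2, E4, E6 are given by Ramanujan's equations, proved by a
    bijection on the solutions of a x + b y = n.  Since k = p + 1 is 1 modulo p, the
    form C_k theta_H satisfies the equation modulo p too, and this is a two-term
    recurrence for the coefficients of P.

    Substitute j = 1728 Phi^3 / (4 Psi^3), with Phi = s^4 + 4 s and Psi = 2 s^3 - 1, so
    that j - 1728 becomes a square over 4 Psi^3.  The recurrence then says that the
    homogenized polynomial, a polynomial in s^3 of degree p + 1, has zero second
    derivative; hence it is s^(p+1) + k up to a constant, and evaluating at a root of
    Phi gives k^3 = 2.  It is squarefree, so that the roots r of P are simple and differ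
    from 1728, and s^(p+1) = - k yields r^(p+1) = 1728^2.  Thus the conjugate of r is
    1728^2 / r, and the only possible root in F_p is -1728. *)

Require Import Defs.
From HB Require Import structures.
From mathcomp Require Import all_boot all_order all_algebra all_field.
From mathcomp Require Import finmap complex ring lra zify.
From mathcomp Require Import all_classical all_reals all_analysis.
(* all_analysis shadows the notation of formal derivatives. *)
From mathcomp Require Import poly.

Set Implicit Arguments.
Unset Strict Implicit.
Unset Printing Implicit Defensive.

Import Order.TTheory GRing.Theory Num.Theory.
Import numFieldNormedType.Exports.

Local Open Scope ring_scope.

(** * Formal power series *)

(** The operator theta^2 - (k+1)/6 E2 theta + k(k+1)/12 theta(E2), with theta = q d/dq, sends
    modular forms of weight k to weight k + 4, and its coefficients depend on k only modulo p. So
    for k = p + 1 the weight 1 operator may be used modulo p. Applied to C_k theta_H it gives a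
    series that is O(q^(n+1)) and is governed by only n + 1 unknown coefficients, which therefore
    vanish; this is where the truncation order n = n_k enters.

    In the variable j the resulting recurrence is a hypergeometric equation whose exponent
    differences are 1/3 at 0, 1/2 at 1728 and 1/3 at infinity: the angles, in units of pi, of
    Schwarz's tetrahedral triangle. The tetrahedral covering of degree 12, ramified to the orders 3,
    2 and 3 over these points, pulls the equation back to y'' = 0, and this covering is the
    substitution for j.

    A q-expansion is given only as a pointwise limit on the upper half-plane, so coefficients are
    compared through the behaviour of real functions as q -> 0+. *)

Definition fps (R : Type) : Type := nat -> R.

HB.instance Definition _ (R : Type) := gen_eqMixin (fps R).
HB.instance Definition _ (R : Type) := gen_choiceMixin (fps R).

Section FpsRing.
Variable R : comNzRingType.
Implicit Types f g h : fps R.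

Definition fps_trunc (N : nat) f : {poly R} := \poly_(i < N) f i.

Definition fps_zero : fps R := fun=> 0.
Definition fps_one : fps R := fun n => (n == 0%N)%:R.
Definition fps_opp f : fps R := fun n => - f n.
Definition fps_add f g : fps R := fun n => f n + g n.
Definition fps_mul f g : fps R := fun n => \sum_(i < n.+1) f i * g (n - i)%N.

Lemma fps_addA : associative fps_add.
Proof. by move=> f g h; apply/funext => n; apply: addrA. Qed.
Lemma fps_addC : commutative fps_add.
Proof. by move=> f g; apply/funext => n; apply: addrC. Qed.
Lemma fps_add0 : left_id fps_zero fps_add.
Proof. by move=> f; apply/funext => n; apply: add0r. Qed.
Lemma fps_addN : left_inverse fps_zero fps_opp fps_add.
Proof. by move=> f; apply/funext => n; apply: addNr. Qed.

HB.instance Definition _ :=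
  GRing.isZmodule.Build (fps R) fps_addA fps_addC fps_add0 fps_addN.

(** Associativity of [fps_mul] is transported from polynomials: a coefficient of a product involves
    only coefficients of the same or lower index, so truncations compute it. *)
Lemma coef_mul_agree (N : nat) (p p' q q' : {poly R}) :
    (forall i, (i < N)%N -> p`_i = p'`_i) ->
    (forall i, (i < N)%N -> q`_i = q'`_i) ->
  forall i, (i < N)%N -> (p * q)`_i = (p' * q')`_i.
Proof.
move=> pp' qq' n ltnN; rewrite !coefM; apply: eq_bigr => i _.
by rewrite pp' ?qq' //; have := ltn_ord i; lia.
Qed.

Lemma coef_trunc N f i : (i < N)%N -> (fps_trunc N f)`_i = f i.
Proof. by move=> ltiN; rewrite coef_poly ltiN. Qed.

Lemma coef_trunc_mul N f g i : (i < N)%N ->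
  (fps_trunc N f * fps_trunc N g)`_i = fps_mul f g i.
Proof.
move=> ltiN; rewrite coefM; apply: eq_bigr => j _.
by rewrite !coef_trunc //; have := ltn_ord j; lia.
Qed.

Lemma fps_mulA : associative fps_mul.
Proof.
move=> f g h; apply/funext => n.
rewrite -!(@coef_trunc_mul n.+1) //.
transitivity ((fps_trunc n.+1 f * (fps_trunc n.+1 g * fps_trunc n.+1 h))`_n).
  by apply: (@coef_mul_agree n.+1) => // i lti; rewrite coef_trunc ?coef_trunc_mul.
rewrite mulrA.
by apply: (@coef_mul_agree n.+1) => // i lti; rewrite coef_trunc ?coef_trunc_mul.
Qed.

Lemma fps_mulC : commutative fps_mul.
Proof.
by move=> f g; apply/funext => n; rewrite -!(@coef_trunc_mul n.+1) // mulrC.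
Qed.

Lemma fps_mul1 : left_id fps_one fps_mul.
Proof.
move=> f; apply/funext => n; rewrite /fps_mul big_ord_recl /= mul1r subn0.
by rewrite big1 ?addr0 // => i _; rewrite mul0r.
Qed.

Lemma fps_mulDl : left_distributive fps_mul fps_add.
Proof.
move=> f g h; apply/funext => n; rewrite /fps_mul /fps_add -big_split /=.
by apply: eq_bigr => i _; rewrite mulrDl.
Qed.

Lemma fps_one_neq0 : fps_one != 0.
Proof. by apply/eqP => /(congr1 (@^~ 0%N)) /eqP; rewrite /= oner_eq0. Qed.

HB.instance Definition _ := GRing.Zmodule_isComNzRing.Build (fps R)
  fps_mulA fps_mulC fps_mul1 fps_mulDl fps_one_neq0.

Lemma fps_coefD f g n : (f + g) n = f n + g n. Proof. by []. Qed.
Lemma fps_coefN f n : (- f) n = - f n. Proof. by []. Qed.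
Lemma fps_coefB f g n : (f - g) n = f n - g n. Proof. by []. Qed.
Lemma fps_coefM f g n : (f * g) n = \sum_(i < n.+1) f i * g (n - i)%N.
Proof. by []. Qed.
Lemma fps_coef0 n : (0 : fps R) n = 0. Proof. by []. Qed.
Lemma fps_coef1 n : (1 : fps R) n = (n == 0%N)%:R. Proof. by []. Qed.
Lemma fps_coefMn f m n : (f *+ m) n = f n *+ m.
Proof. by elim: m => [|m IHm] //; rewrite !mulrSr fps_coefD IHm. Qed.
Lemma fps_coef_sum (I : Type) (r : seq I) (F : I -> fps R) n :
  (\sum_(i <- r) F i) n = \sum_(i <- r) F i n.
Proof. by elim/big_rec2: _ => // i f x _ <-. Qed.
Lemma fps_coef_natM m f n : (m%:R * f) n = m%:R * f n.
Proof. by rewrite !mulr_natl fps_coefMn. Qed.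

Definition fpsC (a : R) : fps R := fun n => a *+ (n == 0%N).

Lemma fps_coef_CM a f n : (fpsC a * f) n = a * f n.
Proof.
rewrite fps_coefM big_ord_recl /fpsC /= mulr1n subn0 big1 ?addr0 // => i _.
by rewrite mulr0n mul0r.
Qed.

Lemma fpsC_nat m : fpsC m%:R = m%:R.
Proof.
by apply/funext => n; rewrite fps_coefMn fps_coef1 /fpsC -!mulrnA mulnC.
Qed.

(* The derivation q d/dq. *)
Definition fps_theta f : fps R := fun n => f n *+ n.

Lemma fps_thetaD f g : fps_theta (f + g) = fps_theta f + fps_theta g.
Proof. by apply/funext => n; rewrite /fps_theta !fps_coefD mulrnDl. Qed.
Lemma fps_thetaN f : fps_theta (- f) = - fps_theta f.
Proof. by apply/funext => n; rewrite /fps_theta fps_coefN mulNrn. Qed.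
Lemma fps_thetaB f g : fps_theta (f - g) = fps_theta f - fps_theta g.
Proof. by rewrite fps_thetaD fps_thetaN. Qed.
Lemma fps_theta0 : fps_theta 0 = 0.
Proof. by apply/funext => n; rewrite /fps_theta fps_coef0 mul0rn. Qed.
Lemma fps_thetaC a : fps_theta (fpsC a) = 0.
Proof. by apply/funext => -[|n]; rewrite /fps_theta /fpsC //= mulr0n mul0rn. Qed.
Lemma fps_theta_nat m : fps_theta m%:R = 0.
Proof. by rewrite -fpsC_nat fps_thetaC. Qed.
Lemma fps_thetaM f g : fps_theta (f * g) = fps_theta f * g + f * fps_theta g.
Proof.
apply/funext => n; rewrite fps_coefD !fps_coefM /fps_theta fps_coefM -sumrMnl.
rewrite -big_split /=; apply: eq_bigr => i _.
rewrite mulrnAl mulrnAr -mulrnDr; congr (_ *+ _).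
by have := ltn_ord i; lia.
Qed.
(** The extra factor [f] avoids the exponent m - 1, which would truncate at m = 0. *)
Lemma fps_thetaX f m : f * fps_theta (f ^+ m) = m%:R * f ^+ m * fps_theta f.
Proof.
elim: m => [|m IHm]; first by rewrite expr0 (fps_theta_nat 1) mulr0 !mul0r.
by rewrite exprS fps_thetaM mulrDr mulrCA mulrCA IHm -natr1; ring.
Qed.
Lemma fps_theta_natM m f : fps_theta (m%:R * f) = m%:R * fps_theta f.
Proof. by rewrite fps_thetaM fps_theta_nat mul0r add0r. Qed.
Lemma fps_theta_CM a f : fps_theta (fpsC a * f) = fpsC a * fps_theta f.
Proof. by rewrite fps_thetaM fps_thetaC mul0r add0r. Qed.

Definition fps_O (N : nat) f := forall n, (n < N)%N -> f n = 0.

Lemma fps_OD N f g : fps_O N f -> fps_O N g -> fps_O N (f + g).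
Proof. by move=> fO gO n ltnN; rewrite fps_coefD fO ?gO ?addr0. Qed.
Lemma fps_ON N f : fps_O N f -> fps_O N (- f).
Proof. by move=> fO n ltnN; rewrite fps_coefN fO ?oppr0. Qed.
Lemma fps_OB N f g : fps_O N f -> fps_O N g -> fps_O N (f - g).
Proof. by move=> fO gO; apply/fps_OD/fps_ON. Qed.
Lemma fps_OM M N f g : fps_O M f -> fps_O N g -> fps_O (M + N) (f * g).
Proof.
move=> fO gO n ltn; rewrite fps_coefM big1 // => i _.
case: (ltnP i M) => [/fO-> | leMi]; first by rewrite mul0r.
by rewrite gO ?mulr0 //; have := ltn_ord i; lia.
Qed.
Lemma fps_OMl N f g : fps_O N g -> fps_O N (f * g).
Proof. by apply: (@fps_OM 0). Qed.
Lemma fps_O_theta N f : fps_O N f -> fps_O N (fps_theta f).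
Proof. by move=> fO n ltnN; rewrite /fps_theta fO ?mul0rn. Qed.
Lemma fps_O_le M N f : (M <= N)%N -> fps_O N f -> fps_O M f.
Proof. by move=> leMN fO n ltnM; apply/fO/(leq_trans ltnM). Qed.
Lemma fps_OX f m : fps_O 1 f -> fps_O m (f ^+ m).
Proof. by move=> fO; elim: m => // m IHm; rewrite exprS; apply: (@fps_OM 1). Qed.

Lemma fps_coefM_lead M N f g : fps_O M f -> fps_O N g ->
  (f * g) (M + N)%N = f M * g N.
Proof.
move=> fO gO; have ltM : (M < (M + N).+1)%N by lia.
rewrite fps_coefM (bigD1 (Ordinal ltM)) //= addKn big1 ?addr0 // => i neq.
have {neq} : i != M :> nat by apply: contraNneq neq => iM; apply/eqP/val_inj.
rewrite neq_ltn => /orP[/fO-> | ltMi]; first by rewrite mul0r.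
by rewrite gO ?mulr0 //; have := ltn_ord i; lia.
Qed.
Lemma fps_coefX_lead f m : fps_O 1 f -> (f ^+ m) m = f 1%N ^+ m.
Proof.
move=> fO; elim: m => // m IHm.
by rewrite !exprS -IHm -(@fps_coefM_lead 1) //; apply: fps_OX.
Qed.
Lemma fps_coef0M f g : (f * g) 0%N = f 0%N * g 0%N.
Proof. by apply: (@fps_coefM_lead 0 0). Qed.
Lemma fps_coef0X f m : (f ^+ m) 0%N = f 0%N ^+ m.
Proof. by elim: m => // m IHm; rewrite !exprS fps_coef0M IHm. Qed.

End FpsRing.

Section FpsMap.
Variables (R S : comNzRingType) (phi : {rmorphism R -> S}).

Definition fps_map (f : fps R) : fps S := fun n => phi (f n).

Lemma fps_map_is_zmod_morphism : zmod_morphism fps_map.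
Proof. by move=> f g; apply/funext => n; rewrite /fps_map fps_coefB rmorphB. Qed.
Lemma fps_map_is_monoid_morphism : monoid_morphism fps_map.
Proof.
split=> [|f g]; apply/funext => n; first by rewrite /fps_map rmorph_nat.
rewrite /fps_map !fps_coefM rmorph_sum; apply: eq_bigr => i _.
by rewrite rmorphM.
Qed.

HB.instance Definition _ :=
  GRing.isZmodMorphism.Build (fps R) (fps S) fps_map fps_map_is_zmod_morphism.
HB.instance Definition _ :=
  GRing.isMonoidMorphism.Build (fps R) (fps S) fps_map fps_map_is_monoid_morphism.

Lemma fps_map_theta f : fps_map (fps_theta f) = fps_theta (fps_map f).
Proof. by apply/funext => n; rewrite /fps_map /fps_theta rmorphMn. Qed.

Lemma fps_map_O N f : fps_O N f -> fps_O N (fps_map f).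
Proof. by move=> fO n ltnN; rewrite /fps_map fO ?rmorph0. Qed.

End FpsMap.

(** * Convolutions of divisor sums *)

(** The index sets below are sequences over infinite types, so a change of variables takes two
    explicit maps, mutually inverse on the indices that satisfy [P] and [Q]. *)
Lemma sum_bij (V : nmodType) (I J : eqType) (s : seq I) (t : seq J)
    (P : pred I) (Q : pred J) (F : I -> V) (G : J -> V)
    (h : I -> J) (h' : J -> I) :
    uniq s -> uniq t ->
    (forall i, i \in s -> P i -> [/\ h i \in t, Q (h i), h' (h i) = i & F i = G (h i)]) ->
    (forall j, j \in t -> Q j -> [/\ h' j \in s, P (h' j) & h (h' j) = j]) ->
  \sum_(i <- s | P i) F i = \sum_(j <- t | Q j) G j.
Proof.
move=> s_uniq t_uniq hP h'P; rewrite -big_filter -[RHS]big_filter.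
have sP i : i \in [seq i <- s | P i] -> [/\ h i \in t, Q (h i), h' (h i) = i & F i = G (h i)].
  by rewrite mem_filter => /andP[Pi si]; apply: hP.
rewrite (eq_big_seq (G \o h)) => [|i /sP[]//].
rewrite -(big_map h predT G); apply: perm_big; apply: uniq_perm.
- rewrite map_inj_in_uniq ?filter_uniq // => i j /sP[_ _ hi _] /sP[_ _ hj _] hij.
  by rewrite -hi hij.
- exact: filter_uniq.
- move=> j; rewrite mem_filter; apply/mapP/andP => [[i /sP[ti Qi _ _] ->] //|[Qj tj]].
  by have [sj Pj hj] := h'P _ tj Qj; exists (h' j); rewrite ?mem_filter ?Pj.
Qed.

Definition irange (N : nat) : seq int := [seq i%:Z - N%:Z | i <- iota 0 (2 * N).+1].

Lemma mem_irange N (x : int) : (x \in irange N) = (- N%:Z <= x <= N%:Z).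
Proof.
apply/mapP/idP => [[j]|xN]; first by rewrite mem_iota => ? ->; lia.
by exists (absz (x + N%:Z)); rewrite ?mem_iota; lia.
Qed.

Lemma irange_uniq N : uniq (irange N).
Proof. by rewrite map_inj_uniq ?iota_uniq // => i j; lia. Qed.

Lemma mem_pairs (I J : eqType) (s : seq I) (t : seq J) x y :
  ((x, y) \in [seq (i, j) | i <- s, j <- t]) = (x \in s) && (y \in t).
Proof.
apply/allpairsP/andP => [[[i j] /= [si tj [-> ->]]] //|[sx ty]].
by exists (x, y).
Qed.

Definition ibox2 (N : nat) : seq (int * int) :=
  [seq (x, y) | x <- irange N, y <- irange N].

Definition ibox4 (N : nat) : seq ((int * int) * (int * int)) :=
  [seq (u, v) | u <- ibox2 N, v <- ibox2 N].

Lemma mem_ibox2 N (x y : int) :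
  ((x, y) \in ibox2 N) = (- N%:Z <= x <= N%:Z) && (- N%:Z <= y <= N%:Z).
Proof. by rewrite mem_pairs !mem_irange. Qed.

Lemma mem_ibox4 N u v : ((u, v) \in ibox4 N) = (u \in ibox2 N) && (v \in ibox2 N).
Proof. exact: mem_pairs. Qed.

Lemma ibox2_uniq N : uniq (ibox2 N).
Proof. by apply: allpairs_uniq; rewrite ?irange_uniq // => -[x y] [x' y']. Qed.

Lemma ibox4_uniq N : uniq (ibox4 N).
Proof. by apply: allpairs_uniq; rewrite ?ibox2_uniq // => -[x y] [x' y']. Qed.

Definition quads (n : nat) : seq ((int * int) * (int * int)) :=
  [seq t <- ibox4 n |
    [&& 0 < t.1.1, 0 < t.1.2, 0 < t.2.1, 0 < t.2.2
      & t.1.1 * t.2.1 + t.1.2 * t.2.2 == n%:Z]].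

Lemma quads_uniq n : uniq (quads n).
Proof. by rewrite filter_uniq ?ibox4_uniq. Qed.

Lemma mem_quads n (a b x y : int) : (((a, b), (x, y)) \in quads n) =
  [&& 0 < a, 0 < b, 0 < x, 0 < y & a * x + b * y == n%:Z].
Proof.
rewrite mem_filter /= mem_ibox4 !mem_ibox2 andb_idr //.
move=> /and5P[a0 b0 x0 y0 /eqP E].
have : a <= n%:Z /\ b <= n%:Z by split; nia.
have : x <= n%:Z /\ y <= n%:Z by split; nia.
by lia.
Qed.

(* [divisors 0] is [:: 1]. *)
Definition divs (n : nat) : seq nat := if n == 0%N then [::] else divisors n.

Lemma mem_divs n d : (d \in divs n) = (0 < n)%N && (d %| n)%N.
Proof. by rewrite /divs; case: n => [|n] /=; rewrite ?in_nil -?dvdn_divisors. Qed.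

Lemma divs_uniq n : uniq (divs n).
Proof. by rewrite /divs; case: eqP => // _; apply: divisors_uniq. Qed.

Definition sigma (k n : nat) : int := \sum_(d <- divs n) d%:Z ^+ k.

Lemma sigma0 k : sigma k 0 = 0. Proof. by rewrite /sigma big_nil. Qed.

(** A solution of a x + b y = n is determined by k = a x, the divisor a of k and the divisor b of n
    - k. *)
Lemma sum_quads_conv (i j n : nat) :
  \sum_(t <- quads n) t.1.1 ^+ i * t.1.2 ^+ j =
  \sum_(k < n.+1) sigma i k * sigma j (n - k).
Proof.
pose r := [seq (k, de) | k <- iota 0 n.+1,
  de <- [seq (d, e) | d <- divs k, e <- divs (n - k)]].
transitivity (\sum_(u <- r) u.2.1%:Z ^+ i * u.2.2%:Z ^+ j); last first.
  rewrite big_allpairs_dep -[iota _ _]/(index_iota 0 n.+1) big_mkord.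
  apply: eq_bigr => k _; rewrite big_allpairs_dep /sigma mulr_suml.
  by apply: eq_bigr => d _; rewrite mulr_sumr.
have memr k d e : ((k, (d, e)) \in r) = [&& (k <= n)%N, d \in divs k & e \in divs (n - k)].
  apply/allpairsPdep/and3P => [[k' [[d' e'] [kn + [-> -> ->]]]] | [lekn dk enk]].
    by rewrite mem_iota in kn; rewrite mem_pairs => /andP[]; split=> //; lia.
  by exists k, (d, e); rewrite mem_iota mem_pairs dk enk; split=> //; lia.
have r_uniq : uniq r.
  apply: allpairs_uniq_dep => [|k _|[k [d e]] [k' [d' e']] _ _ /= [-> -> ->]//].
    exact: iota_uniq.
  by apply: allpairs_uniq; rewrite ?divs_uniq // => -[x y] [x' y'].
apply: (@sum_bij _ _ _ _ _ xpredT xpredT _ _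
  (fun t => (absz (t.1.1 * t.2.1)%R, (absz t.1.1, absz t.1.2)))
  (fun u => ((u.2.1%:Z, u.2.2%:Z), ((u.1 %/ u.2.1)%N%:Z, ((n - u.1) %/ u.2.2)%N%:Z))));
  rewrite ?quads_uniq //=.
- move=> [[a b] [x y]]; rewrite mem_quads memr => /and5P[a0 b0 x0 y0 /eqP E] _ /=.
  have [a' aE] : exists a' : nat, a = a'.+1 by exists (absz a).-1; lia.
  have [b' bE] : exists a' : nat, b = a'.+1 by exists (absz b).-1; lia.
  have [x' xE] : exists a' : nat, x = a'.+1 by exists (absz x).-1; lia.
  have [y' yE] : exists a' : nat, y = a'.+1 by exists (absz y).-1; lia.
  subst; rewrite -!PoszM /= in E *.
  have -> : n = (a'.+1 * x'.+1 + b'.+1 * y'.+1)%N by lia.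
  by rewrite addKn !mulKn // !mem_divs !muln_gt0 !dvdn_mulr // leq_addr.
- move=> [k [d e]]; rewrite memr mem_quads => /and3P[lekn dk en] _ /=.
  move: dk en; rewrite !mem_divs => /andP[k0 /dvdnP[x kE]] /andP[nk0 /dvdnP[y nkE]].
  have [x0 d0] : (0 < x)%N /\ (0 < d)%N by apply/andP; rewrite -muln_gt0 -kE.
  have [y0 e0] : (0 < y)%N /\ (0 < e)%N by apply/andP; rewrite -muln_gt0 -nkE.
  rewrite kE in nkE lekn *; rewrite nkE !mulnK //.
  split=> //=; last by rewrite mulnC.
  by rewrite !ltz_nat d0 e0 x0 y0 /=; apply/eqP; lia.
Qed.

(* The bijection (a, b, x, y) -> (a, a + b, x - y, y) takes {x > y} to {b > a}. *)
Lemma sum_quads_shift n (F : int -> int -> int) :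
    (forall a b, F a b = F b a) -> (forall a b, F a (a + b) = F b (a + b)) ->
  \sum_(t <- quads n) (F t.1.1 (t.1.1 + t.1.2) - F t.1.1 t.1.2) =
  \sum_(t <- quads n | t.2.1 == t.2.2) F t.1.1 (t.1.1 + t.1.2)
  - \sum_(t <- quads n | t.1.1 == t.1.2) F t.1.1 t.1.2.
Proof.
move=> Fsym Fsym'; rewrite sumrB.
have split_sum (f : (int * int) * (int * int) -> int * int)
    (G : (int * int) * (int * int) -> int) :
    \sum_(t <- quads n | (f t).1 > (f t).2) G t = \sum_(t <- quads n | (f t).1 < (f t).2) G t ->
    \sum_(t <- quads n) G t = (\sum_(t <- quads n | (f t).1 < (f t).2) G t) *+ 2
      + \sum_(t <- quads n | (f t).1 == (f t).2) G t.
  move=> E; rewrite mulr2n (bigID (fun t => (f t).1 == (f t).2)) addrC /=; congr (_ + _).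
  rewrite (bigID (fun t => (f t).1 < (f t).2)) /=; congr (_ + _).
    by apply: eq_bigl => t; lia.
  by rewrite -E; apply: eq_bigl => t; lia.
pose swap (t : (int * int) * (int * int)) := ((t.1.2, t.1.1), (t.2.2, t.2.1)).
(* By the two symmetries of [F], each off-diagonal sum is twice one of its halves. The halves x > y
   and a < b then cancel under the bijection, and only the diagonals survive. *)
rewrite (split_sum (fun t => (t.2.2, t.2.1)) (fun t => F t.1.1 (t.1.1 + t.1.2))); last first.
  apply: (@sum_bij _ _ _ _ _ _ _ _ _ swap swap); rewrite ?quads_uniq //=.
    move=> [[a b] [x y]]; rewrite !mem_quads /= => H xy; split=> //; first by lia.
    by rewrite Fsym' [b + a]addrC.
  by move=> [[a b] [x y]]; rewrite !mem_quads /= => H xy; split=> //; lia.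
rewrite (split_sum (fun t => t.1) (fun t => F t.1.1 t.1.2)); last first.
  apply: (@sum_bij _ _ _ _ _ _ _ _ _ swap swap); rewrite ?quads_uniq //=.
    by move=> [[a b] [x y]]; rewrite !mem_quads /= => H xy; split=> //; lia.
  by move=> [[a b] [x y]]; rewrite !mem_quads /= => H xy; split=> //; lia.
rewrite /= (@sum_bij _ _ _ (quads n) (quads n) _ (fun t => t.1.1 < t.1.2) _ (fun t => F t.1.1 t.1.2)
  (fun t => ((t.1.1, t.1.1 + t.1.2), (t.2.1 - t.2.2, t.2.2)))
  (fun t => ((t.1.1, t.1.2 - t.1.1), (t.2.1 + t.2.2, t.2.2)))); rewrite ?quads_uniq //=.
- have -> : forall A B C : int, A *+ 2 + B - (A *+ 2 + C) = B - C by move=> *; ring.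
  by congr (_ - _); apply: eq_bigl => t; rewrite eq_sym.
- move=> [[a b] [x y]]; rewrite !mem_quads /= => /and5P[a0 b0 x0 y0 /eqP E] xy; split=> //.
  + by apply/and5P; split; try lia; apply/eqP; rewrite -E; ring.
  + by lia.
  + by congr ((_, _), (_, _)); ring.
- move=> [[a b] [x y]]; rewrite !mem_quads /= => /and5P[a0 b0 x0 y0 /eqP E] xy; split.
  + by apply/and5P; split; try lia; apply/eqP; rewrite -E; ring.
  + by lia.
  + by congr ((_, _), (_, _)); ring.
Qed.

(** For a = b = d the equation reads d (x + y) = n, which leaves n / d - 1 values of x. *)
Lemma sum_quads_diag_b n (F : int -> int -> int) :
  \sum_(t <- quads n | t.1.1 == t.1.2) F t.1.1 t.1.2 =
  \sum_(d <- divs n) ((n %/ d)%N%:Z - 1) * F d d.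
Proof.
pose r := [seq (d, x) | d <- divs n, x <- index_iota 1 (n %/ d)].
have memr d x : ((d, x) \in r) = (d \in divs n) && (0 < x < n %/ d)%N.
  apply/allpairsPdep/andP => [[d' [x' [dn + [-> ->]]]] | [dn xP]].
    by rewrite mem_index_iota.
  by exists d, x; rewrite mem_index_iota dn.
have r_uniq : uniq r.
  apply: allpairs_uniq_dep => [|k _|[k d] [k' d'] _ _ /= [-> ->]//]; first exact: divs_uniq.
  exact: iota_uniq.
transitivity (\sum_(u <- r) F u.1 u.1); last first.
  rewrite big_allpairs_dep; apply: eq_big_seq => d; rewrite mem_divs => /andP[n0 dn].
  have nd0 : (0 < n %/ d)%N.
    by rewrite divn_gt0; [apply: dvdn_leq | apply: dvdn_gt0 dn].
  by rewrite /= sumr_const_nat -mulr_natl; congr (_ * _); lia.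
apply: (@sum_bij _ _ _ _ _ _ xpredT _ _
  (fun t => (absz t.1.1, absz t.2.1))
  (fun u => ((u.1%:Z, u.1%:Z), (u.2%:Z, (n %/ u.1)%N%:Z - u.2%:Z))));
  rewrite ?quads_uniq //=.
- move=> [[a b] [x y]]; rewrite mem_quads memr /= => /and5P[a0 b0 x0 y0 /eqP E] /eqP ab.
  have [a' aE] : exists a' : nat, a = a'.+1 by exists (absz a).-1; lia.
  have [x' xE] : exists a' : nat, x = a'.+1 by exists (absz x).-1; lia.
  have [y' yE] : exists a' : nat, y = a'.+1 by exists (absz y).-1; lia.
  subst b a x y; rewrite /= mem_divs.
  have -> : n = ((x'.+1 + y'.+1) * a'.+1)%N by lia.
  rewrite mulnK // muln_gt0 dvdn_mull //; split=> //; first by lia.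
  by congr ((_, _), (_, _)); lia.
- move=> [d x]; rewrite memr mem_quads mem_divs /= => /andP[/andP[n0 /dvdnP[y nE]] xy] _.
  have [y0 d0] : (0 < y)%N /\ (0 < d)%N by apply/andP; rewrite -muln_gt0 -nE.
  rewrite nE !mulnK // in xy *.
  by split=> //=; apply/and5P; split; try lia; apply/eqP; lia.
Qed.

(** For x = y the equation reads x (a + b) = n: here d = a + b is the divisor and i = a runs below
    it. *)
Lemma sum_quads_diag_y n (F : int -> int -> int) :
  \sum_(t <- quads n | t.2.1 == t.2.2) F t.1.1 (t.1.1 + t.1.2) =
  \sum_(d <- divs n) \sum_(1 <= i < d) F i d.
Proof.
pose r := [seq (d, x) | d <- divs n, x <- index_iota 1 d].
have memr d x : ((d, x) \in r) = (d \in divs n) && (0 < x < d)%N.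
  apply/allpairsPdep/andP => [[d' [x' [dn + [-> ->]]]] | [dn xP]].
    by rewrite mem_index_iota.
  by exists d, x; rewrite mem_index_iota.
have r_uniq : uniq r.
  apply: allpairs_uniq_dep => [|k _|[k d] [k' d'] _ _ /= [-> ->]//]; first exact: divs_uniq.
  exact: iota_uniq.
transitivity (\sum_(u <- r) F u.2 u.1); last by rewrite big_allpairs_dep.
apply: (@sum_bij _ _ _ _ _ _ xpredT _ _
  (fun t => (absz (t.1.1 + t.1.2), absz t.1.1))
  (fun u => ((u.2%:Z, u.1%:Z - u.2%:Z), ((n %/ u.1)%N%:Z, (n %/ u.1)%N%:Z))));
  rewrite ?quads_uniq //=.
- move=> [[a b] [x y]]; rewrite mem_quads memr /= => /and5P[a0 b0 x0 y0 /eqP E] /eqP xy.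
  have [a' aE] : exists a' : nat, a = a'.+1 by exists (absz a).-1; lia.
  have [x' xE] : exists a' : nat, x = a'.+1 by exists (absz x).-1; lia.
  have [b' bE] : exists a' : nat, b = a'.+1 by exists (absz b).-1; lia.
  subst b a y x; rewrite /= mem_divs.
  have -> : n = (x'.+1 * (a'.+1 + b'.+1))%N by lia.
  rewrite mulnK // muln_gt0 dvdn_mull //; split=> //; first by lia.
  by congr ((_, _), (_, _)); lia.
- move=> [d x]; rewrite memr mem_quads mem_divs /= => /andP[/andP[n0 /dvdnP[y nE]] xd] _.
  have [y0 d0] : (0 < y)%N /\ (0 < d)%N by apply/andP; rewrite -muln_gt0 -nE.
  rewrite nE !mulnK //.
  split=> //=; last by congr pair; lia.
  by apply/and5P; split; try lia; apply/eqP; lia.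
Qed.

Lemma divisor_codivisor_sum k n :
  \sum_(d <- divs n) ((n %/ d)%N%:Z - 1) * d%:Z ^+ k.+1 = n%:Z * sigma k n - sigma k.+1 n.
Proof.
rewrite /sigma mulr_sumr -sumrB; apply: eq_big_seq => d; rewrite mem_divs => /andP[n0 /dvdnP[y nE]].
have d0 : (0 < d)%N by move: n0; rewrite nE muln_gt0 => /andP[].
by rewrite nE mulnK // PoszM exprS; ring.
Qed.


(** Faulhaber's formulas up to degree 6. The factor 420 is the least common multiple of their
    denominators 2, 6, 4, 30, 12 and 42, so that everything stays in [int]. *)
Lemma sum_poly6 (c0 c1 c2 c3 c4 c5 c6 : int) (m : nat) : let M := m%:Z in
  420 * \sum_(1 <= i < m.+1) (c0 + c1 * i%:Z + c2 * i%:Z ^+ 2 + c3 * i%:Z ^+ 3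
     + c4 * i%:Z ^+ 4 + c5 * i%:Z ^+ 5 + c6 * i%:Z ^+ 6) =
  420 * c0 * M + 210 * c1 * (M * (M + 1)) + 70 * c2 * (M * (M + 1) * (2 * M + 1))
  + 105 * c3 * (M * (M + 1)) ^+ 2
  + 14 * c4 * (M * (M + 1) * (2 * M + 1) * (3 * M ^+ 2 + 3 * M - 1))
  + 35 * c5 * ((M * (M + 1)) ^+ 2 * (2 * M ^+ 2 + 2 * M - 1))
  + 10 * c6 * (M * (M + 1) * (2 * M + 1) * (3 * M ^+ 4 + 6 * M ^+ 3 - 3 * M + 1)).
Proof.
elim: m => [|m IHm] M; first by rewrite big_geq // /M; ring.
by rewrite big_nat_recr //= mulrDr {}IHm /M -natr1 natz; ring.
Qed.

Definition sigma_fps (k : nat) : fps int := fun n => sigma k n.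

Lemma quads_sum_conv i j n :
  \sum_(t <- quads n) t.1.1 ^+ i * t.1.2 ^+ j = (sigma_fps i * sigma_fps j) n.
Proof. by rewrite sum_quads_conv fps_coefM. Qed.

(** Powers of this form meet both symmetry hypotheses of [sum_quads_shift], since its value at (a, a
    + b) is a^2 + a b + b^2. The differences (a^2 + a b + b^2)^m - (a^2 - a b + b^2)^m contain only
    products of odd powers of a and b, hence lead to convolutions of odd divisor sums. *)
Definition hexform (a b : int) : int := a ^+ 2 - a * b + b ^+ 2.

Lemma sum_quads_hexform e n :
  \sum_(t <- quads n) (hexform t.1.1 (t.1.1 + t.1.2) ^+ e.+1 - hexform t.1.1 t.1.2 ^+ e.+1)
  = \sum_(d <- divs n) \sum_(1 <= i < d) hexform i d ^+ e.+1
    - (n%:Z * sigma (2 * e).+1 n - sigma (2 * e).+2 n).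
Proof.
rewrite (sum_quads_shift n (F := fun a b => hexform a b ^+ e.+1)).
- rewrite (sum_quads_diag_y n (fun a b => hexform a b ^+ e.+1)).
  rewrite (sum_quads_diag_b n (fun a b => hexform a b ^+ e.+1)).
  rewrite -divisor_codivisor_sum; congr (_ - _); apply: eq_bigr => d _; congr (_ * _).
  by rewrite /hexform -[(2 * e).+2]/(2 + 2 * e)%N -mulnS exprM; congr (_ ^+ _); ring.
- by move=> a b; congr (_ ^+ _); rewrite /hexform; ring.
- by move=> a b; congr (_ ^+ _); rewrite /hexform; ring.
Qed.

Lemma divs_gt0 n d : d \in divs n -> (0 < d)%N.
Proof. by rewrite mem_divs => /andP[n0 /dvdn_gt0->]. Qed.

Lemma sum_hexform1 n :
  420 * \sum_(d <- divs n) \sum_(1 <= i < d) hexform i d ^+ 1 =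
  350 * sigma 3 n - 420 * sigma 2 n + 70 * sigma 1 n.
Proof.
rewrite /sigma !mulr_sumr -sumrB -big_split /=; apply: eq_big_seq => -[/divs_gt0//|m] _.
pose D : int := m.+1.
transitivity (420 * \sum_(1 <= i < m.+1) (D ^+ 2 + (- D) * i%:Z + 1 * i%:Z ^+ 2 + 0 * i%:Z ^+ 3
     + 0 * i%:Z ^+ 4 + 0 * i%:Z ^+ 5 + 0 * i%:Z ^+ 6)).
  by congr (_ * _); apply: eq_bigr => i _; rewrite /hexform -/D; ring.
by rewrite sum_poly6 /D -natr1 natz; ring.
Qed.

Lemma sum_hexform2 n :
  420 * \sum_(d <- divs n) \sum_(1 <= i < d) hexform i d ^+ 2 =
  294 * sigma 5 n - 420 * sigma 4 n + 140 * sigma 3 n - 14 * sigma 1 n.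
Proof.
rewrite /sigma !mulr_sumr -sumrB -big_split -sumrB /=; apply: eq_big_seq => -[/divs_gt0//|m] _.
pose D : int := m.+1.
transitivity (420 * \sum_(1 <= i < m.+1) (D ^+ 4 + (- 2 * D ^+ 3) * i%:Z
     + (3 * D ^+ 2) * i%:Z ^+ 2 + (- 2 * D) * i%:Z ^+ 3
     + 1 * i%:Z ^+ 4 + 0 * i%:Z ^+ 5 + 0 * i%:Z ^+ 6)).
  by congr (_ * _); apply: eq_bigr => i _; rewrite /hexform -/D; ring.
by rewrite sum_poly6 /D -natr1 natz; ring.
Qed.

Lemma sum_hexform3 n :
  420 * \sum_(d <- divs n) \sum_(1 <= i < d) hexform i d ^+ 3 =
  249 * sigma 7 n - 420 * sigma 6 n + 210 * sigma 5 n - 49 * sigma 3 n + 10 * sigma 1 n.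
Proof.
rewrite /sigma !mulr_sumr -sumrB -big_split -sumrB -big_split /=.
apply: eq_big_seq => -[/divs_gt0//|m] _.
pose D : int := m.+1.
transitivity (420 * \sum_(1 <= i < m.+1) (D ^+ 6 + (- 3 * D ^+ 5) * i%:Z
     + (6 * D ^+ 4) * i%:Z ^+ 2 + (- 7 * D ^+ 3) * i%:Z ^+ 3
     + (6 * D ^+ 2) * i%:Z ^+ 4 + (- 3 * D) * i%:Z ^+ 5 + 1 * i%:Z ^+ 6)).
  by congr (_ * _); apply: eq_bigr => i _; rewrite /hexform -/D; ring.
by rewrite sum_poly6 /D -natr1 natz; ring.
Qed.

Lemma conv_sigma11 n :
  12 * (sigma_fps 1 * sigma_fps 1) n = 5 * sigma 3 n - 6 * (n%:Z * sigma 1 n) + sigma 1 n.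
Proof.
have H := sum_quads_hexform 0 n; rewrite -[(2 * 0)%N]/0%N in H.
have H1 := sum_hexform1 n.
rewrite (eq_bigr (fun t => 2 * (t.1.1 ^+ 1 * t.1.2 ^+ 1))) -?mulr_sumr ?quads_sum_conv in H; last first.
  by move=> t _; rewrite /hexform; ring.
by lia.
Qed.

Lemma conv_sigma13 n :
  240 * (sigma_fps 1 * sigma_fps 3) n =
  21 * sigma 5 n - 30 * (n%:Z * sigma 3 n) + 10 * sigma 3 n - sigma 1 n.
Proof.
have H := sum_quads_hexform 1 n; rewrite -[(2 * 1)%N]/2%N in H.
have H2 := sum_hexform2 n.
rewrite (eq_bigr (fun t => 4 * (t.1.1 ^+ 1 * t.1.2 ^+ 3) + 4 * (t.1.1 ^+ 3 * t.1.2 ^+ 1))) in H;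
  last by move=> t _; rewrite /hexform; ring.
rewrite big_split -!mulr_sumr !quads_sum_conv [sigma_fps 3 * _]mulrC /= in H.
by lra.
Qed.

Lemma conv_sigma33 n :
  120 * (sigma_fps 3 * sigma_fps 3) n = sigma 7 n - sigma 3 n.
Proof.
(* This test function vanishes for a = b, and F a (a + b) - F a b = a^2 b^2 ((a + b)^2 - (a - b)^2)
   is a multiple of a^3 b^3 alone. *)
pose F (a b : int) := (a * b * (a - b)) ^+ 2.
have H := @sum_quads_shift n F.
rewrite (sum_quads_diag_y n F) (sum_quads_diag_b n F) in H.
rewrite (eq_bigr (fun t => 4 * (t.1.1 ^+ 3 * t.1.2 ^+ 3))) in H;
  last by move=> t _; rewrite /F; ring.
rewrite -mulr_sumr quads_sum_conv [X in _ - X]big1 ?subr0 in H; last first.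
  by move=> d _; rewrite /F; ring.
have -> : 120 * (sigma_fps 3 * sigma_fps 3) n = 30 * (4 * (sigma_fps 3 * sigma_fps 3) n) by ring.
rewrite H; [|by move=> a b; rewrite /F; ring ..].
suff : 420 * \sum_(d <- divs n) \sum_(1 <= i < d) F i d = 14 * sigma 7 n - 14 * sigma 3 n by lra.
rewrite /sigma !mulr_sumr -sumrB /=; apply: eq_big_seq => -[/divs_gt0//|m] _.
pose D : int := m.+1.
transitivity (420 * \sum_(1 <= i < m.+1) (0 + 0 * i%:Z
     + D ^+ 4 * i%:Z ^+ 2 + (- 2 * D ^+ 3) * i%:Z ^+ 3
     + D ^+ 2 * i%:Z ^+ 4 + 0 * i%:Z ^+ 5 + 0 * i%:Z ^+ 6)).
  by congr (_ * _); apply: eq_bigr => i _; rewrite /F -/D; ring.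
by rewrite sum_poly6 /D -natr1 natz; ring.
Qed.

(** The cube of [hexform] brings in [sigma 7]. It is eliminated with [conv_sigma33], which is E4^2 =
    E8 in coefficients, and this leaves the combination that occurs in E2 E6 - E4^2. *)
Lemma conv_sigma15_33 n :
  504 * (sigma_fps 1 * sigma_fps 5) n - 2400 * (sigma_fps 3 * sigma_fps 3) n =
  21 * sigma 5 n + 20 * sigma 3 n + sigma 1 n - 42 * (n%:Z * sigma 5 n).
Proof.
have H := sum_quads_hexform 2 n; rewrite -[(2 * 2)%N]/4%N in H.
have H3 := sum_hexform3 n.
have H33 := conv_sigma33 n.
rewrite (eq_bigr (fun t => 6 * (t.1.1 ^+ 1 * t.1.2 ^+ 5) + 6 * (t.1.1 ^+ 5 * t.1.2 ^+ 1)
   + 14 * (t.1.1 ^+ 3 * t.1.2 ^+ 3))) in H;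
  last by move=> t _; rewrite /hexform; ring.
rewrite !big_split -!mulr_sumr !quads_sum_conv [sigma_fps 5 * _]mulrC /= in H.
by lra.
Qed.

(** * Ramanujan's differential equations *)

Definition E2 : fps int := 1 - 24%:R * sigma_fps 1.
Definition E4 : fps int := 1 + 240%:R * sigma_fps 3.
Definition E6 : fps int := 1 - 504%:R * sigma_fps 5.

Lemma theta_sigma_fps k n : fps_theta (sigma_fps k) n = n%:Z * sigma k n.
Proof. by rewrite /fps_theta -mulr_natl natz. Qed.

Section RamanujanAlgebra.
Variables (A : comNzRingType) (s1 s3 s5 t1 t3 t5 : A).
Let e2 := 1 - 24%:R * s1.
Let e4 := 1 + 240%:R * s3.
Let e6 := 1 - 504%:R * s5.

(** Here [t1] stands for the derivative of [s1], and the summand [0] for that of the constant term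
    1. *)
Lemma ramanujan_alg2 : 12%:R * (s1 * s1) = 5%:R * s3 - 6%:R * t1 + s1 ->
  12%:R * (0 - 24%:R * t1) = e2 ^+ 2 - e4.
Proof.
move=> E; transitivity (48%:R * (12%:R * (s1 * s1)) - 48%:R * s1 - 240%:R * s3).
  by rewrite E; ring.
by rewrite /e2 /e4; ring.
Qed.

Lemma ramanujan_alg4 :
    240%:R * (s1 * s3) = 21%:R * s5 - 30%:R * t3 + 10%:R * s3 - s1 ->
  3%:R * (0 + 240%:R * t3) = e2 * e4 - e6.
Proof.
move=> E.
transitivity (- 24%:R * (240%:R * (s1 * s3)) - 24%:R * s1 + 240%:R * s3 + 504%:R * s5).
  by rewrite E; ring.
by rewrite /e2 /e4 /e6; ring.
Qed.

Lemma ramanujan_alg6 :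
    504%:R * (s1 * s5) - 2400%:R * (s3 * s3) = 21%:R * s5 + 20%:R * s3 + s1 - 42%:R * t5 ->
  2%:R * (0 - 504%:R * t5) = e2 * e6 - e4 ^+ 2.
Proof.
move=> E; transitivity (24%:R * (504%:R * (s1 * s5) - 2400%:R * (s3 * s3))
   - 24%:R * s1 - 504%:R * s5 - 480%:R * s3); first by rewrite E; ring.
by rewrite /e2 /e4 /e6; ring.
Qed.

End RamanujanAlgebra.

Lemma ramanujan_E2 : 12%:R * fps_theta E2 = E2 ^+ 2 - E4.
Proof.
have E : 12%:R * (sigma_fps 1 * sigma_fps 1) =
    5%:R * sigma_fps 3 - 6%:R * fps_theta (sigma_fps 1) + sigma_fps 1.
  apply/funext => n.
  by rewrite fps_coefD fps_coefB !fps_coef_natM theta_sigma_fps conv_sigma11.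
rewrite /E2 fps_thetaB (fps_theta_nat int 1) fps_theta_natM.
exact: ramanujan_alg2 E.
Qed.

Lemma ramanujan_E4 : 3%:R * fps_theta E4 = E2 * E4 - E6.
Proof.
have E : 240%:R * (sigma_fps 1 * sigma_fps 3) =
    21%:R * sigma_fps 5 - 30%:R * fps_theta (sigma_fps 3) + 10%:R * sigma_fps 3 - sigma_fps 1.
  apply/funext => n.
  by rewrite fps_coefB fps_coefD fps_coefB !fps_coef_natM theta_sigma_fps conv_sigma13.
rewrite /E4 fps_thetaD (fps_theta_nat int 1) fps_theta_natM.
exact: ramanujan_alg4 E.
Qed.

Lemma ramanujan_E6 : 2%:R * fps_theta E6 = E2 * E6 - E4 ^+ 2.
Proof.
have lift_coef (a b c d e : nat) :
    (forall n, a%:R * (sigma_fps 1 * sigma_fps 5) n - b%:R * (sigma_fps 3 * sigma_fps 3) n =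
       c%:R * sigma 5 n + d%:R * sigma 3 n + sigma 1 n - e%:R * (n%:Z * sigma 5 n)) ->
    a%:R * (sigma_fps 1 * sigma_fps 5) - b%:R * (sigma_fps 3 * sigma_fps 3) =
    c%:R * sigma_fps 5 + d%:R * sigma_fps 3 + sigma_fps 1 - e%:R * fps_theta (sigma_fps 5).
  move=> E; apply/funext => n.
  by rewrite fps_coefB [RHS]fps_coefB !fps_coefD !fps_coef_natM theta_sigma_fps E.
have E := lift_coef 504%N 2400%N 21%N 20%N 42%N conv_sigma15_33.
rewrite /E6 fps_thetaB (fps_theta_nat int 1) fps_theta_natM.
exact: ramanujan_alg6 E.
Qed.

(** * The differential equation of the hexagonal theta series *)

Definition hexQ (x y : int) : int := x ^+ 2 + y ^+ 2 + x * y.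

Lemma hexQ_ge0 x y : 0 <= hexQ x y.
Proof. by rewrite /hexQ; nia. Qed.

Lemma hexQ_bound (x y n : int) : hexQ x y <= n -> [&& - n <= x <= n & - n <= y <= n].
Proof.
move=> le_n; have n_ge0 : 0 <= n by apply: le_trans le_n; apply: hexQ_ge0.
have [x2 y2] : 3 * (x * x) <= 4 * n /\ 3 * (y * y) <= 4 * n.
  have := sqr_ge0 (x + 2 * y); have := sqr_ge0 (2 * x + y).
  by move: le_n; rewrite /hexQ; split; lra.
clear le_n.
suff bound (z : int) : 3 * (z * z) <= 4 * n -> - n <= z <= n by rewrite !bound.
by move=> z2; clear x2 y2; apply/andP; split; nia.
Qed.

Definition hexvecs (n : nat) : seq (int * int) :=
  [seq v <- ibox2 n | hexQ v.1 v.2 == n%:Z].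

Lemma mem_hexvecs n x y : ((x, y) \in hexvecs n) = (hexQ x y == n%:Z).
Proof.
rewrite mem_filter /= mem_ibox2 andb_idr // => /eqP E.
by apply: hexQ_bound; rewrite E.
Qed.

Lemma hexvecs_uniq n : uniq (hexvecs n).
Proof. by rewrite filter_uniq ?ibox2_uniq. Qed.

Definition hexquads (n : nat) : seq ((int * int) * (int * int)) :=
  [seq t <- ibox4 n | [&& 0 < t.1.1, 0 < t.1.2
     & t.1.1 * t.1.2 + hexQ t.2.1 t.2.2 == n%:Z]].

Lemma mem_hexquads n d e x y : (((d, e), (x, y)) \in hexquads n) =
  [&& 0 < d, 0 < e & d * e + hexQ x y == n%:Z].
Proof.
rewrite mem_filter /= mem_ibox4 !mem_ibox2 andb_idr // => /and3P[d0 e0 /eqP E].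
have Q0 := hexQ_ge0 x y.
have de_gt0 : 0 < d * e by rewrite mulr_gt0.
rewrite (@hexQ_bound x y) ?andbT; last by rewrite -E lerDr ltW.
have : d <= n%:Z /\ e <= n%:Z.
  have : d * e <= n%:Z by rewrite -E lerDl.
  by move: n%:Z => m dem; clear E Q0 de_gt0; split; nia.
by lia.
Qed.

Lemma hexquads_uniq n : uniq (hexquads n).
Proof. by rewrite filter_uniq ?ibox4_uniq. Qed.

Definition theta_hex : fps int := fun n => (size (hexvecs n))%:Z.

Lemma sumr_const_seq (V : nmodType) (I : Type) (s : seq I) (x : V) :
  \sum_(i <- s) x = x *+ size s.
Proof. by rewrite big_const_seq count_predT iter_addr_0. Qed.

Lemma sum_hexquads_conv (F : int -> int -> int) n :
  \sum_(t <- hexquads n) t.1.1 * F (t.1.1 * t.1.2) (hexQ t.2.1 t.2.2) =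
  \sum_(m < n.+1) (sigma 1 m) * theta_hex (n - m)%N * F m (n - m)%N.
Proof.
pose r := [seq (m, dv) | m <- iota 0 n.+1,
  dv <- [seq (d, v) | d <- divs m, v <- hexvecs (n - m)]].
transitivity (\sum_(u <- r) u.2.1%:Z * F u.1 (n - u.1)%N); last first.
  rewrite big_allpairs_dep -[iota _ _]/(index_iota 0 n.+1) big_mkord.
  apply: eq_bigr => m _; rewrite big_allpairs_dep /sigma !mulr_suml.
  apply: eq_bigr => d _ /=; rewrite /theta_hex expr1.
  rewrite sumr_const_seq -mulr_natr natz. ring.
have memr m d v : ((m, (d, v)) \in r) =
    [&& (m <= n)%N, d \in divs m & v \in hexvecs (n - m)].
  apply/allpairsPdep/and3P => [[m' [[d' v'] [mn + [-> -> ->]]]] | [lemn dm vnm]].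
    by rewrite mem_iota in mn; rewrite mem_pairs => /andP[]; split=> //; lia.
  by exists m, (d, v); rewrite mem_iota mem_pairs dm vnm; split=> //; lia.
have r_uniq : uniq r.
  apply: allpairs_uniq_dep => [|m _|[k [d e]] [k' [d' e']] _ _ /= [-> -> ->]//].
    exact: iota_uniq.
  by apply: allpairs_uniq; rewrite ?divs_uniq ?hexvecs_uniq // => -[x y] [x' y'].
apply: (@sum_bij _ _ _ _ _ xpredT xpredT _ _
  (fun t => (absz (t.1.1 * t.1.2)%R, (absz t.1.1, t.2)))
  (fun u => ((u.2.1%:Z, (u.1 %/ u.2.1)%N%:Z), u.2.2)));
  rewrite ?hexquads_uniq //=.
- move=> [[d e] [x y]]; rewrite mem_hexquads memr mem_hexvecs => /and3P[d0 e0 /eqP E] _ /=.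
  have [d' dE] : exists d' : nat, d = d'.+1 by exists (absz d).-1; lia.
  have [e' eE] : exists e' : nat, e = e'.+1 by exists (absz e).-1; lia.
  subst; have Q0 := hexQ_ge0 x y; move: (hexQ x y) E Q0 => Q E Q0.
  rewrite -!PoszM /= in E *.
  have le_n : (d'.+1 * e'.+1 <= n)%N by lia.
  rewrite mem_divs muln_gt0 dvdn_mulr // mulKn //.
  have -> : Q = (n - d'.+1 * e'.+1)%N%:Z by lia.
  by rewrite le_n eqxx.
- move=> [m [d [x y]]]; rewrite memr mem_hexquads mem_hexvecs => /and3P[lemn dm /eqP E] _ /=.
  move: dm; rewrite !mem_divs => /andP[m0 /dvdnP[e mE]].
  have [e0 d0] : (0 < e)%N /\ (0 < d)%N by apply/andP; rewrite -muln_gt0 -mE.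
  rewrite mE in E lemn *; rewrite mulnK // E.
  split=> //=; last by rewrite mulnC.
  by rewrite !ltz_nat d0 e0 /=; apply/eqP; lia.
Qed.

(* With s = 2 x + y one has s ^ 2 + 4 d e = 4 n - 3 y ^ 2 on [hexquads n], and y is
   fixed by both maps: [hexquad_swap] exchanges the signs of d + s - e, and
   [hexquad_flip] is an involution of the part d + s < e that changes the sign of
   the weight. *)
Definition hexquad_weight (t : (int * int) * (int * int)) : int :=
  let s := 2 * t.2.1 + t.2.2 in (t.1.1 + t.1.2) * (t.1.2 - s) * (t.1.1 + s).
Definition hexquad_swap (t : (int * int) * (int * int)) : (int * int) * (int * int) :=
  ((t.1.2, t.1.1), (- t.2.1 - t.2.2, t.2.2)).
Definition hexquad_flip (t : (int * int) * (int * int)) : (int * int) * (int * int) :=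
  ((t.1.1, t.1.2 - (2 * t.2.1 + t.2.2) - t.1.1), (- t.2.1 - t.2.2 - t.1.1, t.2.2)).

Lemma sum_weight_boundary n :
  \sum_(t <- hexquads n) hexquad_weight t =
  \sum_(t <- hexquads n | t.1.1 + (2 * t.2.1 + t.2.2) == t.1.2) hexquad_weight t.
Proof.
pose c (t : (int * int) * (int * int)) : int := t.1.1 + (2 * t.2.1 + t.2.2).
have gt_lt : \sum_(t <- hexquads n | c t > t.1.2) hexquad_weight t =
             \sum_(t <- hexquads n | c t < t.1.2) hexquad_weight t.
  apply: (@sum_bij _ _ _ _ _ _ _ _ _ hexquad_swap hexquad_swap); rewrite ?hexquads_uniq //.
    move=> [[d e] [x y]]; rewrite !mem_hexquads /c /hexquad_swap /hexquad_weight /=.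
    move=> /and3P[d0 e0 /eqP E] dse; split; [| by lia | |].
    - by rewrite d0 e0 -E; apply/eqP; rewrite /hexQ; ring.
    - by congr ((_, _), (_, _)); ring.
    - by ring.
  move=> [[d e] [x y]]; rewrite !mem_hexquads /c /hexquad_swap /=.
  move=> /and3P[d0 e0 /eqP E] dse; split; [| by lia |].
  - by rewrite d0 e0 -E; apply/eqP; rewrite /hexQ; ring.
  - by congr ((_, _), (_, _)); ring.
have lt_opp : \sum_(t <- hexquads n | c t < t.1.2) hexquad_weight t =
             \sum_(t <- hexquads n | c t < t.1.2) - hexquad_weight t.
  apply: (@sum_bij _ _ _ _ _ _ _ _ _ hexquad_flip hexquad_flip); rewrite ?hexquads_uniq //.
    move=> [[d e] [x y]]; rewrite !mem_hexquads /c /hexquad_flip /hexquad_weight /=.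
    move=> /and3P[d0 e0 /eqP E] dse; split; [| by lia | |].
    - rewrite d0 /=; apply/andP; split; first by lia.
      by rewrite -E; apply/eqP; rewrite /hexQ; ring.
    - by congr ((_, _), (_, _)); ring.
    - by ring.
  move=> [[d e] [x y]]; rewrite !mem_hexquads /c /hexquad_flip /=.
  move=> /and3P[d0 e0 /eqP E] dse; split; [| by lia |].
  - rewrite d0 /=; apply/andP; split; first by lia.
    by rewrite -E; apply/eqP; rewrite /hexQ; ring.
  - by congr ((_, _), (_, _)); ring.
have lt0 : \sum_(t <- hexquads n | c t < t.1.2) hexquad_weight t = 0.
  by apply/eqP; move/eqP: lt_opp; rewrite sumrN -addr_eq0 -mulr2n mulrn_eq0.
rewrite (bigID (fun t => c t == t.1.2)) /= [X in _ + X](bigID (fun t => c t < t.1.2)) /=.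
rewrite [X in _ + (X + _)](_ : _ = 0) ?add0r; last first.
  by rewrite -[RHS]lt0; apply: eq_bigl => t; lia.
rewrite [X in _ + X](_ : _ = 0) ?addr0 // -[RHS]lt0 -gt_lt.
by apply: eq_bigl => t; lia.
Qed.

Lemma sum_quadratic_weight (s : nat) :
  6 * \sum_(1 <= i < s) s%:Z * (i%:Z * (s%:Z - i%:Z)) = s%:Z ^+ 4 - s%:Z ^+ 2.
Proof.
have sum_gen (D : int) m : 6 * \sum_(1 <= i < m.+1) D * (i%:Z * (D - i%:Z)) =
    D * (m%:Z * (m%:Z + 1) * (3 * D - (2 * m%:Z + 1))).
  elim: m => [|m IHm]; first by rewrite big_geq //; ring.
  by rewrite big_nat_recr //= mulrDr {}IHm -natr1 natz; ring.
case: s => [|m]; first by rewrite big_geq //; ring.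
by rewrite sum_gen -natr1 natz; ring.
Qed.

(** On the boundary e = d + s, the vector v = (x + d, y) satisfies Q(v) = Q(x, y) + d e = n and s(v)
    = d + e, and the weight is s(v) d (s(v) - d). Hence the boundary is parametrized by the v with
    s(v) > 0 and by 1 <= d < s(v). The constant 12 is 6 from [sum_quadratic_weight] times 2 for the
    symmetry v -> - v. *)
Lemma sum_weight n :
  12 * \sum_(t <- hexquads n) hexquad_weight t =
  \sum_(v <- hexvecs n) ((2 * v.1 + v.2) ^+ 4 - (2 * v.1 + v.2) ^+ 2).
Proof.
pose s (v : int * int) : int := 2 * v.1 + v.2.
pose r := [seq (v, i) | v <- [seq v <- hexvecs n | 0 < s v], i <- index_iota 1 (absz (s v))].
have memr v i : ((v, i) \in r) = [&& v \in hexvecs n, 0 < s v & (0 < i < absz (s v))%N].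
  apply/allpairsPdep/and3P => [[v' [i' [+ + [-> ->]]]] | [vn s0 iP]].
    by rewrite mem_filter mem_index_iota => /andP[].
  by exists v, i; rewrite mem_filter mem_index_iota s0.
have r_uniq : uniq r.
  apply: allpairs_uniq_dep => [|v _|[k d] [k' d'] _ _ /= [-> ->]//].
    by rewrite filter_uniq ?hexvecs_uniq.
  exact: iota_uniq.
have -> : \sum_(t <- hexquads n) hexquad_weight t =
    \sum_(v <- hexvecs n | 0 < s v) \sum_(1 <= i < absz (s v)) s v * (i%:Z * (s v - i%:Z)).
  rewrite sum_weight_boundary -[RHS]big_filter.
  transitivity (\sum_(u <- r) s u.1 * (u.2%:Z * (s u.1 - u.2%:Z))); last by rewrite big_allpairs_dep.
  apply: (@sum_bij _ _ _ _ _ _ xpredT _ _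
    (fun t => ((t.2.1 + t.1.1, t.2.2), absz t.1.1))
    (fun u => ((u.2%:Z, s u.1 - u.2%:Z), (u.1.1 - u.2%:Z, u.1.2))));
    rewrite ?hexquads_uniq //.
  - move=> [[d e] [x y]]; rewrite mem_hexquads memr mem_hexvecs /s /=.
    move=> /and3P[d0 e0 /eqP E] /eqP dse; split=> //; try lia.
    + apply/and3P; split; try lia.
      by rewrite -E -dse; apply/eqP; rewrite /hexQ; ring.
    + by congr ((_, _), (_, _)); lia.
    + by rewrite gez0_abs 1?ltW // /hexquad_weight /= -dse; ring.
  - move=> [[x y] i]; rewrite memr mem_hexquads mem_hexvecs /s /=.
    move=> /and3P[/eqP E s0 iP] _; split=> //; try lia.
    + apply/and3P; split; try lia.
      by rewrite -E; apply/eqP; rewrite /hexQ; ring.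
    + by congr ((_, _), _); ring.
have neg : \sum_(v <- hexvecs n | s v < 0) (s v ^+ 4 - s v ^+ 2) =
           \sum_(v <- hexvecs n | 0 < s v) (s v ^+ 4 - s v ^+ 2).
  apply: (@sum_bij _ _ _ _ _ _ _ _ _ (fun v => (- v.1, - v.2)) (fun v => (- v.1, - v.2)));
    rewrite ?hexvecs_uniq //.
    move=> [x y]; rewrite !mem_hexvecs /s /= => /eqP E s0; split; [| by lia | |].
    - by rewrite -E; apply/eqP; rewrite /hexQ; ring.
    - by rewrite !opprK.
    - by ring.
  move=> [x y]; rewrite !mem_hexvecs /s /= => /eqP E s0; split; [| by lia |].
    by rewrite -E; apply/eqP; rewrite /hexQ; ring.
  by rewrite !opprK.
transitivity (2 * \sum_(v <- hexvecs n | 0 < s v) (s v ^+ 4 - s v ^+ 2)).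
  rewrite -[12]/((2 * 6) : int) -mulrA; congr (_ * _); rewrite mulr_sumr.
  by apply: eq_bigr => v s0; have := sum_quadratic_weight (absz (s v)); rewrite gtz0_abs.
rewrite [RHS](bigID (fun v => 0 < s v)) /= [X in _ = _ + X](bigID (fun v => s v < 0)) /=.
rewrite [X in _ = _ + (_ + X)]big1 ?addr0; last first.
  by move=> v /andP[s1 s2]; have -> : 2 * v.1 + v.2 = 0; [move: s1 s2; rewrite /s; lia | ring].
rewrite [X in _ = _ + X](_ : _ = \sum_(v <- hexvecs n | 0 < s v) (s v ^+ 4 - s v ^+ 2)).
  by rewrite mulrDl !mul1r.
by rewrite -neg; apply: eq_bigl => v; lia.
Qed.

(** The weight equals (d + e) (d e - s^2) + (d + e) s (e - d). The second part is odd under s -> -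
    s, and exchanging d and e replaces d + e by 2 d in the first. *)
Lemma sum_hexquads_direction n :
  24 * \sum_(t <- hexquads n) t.1.1 * (t.1.1 * t.1.2 - (2 * t.2.1 + t.2.2) ^+ 2) =
  \sum_(v <- hexvecs n) ((2 * v.1 + v.2) ^+ 4 - (2 * v.1 + v.2) ^+ 2).
Proof.
rewrite -sum_weight.
pose s (v : int * int) : int := 2 * v.1 + v.2.
have odd0 : \sum_(t <- hexquads n) (t.1.1 + t.1.2) * (s t.2 * (t.1.2 - t.1.1)) = 0.
  suff : \sum_(t <- hexquads n) (t.1.1 + t.1.2) * (s t.2 * (t.1.2 - t.1.1)) =
     \sum_(t <- hexquads n) - ((t.1.1 + t.1.2) * (s t.2 * (t.1.2 - t.1.1))).
    by move/eqP; rewrite sumrN -addr_eq0 -mulr2n mulrn_eq0 => /eqP.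
  pose f (t : (int * int) * (int * int)) := (t.1, (- t.2.1 - t.2.2, t.2.2)).
  apply: (@sum_bij _ _ _ _ _ xpredT xpredT _ _ f f); rewrite ?hexquads_uniq //.
    move=> [[d e] [x y]]; rewrite !mem_hexquads /s /f /= => /and3P[d0 e0 /eqP E] _; split=> //.
    - by rewrite d0 e0 -E; apply/eqP; rewrite /hexQ; ring.
    - by congr (_, (_, _)); ring.
    - by ring.
  move=> [[d e] [x y]]; rewrite !mem_hexquads /f /= => /and3P[d0 e0 /eqP E] _; split=> //.
  - by rewrite d0 e0 -E; apply/eqP; rewrite /hexQ; ring.
  - by congr (_, (_, _)); ring.
have sym : \sum_(t <- hexquads n) t.1.1 * (t.1.1 * t.1.2 - s t.2 ^+ 2) =
           \sum_(t <- hexquads n) t.1.2 * (t.1.1 * t.1.2 - s t.2 ^+ 2).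
  pose f (t : (int * int) * (int * int)) := ((t.1.2, t.1.1), t.2).
  apply: (@sum_bij _ _ _ _ _ xpredT xpredT _ _ f f); rewrite ?hexquads_uniq //.
    move=> [[d e] [x y]]; rewrite !mem_hexquads /s /f /= => /and3P[d0 e0 /eqP E] _; split=> //.
    - by rewrite d0 e0 -E; apply/eqP; ring.
    - by rewrite [e * d]mulrC.
  move=> [[d e] [x y]]; rewrite !mem_hexquads /f /= => /and3P[d0 e0 /eqP E] _; split=> //.
  by rewrite d0 e0 -E; apply/eqP; ring.
transitivity (12 * (\sum_(t <- hexquads n) t.1.1 * (t.1.1 * t.1.2 - s t.2 ^+ 2)
    + \sum_(t <- hexquads n) t.1.2 * (t.1.1 * t.1.2 - s t.2 ^+ 2)
    + \sum_(t <- hexquads n) (t.1.1 + t.1.2) * (s t.2 * (t.1.2 - t.1.1)))).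
  by rewrite odd0 -sym; ring.
rewrite -!big_split /=; congr (_ * _); apply: eq_bigr => t _.
by rewrite /hexquad_weight /s; ring.
Qed.

Section HexAutomorphism.
Variables (f g : int * int -> int * int).
Hypotheses (fK : cancel f g) (gK : cancel g f).
Hypothesis f_hexQ : forall v, hexQ (f v).1 (f v).2 = hexQ v.1 v.2.

Let mem_hexvecs_aut n v : (f v \in hexvecs n) = (v \in hexvecs n).
Proof. by move: (f_hexQ v); case: (f v) => x' y'; case: v => x y; rewrite !mem_hexvecs => ->. Qed.

Let mem_hexquads_aut n t : ((t.1, f t.2) \in hexquads n) = (t \in hexquads n).
Proof.
move: (f_hexQ t.2); case: t => -[d e] v /=; case: (f v) => x' y'; case: v => x y.
by rewrite !mem_hexquads => ->.
Qed.

Lemma sum_hexvecs_aut n (F : int * int -> int) :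
  \sum_(v <- hexvecs n) F (f v) = \sum_(v <- hexvecs n) F v.
Proof.
apply: (@sum_bij _ _ _ _ _ xpredT xpredT _ _ f g); rewrite ?hexvecs_uniq //.
  by move=> v vn _; rewrite mem_hexvecs_aut fK.
by move=> v vn _; rewrite -mem_hexvecs_aut gK.
Qed.

Lemma sum_hexquads_aut n (F : (int * int) * (int * int) -> int) :
  \sum_(t <- hexquads n) F (t.1, f t.2) = \sum_(t <- hexquads n) F t.
Proof.
apply: (@sum_bij _ _ _ _ _ xpredT xpredT _ _
  (fun t => (t.1, f t.2)) (fun t => (t.1, g t.2))); rewrite ?hexquads_uniq //.
  by move=> [u v] tn _; rewrite mem_hexquads_aut /= fK.
by move=> [u v] tn _; rewrite -mem_hexquads_aut /= gK.
Qed.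

Lemma sum_hexquads_direction_aut n :
  24 * \sum_(t <- hexquads n) t.1.1 * (t.1.1 * t.1.2 - (2 * (f t.2).1 + (f t.2).2) ^+ 2) =
  \sum_(v <- hexvecs n) ((2 * (f v).1 + (f v).2) ^+ 4 - (2 * (f v).1 + (f v).2) ^+ 2).
Proof.
rewrite (sum_hexvecs_aut n (fun v => (2 * v.1 + v.2) ^+ 4 - (2 * v.1 + v.2) ^+ 2)).
rewrite -sum_hexquads_direction; congr (_ * _).
exact: (sum_hexquads_aut n
  (fun t => t.1.1 * (t.1.1 * t.1.2 - (2 * t.2.1 + t.2.2) ^+ 2))).
Qed.

End HexAutomorphism.

(* For the three directions s = 2 x + y, x + 2 y and x - y, which automorphisms of Q
   permute, the squares add up to 6 Q and the fourth powers to 18 Q ^ 2. *)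
Lemma sum_hexquads_average n :
  24 * \sum_(t <- hexquads n) t.1.1 * (t.1.1 * t.1.2 - 2 * hexQ t.2.1 t.2.2) =
  \sum_(v <- hexvecs n) (6 * hexQ v.1 v.2 ^+ 2 - 2 * hexQ v.1 v.2).
Proof.
pose f (v : int * int) := (v.2, v.1).
(* A rotation of order 6; it turns 2 x + y into x - y. *)
pose g (v : int * int) := (- v.2, v.1 + v.2).
pose g' (v : int * int) := (v.1 + v.2, - v.1).
have D1 := sum_hexquads_direction n.
have D2 : 24 * \sum_(t <- hexquads n) t.1.1 * (t.1.1 * t.1.2 - (2 * t.2.2 + t.2.1) ^+ 2) =
  \sum_(v <- hexvecs n) ((2 * v.2 + v.1) ^+ 4 - (2 * v.2 + v.1) ^+ 2).
  apply: (@sum_hexquads_direction_aut f f); try by case.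
  by move=> v; rewrite /f /hexQ /=; ring.
have D3 : 24 * \sum_(t <- hexquads n) t.1.1 * (t.1.1 * t.1.2 - (2 * - t.2.2 + (t.2.1 + t.2.2)) ^+ 2) =
  \sum_(v <- hexvecs n) ((2 * - v.2 + (v.1 + v.2)) ^+ 4 - (2 * - v.2 + (v.1 + v.2)) ^+ 2).
  apply: (@sum_hexquads_direction_aut g g').
  - by move=> [x y]; rewrite /g /g' /=; congr pair; ring.
  - by move=> [x y]; rewrite /g /g' /=; congr pair; ring.
  - by move=> v; rewrite /g /hexQ /=; ring.
apply: (@mulfI _ 3) => //.
transitivity (24 * (\sum_(t <- hexquads n) t.1.1 * (t.1.1 * t.1.2 - (2 * t.2.1 + t.2.2) ^+ 2)
  + \sum_(t <- hexquads n) t.1.1 * (t.1.1 * t.1.2 - (2 * t.2.2 + t.2.1) ^+ 2)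
  + \sum_(t <- hexquads n) t.1.1 * (t.1.1 * t.1.2 - (2 * - t.2.2 + (t.2.1 + t.2.2)) ^+ 2))).
  rewrite mulrCA -!big_split /= mulr_sumr; congr (_ * _); apply: eq_bigr => t _.
  by rewrite /hexQ; ring.
rewrite !mulrDr D1 D2 D3 -!big_split /= mulr_sumr; apply: eq_bigr => v _.
by rewrite /hexQ; ring.
Qed.

Lemma kaneko_zagier_alg (A : comNzRingType) (s s' t t' t'' : A) :
    24%:R * (s' * t - 2%:R * (s * t')) = 6%:R * t'' - 2%:R * t' ->
  6%:R * t'' - 2%:R * (1 - 24%:R * s) * t' + (0 - 24%:R * s') * t = 0.
Proof.
move=> E; transitivity (6%:R * t'' - 2%:R * t' - 24%:R * (s' * t - 2%:R * (s * t'))).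
  by ring.
by rewrite E subrr.
Qed.

(** With r = [theta_hex] and m = d e, the coefficient of q^n reads: 24 times the sum of sigma(m) r(n
    - m) (m - 2 (n - m)) is (6 n^2 - 2 n) r(n). This is [sum_hexquads_average], because Q = n on
    [hexvecs n]. *)
Lemma theta_kaneko_zagier :
  6%:R * fps_theta (fps_theta theta_hex) - 2%:R * E2 * fps_theta theta_hex
  + fps_theta E2 * theta_hex = 0.
Proof.
have E : 24%:R * (fps_theta (sigma_fps 1) * theta_hex - 2%:R * (sigma_fps 1 * fps_theta theta_hex))
    = 6%:R * fps_theta (fps_theta theta_hex) - 2%:R * fps_theta theta_hex.
  apply/funext => n.
  rewrite (fps_coef_natM 24) 2!fps_coefB (fps_coef_natM 2) (fps_coef_natM 6) (fps_coef_natM 2).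
  transitivity (24 * \sum_(t <- hexquads n) t.1.1 * (t.1.1 * t.1.2 - 2 * hexQ t.2.1 t.2.2)).
    congr (_ * _); rewrite (sum_hexquads_conv (fun a b => a - 2 * b)).
    rewrite !fps_coefM mulr_sumr -sumrB; apply: eq_bigr => i _.
    rewrite theta_sigma_fps /fps_theta -[theta_hex _ *+ _]mulr_natl natz /sigma_fps; ring.
  rewrite sum_hexquads_average.
  rewrite (eq_big_seq (fun=> 6 * n%:Z ^+ 2 - 2 * n%:Z)); last first.
    by move=> [x y]; rewrite mem_hexvecs => /eqP ->.
  by rewrite sumr_const_seq /fps_theta /theta_hex; ring.
have theta_E2 : fps_theta E2 = 0 - 24%:R * fps_theta (sigma_fps 1).
  by rewrite /E2 fps_thetaB (fps_theta_nat int 1) fps_theta_natM.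
apply: etrans (kaneko_zagier_alg E).
exact: (congr1 (fun z => _ + z * _) theta_E2).
Qed.

(** * The discriminant with integral coefficients *)

Lemma fps_int_mulfI m (f g : fps int) : (0 < m)%N -> m%:R * f = m%:R * g -> f = g.
Proof.
move=> m0 E; apply/funext => n; apply: (@mulfI _ (m%:R : int)).
  by rewrite pnatr_eq0 -lt0n.
by have := congr1 (fun h : fps int => h n) E; rewrite !(fps_coef_natM m).
Qed.

Lemma dvdn12_cube_fifth d : (12 %| 5 * d ^ 3 + 7 * d ^ 5)%N.
Proof.
rewrite /dvdn -modnDm -(modnMmr 5) -(modnMmr 7) -(modnXm 3) -(modnXm 5).
by move: (d %% 12)%N (ltn_pmod d (isT : 0 < 12)%N); do 12?case=> //.
Qed.

(** The part of E4^3 - E6^2 linear in the divisor sums is 144 (5 sigma_3 + 7 sigma_5), so only a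
    further division by 12 is delicate. The remaining coefficients 3 * 240^2, 504^2 and 240^3 are
    1728 times 100, 147 and 8000. *)
Definition delta_lin : fps int :=
  fun n => \sum_(d <- divs n) ((5 * d ^ 3 + 7 * d ^ 5) %/ 12)%N%:Z.

Lemma delta_linE : 12%:R * delta_lin = 5%:R * sigma_fps 3 + 7%:R * sigma_fps 5.
Proof.
apply/funext => n; rewrite fps_coefD (fps_coef_natM 12) (fps_coef_natM 5) (fps_coef_natM 7).
rewrite /delta_lin /sigma_fps /sigma !mulr_sumr -big_split /=; apply: eq_bigr => d _.
by rewrite -[12%:R]/(12%N%:Z) -PoszM mulnC divnK ?dvdn12_cube_fifth.
Qed.

Definition DeltaZ : fps int := delta_lin + 100%:R * sigma_fps 3 ^+ 2
  - 147%:R * sigma_fps 5 ^+ 2 + 8000%:R * sigma_fps 3 ^+ 3.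

Lemma delta_alg (A : comNzRingType) (s3 s5 l : A) :
    12%:R * l = 5%:R * s3 + 7%:R * s5 ->
  1728%:R * (l + 100%:R * s3 ^+ 2 - 147%:R * s5 ^+ 2 + 8000%:R * s3 ^+ 3) =
  (1 + 240%:R * s3) ^+ 3 - (1 - 504%:R * s5) ^+ 2.
Proof.
move=> E; transitivity (144%:R * (12%:R * l)
  + 1728%:R * (100%:R * s3 ^+ 2 - 147%:R * s5 ^+ 2 + 8000%:R * s3 ^+ 3)); first by ring.
by rewrite E; ring.
Qed.

Lemma DeltaZE : 1728%:R * DeltaZ = E4 ^+ 3 - E6 ^+ 2.
Proof. exact: delta_alg delta_linE. Qed.

Lemma theta_delta_alg (A : comNzRingType) (e2 e4 e6 t4 t6 : A) :
    3%:R * t4 = e2 * e4 - e6 -> 2%:R * t6 = e2 * e6 - e4 ^+ 2 ->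
  (t4 * (e4 * e4) + e4 * (t4 * e4 + e4 * t4)) - (t6 * e6 + e6 * t6) = e2 * (e4 ^+ 3 - e6 ^+ 2).
Proof.
move=> H4 H6; transitivity (e4 ^+ 2 * (3%:R * t4) - e6 * (2%:R * t6)); first by ring.
by rewrite H4 H6; ring.
Qed.

Lemma theta_DeltaZ : fps_theta DeltaZ = E2 * DeltaZ.
Proof.
apply: (@fps_int_mulfI 1728) => //.
rewrite -(fps_theta_natM 1728) mulrCA DeltaZE -(theta_delta_alg ramanujan_E4 ramanujan_E6).
by rewrite fps_thetaB expr2 exprS expr2 !fps_thetaM.
Qed.

Lemma sigma_fps_O k : fps_O 1 (sigma_fps k).
Proof. by case=> // _; apply: sigma0. Qed.

Lemma DeltaZ_O : fps_O 1 DeltaZ.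
Proof.
have sO c k m : (0 < m)%N -> fps_O 1 (c * sigma_fps k ^+ m).
  by move=> m0; apply/fps_OMl/(fps_O_le m0)/fps_OX/sigma_fps_O.
apply: fps_OD; last exact: sO.
apply: fps_OB; last exact: sO.
apply: fps_OD; last exact: sO.
by case=> // _; rewrite /delta_lin big_nil.
Qed.

Lemma DeltaZ_1 : DeltaZ 1%N = 1.
Proof.
have sO k m (c : fps int) : (1 < m)%N -> (c * sigma_fps k ^+ m) 1%N = 0.
  by move=> m1; apply: (@fps_OMl _ 2) => //; apply: (fps_O_le m1); apply/fps_OX/sigma_fps_O.
have lin (a b c : fps int) : (delta_lin + a * sigma_fps 3 ^+ 2
    - b * sigma_fps 5 ^+ 2 + c * sigma_fps 3 ^+ 3) 1%N = delta_lin 1%N.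
  by rewrite fps_coefD fps_coefB fps_coefD !sO // subr0 !addr0.
by rewrite [LHS]lin /delta_lin -[divs 1]/[:: 1%N] big_seq1.
Qed.

Lemma E4_0 : E4 0%N = 1.
Proof. by rewrite /E4 fps_coefD (fps_coef_natM 240) sigma_fps_O // mulr0 addr0. Qed.

Lemma E6_0 : E6 0%N = 1.
Proof. by rewrite /E6 fps_coefB (fps_coef_natM 504) sigma_fps_O // mulr0 subr0. Qed.

(** * The recurrence for the coefficients of the polynomial *)

(* The Kaneko-Zagier operator in weight 1, multiplied by 6. *)
Definition kaneko_zagier (R : comNzRingType) (e2 f : fps R) : fps R :=
  6%:R * fps_theta (fps_theta f) - 2%:R * e2 * fps_theta f + fps_theta e2 * f.

(** Here [f] stands for E4^(3i) Delta^(N-i), a form of weight 12 N with logarithmic derivative [W] /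
    [a4]. All terms with the quasimodular [a2] are collected in a multiple of 12 N - 1, which
    vanishes when the weight is 1. *)
Lemma kaneko_zagier_mono_alg (A : comNzRingType) (a2 a4 a6 w d2 d4 d6 f f' f'' N i W W' : A) :
    12%:R * d2 = a2 ^+ 2 - a4 -> 3%:R * d4 = a2 * a4 - a6 ->
    2%:R * d6 = a2 * a6 - a4 ^+ 2 -> 1728%:R * w = a4 ^+ 3 - a6 ^+ 2 ->
    W = N * (a2 * a4) - i * a6 -> W' = N * (d2 * a4 + a2 * d4) - i * d6 ->
    a4 * f' = f * W -> d4 * f' + a4 * f'' = f' * W + f * W' ->
  24%:R * (a4 ^+ 2 * (6%:R * f'' - 2%:R * a2 * f' + d2 * f)) =
  f * (((12%:R * i - 1) * (12%:R * i + 3%:R)) * a4 ^+ 3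
       - 48%:R * (i * (3%:R * i - 1)) * (1728%:R * w)
     + (12%:R * N - 1) * ((12%:R * N - 2%:R) * a2 ^+ 2 * a4 ^+ 2
        - 24%:R * i * a2 * a4 * a6 - a4 ^+ 3)).
Proof.
move=> H2 H4 H6 Hw WE W'E Hf Hf'.
have -> : a4 ^+ 2 * (6%:R * f'' - 2%:R * a2 * f' + d2 * f) =
    6%:R * a4 * (d4 * f' + a4 * f'') - 6%:R * d4 * (a4 * f') - 2%:R * a2 * a4 * (a4 * f')
    + d2 * f * a4 ^+ 2 by ring.
rewrite Hf' Hf.
have -> : 6%:R * a4 * (f' * W + f * W') = 6%:R * (a4 * f') * W + 6%:R * a4 * f * W' by ring.
rewrite Hf Hw W'E.
transitivity (f * (144%:R * W ^+ 2 + N * (12%:R * a4 ^+ 2 * (12%:R * d2) + 48%:R * a4 * a2 * (3%:R * d4))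
   - 72%:R * i * a4 * (2%:R * d6) - 48%:R * (3%:R * d4) * W - 48%:R * a2 * a4 * W
   + 2%:R * (12%:R * d2) * a4 ^+ 2)); first by ring.
by rewrite H2 H4 H6 WE; ring.
Qed.

(** The analogue for [f] times E6, of weight 12 N + 6; accordingly the terms with [a2] carry the
    factor 12 N + 5. *)
Lemma kaneko_zagier_mono_alg6 (A : comNzRingType)
    (a2 a4 a6 w d2 d4 d6 d6' f f' f'' N i W W' : A) :
    12%:R * d2 = a2 ^+ 2 - a4 -> 3%:R * d4 = a2 * a4 - a6 ->
    2%:R * d6 = a2 * a6 - a4 ^+ 2 -> 1728%:R * w = a4 ^+ 3 - a6 ^+ 2 ->
    2%:R * d6' = d2 * a6 + a2 * d6 - 2%:R * a4 * d4 ->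
    W = N * (a2 * a4) - i * a6 -> W' = N * (d2 * a4 + a2 * d4) - i * d6 ->
    a4 * f' = f * W -> d4 * f' + a4 * f'' = f' * W + f * W' ->
  24%:R * (a4 ^+ 2 * (6%:R * (f'' * a6 + 2%:R * (f' * d6) + f * d6')
     - 2%:R * a2 * (f' * a6 + f * d6) + d2 * (f * a6))) =
  f * a6 * (((12%:R * i + 5%:R) * (12%:R * i + 9%:R)) * a4 ^+ 3
       - 48%:R * (i * (3%:R * i - 1)) * (1728%:R * w))
  + f * (12%:R * N + 5%:R) * ((12%:R * N + 4%:R) * a2 ^+ 2 * a4 ^+ 2 * a6
        - 12%:R * a2 * a4 ^+ 4 - 24%:R * i * a2 * a4 * a6 ^+ 2 - a4 ^+ 3 * a6).
Proof.
move=> H2 H4 H6 Hw H6' WE W'E Hf Hf'.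
have E := kaneko_zagier_mono_alg H2 H4 H6 Hw WE W'E Hf Hf'.
transitivity (24%:R * (a4 ^+ 2 * (6%:R * f'' - 2%:R * a2 * f' + d2 * f)) * a6
   + 144%:R * a4 * (a4 * f') * (2%:R * d6)
   + f * a4 ^+ 2 * (72%:R * (2%:R * d6') - 24%:R * a2 * (2%:R * d6))); first by ring.
rewrite E H6' Hf.
have -> : 72%:R * (d2 * a6 + a2 * d6 - 2%:R * a4 * d4) - 24%:R * a2 * (2%:R * d6) =
   6%:R * (12%:R * d2) * a6 + 12%:R * a2 * (2%:R * d6) - 48%:R * a4 * (3%:R * d4) by ring.
by rewrite H2 H4 H6 Hw WE; ring.
Qed.

Section Recurrence.
Variables (F : fieldType) (e2 e4 e6 v : fps F).
Hypothesis ram2 : 12%:R * fps_theta e2 = e2 ^+ 2 - e4.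
Hypothesis ram4 : 3%:R * fps_theta e4 = e2 * e4 - e6.
Hypothesis ram6 : 2%:R * fps_theta e6 = e2 * e6 - e4 ^+ 2.
Hypothesis vE : 1728%:R * v = e4 ^+ 3 - e6 ^+ 2.
Hypothesis theta_v : fps_theta v = e2 * v.
Hypotheses (e4_0 : e4 0%N = 1) (e6_0 : e6 0%N = 1) (v_O : fps_O 1 v) (v_1 : v 1%N = 1).

Let mono (i r : nat) := e4 ^+ (3 * i) * v ^+ r.

Let theta_vX r : fps_theta (v ^+ r) = r%:R * e2 * v ^+ r.
Proof.
elim: r => [|r IHr]; first by rewrite expr0 (fps_theta_nat F 1) !mul0r.
by rewrite exprS fps_thetaM IHr theta_v -natr1; ring.
Qed.

Let W (i r : nat) := (i + r)%:R * (e2 * e4) - i%:R * e6.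

Let theta_W i r : fps_theta (W i r) =
  (i + r)%:R * (fps_theta e2 * e4 + e2 * fps_theta e4) - i%:R * fps_theta e6.
Proof. by rewrite fps_thetaB !fps_theta_natM fps_thetaM. Qed.

Let theta_mono i r : e4 * fps_theta (mono i r) =
  mono i r * W i r.
Proof.
rewrite /mono /W fps_thetaM theta_vX mulrDr mulrA fps_thetaX.
have -> : (3 * i)%:R * e4 ^+ (3 * i) * fps_theta e4 =
          i%:R * e4 ^+ (3 * i) * (3%:R * fps_theta e4) by rewrite natrM; ring.
by rewrite ram4 natrD; ring.
Qed.


Let theta_theta_mono i r :
  fps_theta e4 * fps_theta (mono i r) + e4 * fps_theta (fps_theta (mono i r)) =
  fps_theta (mono i r) * W i r + mono i r * fps_theta (W i r).
Proof. by rewrite -!fps_thetaM theta_mono. Qed.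

Let theta_theta_e6 : 2%:R * fps_theta (fps_theta e6) =
  fps_theta e2 * e6 + e2 * fps_theta e6 - 2%:R * e4 * fps_theta e4.
Proof.
by rewrite -(fps_theta_natM 2) ram6 fps_thetaB expr2 !fps_thetaM; ring.
Qed.

Variables (n b : nat).
Hypotheses (b_le1 : (b <= 1)%N) (weight1 : (12 * n + 6 * b)%:R = 1 :> F).

(** The subtraction takes place in [F], as 12 i + 6 b may be the natural number 0. At i = n the
    first factor vanishes, because the weight is 1 there; this fits the convention that coefficient
    n + 1 is 0. *)
Definition rec_lhs (i : nat) : F := ((12 * i + 6 * b)%:R - 1) * (12 * i + 6 * b + 3)%:R.
Definition rec_rhs (i : nat) : F := 1728%:R * (48%:R * (i%:R * ((3 * i)%:R - 1))).

Let bmono i := mono i (n - i) * e6 ^+ b.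

Let fpsCB x y : fpsC (x - y) = fpsC x - fpsC y :> fps F.
Proof. by apply/funext => m; rewrite fps_coefB /fpsC mulrnBl. Qed.
Let fpsCM x y : fpsC (x * y) = fpsC x * fpsC y :> fps F.
Proof. by apply/funext => m; rewrite fps_coef_CM /fpsC mulrnAr. Qed.

Lemma kaneko_zagier_mono i : (i <= n)%N ->
  24%:R * (e4 ^+ 2 * kaneko_zagier e2 (bmono i)) =
  bmono i * (fpsC (rec_lhs i) * e4 ^+ 3 - fpsC (rec_rhs i) * v).
Proof.
move=> lein; have subnK := subnKC lein.
have lhsE : fpsC (rec_lhs i) = (12%:R * i%:R + 6%:R * b%:R - 1) * (12%:R * i%:R + 6%:R * b%:R + 3%:R).
  by rewrite /rec_lhs fpsCM fpsCB !fpsC_nat (fpsC_nat _ 1); ring.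
have rhsE : fpsC (rec_rhs i) = 1728%:R * (48%:R * (i%:R * (3%:R * i%:R - 1))).
  by rewrite /rec_rhs !fpsCM fpsCB !fpsC_nat (fpsC_nat _ 1); ring.
have hn : 12%:R * (i + (n - i))%:R + 6%:R * b%:R = 1 :> fps F.
  transitivity ((12 * n + 6 * b)%:R : fps F); first by rewrite subnK; ring.
  by rewrite -fpsC_nat weight1 (fpsC_nat _ 1).
rewrite lhsE rhsE /bmono /kaneko_zagier; case: b b_le1 hn => [|[|//]] _ hn.
  rewrite expr0 !mulr1 (kaneko_zagier_mono_alg ram2 ram4 ram6 vE (erefl (W i (n - i))) (theta_W _ _)
    (theta_mono _ _) (theta_theta_mono _ _)).
  have -> : 12%:R * (i + (n - i))%:R - 1 = 0 :> fps F.
    by apply: (addIr 1); rewrite add0r -[RHS]hn; ring.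
  by ring.
have -> : fps_theta (mono i (n - i) * e6 ^+ 1) =
    fps_theta (mono i (n - i)) * e6 + mono i (n - i) * fps_theta e6 by rewrite expr1 fps_thetaM.
have -> : fps_theta (fps_theta (mono i (n - i)) * e6 + mono i (n - i) * fps_theta e6) =
    fps_theta (fps_theta (mono i (n - i))) * e6 + 2%:R * (fps_theta (mono i (n - i)) * fps_theta e6)
    + mono i (n - i) * fps_theta (fps_theta e6) by rewrite fps_thetaD !fps_thetaM; ring.
rewrite expr1 (kaneko_zagier_mono_alg6 ram2 ram4 ram6 vE theta_theta_e6 (erefl (W i (n - i)))
   (theta_W _ _) (theta_mono _ _) (theta_theta_mono _ _)).
have -> : 12%:R * (i + (n - i))%:R + 5%:R = 0 :> fps F by apply: (addIr 1); rewrite add0r -[RHS]hn; ring.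
by ring.
Qed.

(** The product of E4^(3i) and Delta^(n-i) starts at q^(n-i), so the system is triangular and the
    coefficients vanish successively from i = n downwards. *)
Lemma fps_mono_indep (w : fps F) (c : nat -> F) : w 0%N = 1 ->
    fps_O n.+1 (w * \sum_(i < n.+1) fpsC (c i) * (e4 ^+ (3 * i) * v ^+ (n - i))) ->
  forall i, (i <= n)%N -> c i = 0.
Proof.
move=> w_0 O i lein; have [j ltj ->] : exists2 j, (j <= n)%N & i = (n - j)%N.
  by exists (n - i)%N; lia.
elim/ltn_ind: j ltj {i lein} => j IHj lejn.
have := O j; rewrite ltnS => /(_ lejn); rewrite mulr_sumr fps_coef_sum.
have ltnj : (n - j < n.+1)%N by lia.
rewrite (bigD1 (Ordinal ltnj)) //= big1 ?addr0 => [|i neq].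
  rewrite subKn // !mulrA [w * _]mulrC -!mulrA fps_coef_CM mulrA.
  rewrite (@fps_coefM_lead _ 0 j) ?fps_coef0M ?fps_coef0X ?fps_coefX_lead //; last exact: fps_OX.
  by rewrite w_0 e4_0 v_1 !expr1n !mulr1.
have {neq} neq : i != (n - j)%N :> nat by apply: contraNneq neq => iE; apply/eqP/val_inj.
rewrite !mulrA [w * _]mulrC -!mulrA fps_coef_CM.
case: (ltnP (n - i) j) => [lt|le].
  have lein : (i <= n)%N by rewrite -ltnS.
  by rewrite -{1}(subKn lein) IHj ?mul0r // leq_subr.
have ltji : (j < n - i)%N by have := ltn_ord i; lia.
by rewrite mulrA (@fps_OMl _ (n - i)) ?mulr0 //; apply: fps_OX.
Qed.

(** By [kaneko_zagier_mono] the i-th monomial contributes to two consecutive monomials of one step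
    higher. As [rec_rhs] is 0 at 0, all surviving ones are divisible by E4^3; after this factor is
    taken out, n + 1 coefficients remain against precision n + 1, and [fps_mono_indep] applies. *)
Lemma polynomial_recurrence (c : nat -> F) :
    24%:R != 0 :> F -> c n.+1 = 0 ->
    fps_O n.+1 (kaneko_zagier e2 (\sum_(i < n.+1) fpsC (c i) * (e4 ^+ (3 * i) * v ^+ (n - i) * e6 ^+ b))) ->
  forall i, (i <= n)%N -> rec_lhs i * c i = rec_rhs i.+1 * c i.+1.
Proof.
move=> n24 c_n1 O i lein; apply/eqP; rewrite -subr_eq0; apply/eqP.
pose C i := rec_lhs i * c i - rec_rhs i.+1 * c i.+1.
apply: (@fps_mono_indep (e4 ^+ 3 * e6 ^+ b) C) lein.
  by rewrite fps_coef0M !fps_coef0X e4_0 e6_0 !expr1n mulr1.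
have {O} := fps_OMl (24%:R * e4 ^+ 2) O.
congr (fps_O _ _).
have kzD f g : kaneko_zagier e2 (f + g) = kaneko_zagier e2 f + kaneko_zagier e2 g.
  by rewrite /kaneko_zagier !fps_thetaD; ring.
have kz0 : kaneko_zagier e2 0 = 0 by rewrite /kaneko_zagier !fps_theta0; ring.
have kzC a f : kaneko_zagier e2 (fpsC a * f) = fpsC a * kaneko_zagier e2 f.
  by rewrite /kaneko_zagier !fps_theta_CM; ring.
rewrite (big_morph _ kzD kz0) -mulrA !mulr_sumr.
pose m i := e4 ^+ (3 * i) * v ^+ (n.+1 - i) * e6 ^+ b.
transitivity (\sum_(i < n.+1) (fpsC (rec_lhs i * c i) * m i.+1 - fpsC (rec_rhs i * c i) * m i)).
  apply: eq_bigr => -[j ltj] _ /=; rewrite kzC; have lejn : (j <= n)%N by [].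
  transitivity (fpsC (c j) * (24%:R * (e4 ^+ 2 * kaneko_zagier e2 (bmono j)))).
    by rewrite /bmono /mono; ring.
  rewrite (kaneko_zagier_mono lejn) /bmono.
  by rewrite !fpsCM /m subSS subSn // mulnS exprD [v ^+ _.+1]exprS /mono; ring.
rewrite sumrB.
have -> : \sum_(i < n.+1) fpsC (rec_rhs i * c i) * m i =
          \sum_(i < n.+1) fpsC (rec_rhs i.+1 * c i.+1) * m i.+1.
  rewrite big_ord_recl /= [in RHS]big_ord_recr /= c_n1 mulr0 {1}/rec_rhs.
  rewrite !(mul0r, mulr0) -[0]/(0%:R) !fpsC_nat !mul0r add0r addr0.
  by apply: eq_bigr => j _; rewrite /bump.
rewrite -sumrB; apply: eq_bigr => j _.
by rewrite /C fpsCB /m subSS mulnS exprD; ring.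
Qed.

End Recurrence.

Lemma kaneko_zagier_map (R S : comNzRingType) (phi : {rmorphism R -> S}) (e2 f : fps R) :
  fps_map phi (kaneko_zagier e2 f) = kaneko_zagier (fps_map phi e2) (fps_map phi f).
Proof. by rewrite /kaneko_zagier rmorphD rmorphB !rmorphM !rmorph_nat /= !fps_map_theta. Qed.

Lemma theta_hex_0 : theta_hex 0%N = 1.
Proof.
rewrite /theta_hex; suff -> : hexvecs 0 = [:: (0, 0)] by [].
by apply/perm_small_eq => //; apply: uniq_perm; rewrite ?hexvecs_uniq //;
   move=> [x y]; rewrite mem_hexvecs inE xpair_eqE; apply/eqP/andP => [H|[/eqP-> /eqP->]//];
   have := hexQ_bound (n := 0) (x := x) (y := y); rewrite H; lia.
Qed.

Definition hex_form (n b : nat) (c : nat -> int) : fps int :=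
  \sum_(i < n.+1) fpsC (c i) * (E4 ^+ (3 * i) * DeltaZ ^+ (n - i) * E6 ^+ b).

Lemma fps_map_C (R S : comNzRingType) (phi : {rmorphism R -> S}) a :
  fps_map phi (fpsC a) = fpsC (phi a).
Proof. by apply/funext => n; rewrite /fps_map /fpsC rmorphMn. Qed.

Lemma hex_form_recurrence (p n b : nat) (c : nat -> int) :
    prime p -> (3 < p)%N -> (b <= 1)%N -> p.+1 = (12 * n + 6 * b)%N -> c n.+1 = 0 ->
    fps_O n.+1 (hex_form n b c - theta_hex) ->
  forall i, (i <= n)%N ->
    rec_lhs 'F_p b i * (c i)%:~R = rec_rhs 'F_p i.+1 * (c i.+1)%:~R.
Proof.
move=> p_pr p3 b_le1 pE c_n1 O.
pose phi : {rmorphism int -> 'F_p} := intr.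
have intr_map m : fps_map phi m%:R = m%:R by rewrite rmorph_nat.
have p0 : p%:R = 0 :> 'F_p by rewrite pchar_Fp_0.
apply: (@polynomial_recurrence _ (fps_map phi E2) (fps_map phi E4) (fps_map phi E6)
  (fps_map phi DeltaZ)).
- by rewrite -fps_map_theta -(intr_map 12%N) -rmorphM ramanujan_E2 rmorphB rmorphXn.
- by rewrite -fps_map_theta -(intr_map 3%N) -rmorphM ramanujan_E4 rmorphB rmorphM.
- by rewrite -fps_map_theta -(intr_map 2%N) -rmorphM ramanujan_E6 rmorphB rmorphM rmorphXn.
- by rewrite -(intr_map 1728%N) -rmorphM DeltaZE rmorphB !rmorphXn.
- by rewrite -fps_map_theta theta_DeltaZ rmorphM.
- by rewrite /fps_map E4_0 rmorph1.
- by rewrite /fps_map E6_0 rmorph1.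
- exact/fps_map_O/DeltaZ_O.
- by rewrite /fps_map DeltaZ_1 rmorph1.
- exact: b_le1.
- by rewrite -pE -natr1 p0 add0r.
- rewrite -(dvdn_pcharf (pchar_Fp p_pr)) (_ : 24 = 2 ^ 3 * 3)%N // Euclid_dvdM // Euclid_dvdX //.
  by rewrite !dvdn_prime2 //; apply/negP; lia.
- by rewrite c_n1.
have := fps_map_O phi (f := kaneko_zagier E2 (hex_form n b c)) (N := n.+1).
rewrite kaneko_zagier_map /hex_form rmorph_sum.
rewrite (eq_bigr (fun i : 'I_n.+1 => fpsC (c i)%:~R * (fps_map phi E4 ^+ (3 * i)
   * fps_map phi DeltaZ ^+ (n - i) * fps_map phi E6 ^+ b))); last first.
  by move=> i _; rewrite !rmorphM !rmorphXn /= fps_map_C.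
apply; rewrite -/(hex_form n b c).
(* The theta series is annihilated already over the integers, so the operator sees only the
   difference, which is O(q^(n+1)). *)
have -> : kaneko_zagier E2 (hex_form n b c) =
    kaneko_zagier E2 (hex_form n b c) - kaneko_zagier E2 theta_hex.
  by rewrite /kaneko_zagier theta_kaneko_zagier subr0.
have -> : kaneko_zagier E2 (hex_form n b c) - kaneko_zagier E2 theta_hex =
    kaneko_zagier E2 (hex_form n b c - theta_hex).
  by rewrite /kaneko_zagier !fps_thetaB; ring.
apply: fps_OD; last exact: fps_OMl.
by apply: fps_OB; apply/fps_OMl; do ?apply: fps_O_theta.
Qed.

(** Only the monomial i = n has a nonzero constant term, and it is 1, as is that of the theta
    series. So the polynomial is monic. *)
Lemma hex_form_lead (n b : nat) (c : nat -> int) :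
  fps_O n.+1 (hex_form n b c - theta_hex) -> c n = 1.
Proof.
move=> /(_ 0%N isT) /eqP; rewrite fps_coefB subr_eq0 theta_hex_0 /hex_form fps_coef_sum => /eqP <-.
rewrite big_ord_recr /= subnn expr0 mulr1 fps_coef_CM fps_coef0M !fps_coef0X E4_0 E6_0.
rewrite !expr1n !mulr1 big1 ?add0r // => i _; have := ltn_ord i => lti.
rewrite fps_coef_CM !fps_coef0M !fps_coef0X [DeltaZ 0%N](DeltaZ_O (n := 0)) //.
by rewrite expr0n subn_eq0 leqNgt lti !(mul0r, mulr0).
Qed.

(** * The tetrahedral substitution *)

(** Semi-invariants of the tetrahedral group, in a coordinate where one of its axes of order 3
    passes through infinity: the zeros of [tPhi] are the vertices, those of [tPsi] together with
    infinity the face centres, and those of [tEdge] the midpoints of the edges. The rotation about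
    that axis multiplies s by a cube root of unity, which is why s^3 governs all three. *)
Definition tPhi (R : nzRingType) : {poly R} := 'X^4 + 4%:R * 'X.
Definition tPsi (R : nzRingType) : {poly R} := 2%:R * 'X^3 - 1.
Definition tEdge (R : nzRingType) : {poly R} := 'X^6 - 10%:R * 'X^3 - 2%:R.
Definition tU (R : nzRingType) : {poly R} := tPhi R ^+ 3.
Definition tV (R : nzRingType) : {poly R} := 4%:R * tPsi R ^+ 3.

Lemma tUV_edge (R : comNzRingType) : tU R - tV R = tEdge R ^+ 2.
Proof. by rewrite /tU /tV /tPhi /tPsi /tEdge; ring. Qed.

Lemma deriv_tPhi (R : comNzRingType) : (tPhi R)^`() = 4%:R * 'X^3 + 4%:R.
Proof. by rewrite /tPhi !derivE /= ; ring. Qed.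

Lemma deriv_tPsi (R : comNzRingType) : (tPsi R)^`() = 6%:R * 'X^2.
Proof. by rewrite /tPsi !derivE /= ; ring. Qed.

Lemma deriv_tEdge (R : comNzRingType) : (tEdge R)^`() = 6%:R * 'X^5 - 30%:R * 'X^2.
Proof. by rewrite /tEdge !derivE /= ; ring. Qed.

(* The two identities below are [L ^ 2 + M L' - M' L = ...] for the logarithmic
   derivative L / M of Phi ^ a Psi ^ (d - a) E ^ b; the cofactor of 4 d - 1
   (resp. 4 d + 5) vanishes when the weight is 1. *)
Lemma tetra_ode_alg0 (A : comNzRingType) (x a d : A) :
  let P := x ^+ 4 + 4%:R * x in let Q := 2%:R * x ^+ 3 - 1 in
  let P' := 4%:R * x ^+ 3 + 4%:R in let Q' := 6%:R * x ^+ 2 in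
  let P'' := 12%:R * x ^+ 2 in let Q'' := 12%:R * x in
  let L := a * P' * Q + (d - a) * P * Q' in
  let L' := a * (P'' * Q + P' * Q') + (d - a) * (P' * Q' + P * Q'') in
  L ^+ 2 + P * Q * L' - (P' * Q + P * Q') * L =
  4%:R * ((d - a) * (d - a - 1)) * P ^+ 3 - 16%:R * (a * (a - 1)) * Q ^+ 3
  + (4%:R * d - 1) * (
    (- 64) * x ^+ 3 * d + 80 * x ^+ 3 * a
     + 96 * x ^+ 6 * d + (- 156) * x ^+ 6 * a
     + 60 * x ^+ 9 * d + (- 12) * x ^+ 9 * a
     + 8 * x ^+ 12 * d + 8 * x ^+ 12 * a).
Proof. by move=> /=; ring. Qed.

Lemma tetra_ode_alg1 (A : comNzRingType) (x a d : A) :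
  let P := x ^+ 4 + 4%:R * x in let Q := 2%:R * x ^+ 3 - 1 in
  let S := x ^+ 6 - 10%:R * x ^+ 3 - 2%:R in
  let P' := 4%:R * x ^+ 3 + 4%:R in let Q' := 6%:R * x ^+ 2 in
  let S' := 6%:R * x ^+ 5 - 30%:R * x ^+ 2 in
  let P'' := 12%:R * x ^+ 2 in let Q'' := 12%:R * x in
  let S'' := 30%:R * x ^+ 4 - 60%:R * x in
  let L := a * P' * Q * S + (d - a) * P * Q' * S + P * Q * S' in
  let L' := a * (P'' * Q * S + P' * Q' * S + P' * Q * S')
    + (d - a) * (P' * Q' * S + P * Q'' * S + P * Q' * S')
    + (P' * Q * S' + P * Q' * S' + P * Q * S'') in
  L ^+ 2 + P * Q * S * L' - (P' * Q * S + P * Q' * S + P * Q * S') * L =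
  S ^+ 2 * (4%:R * ((d - a) * (d - a - 1)) * P ^+ 3 - 16%:R * (a * (a - 1)) * Q ^+ 3)
  + (4%:R * d + 5%:R) * (
    384 * x ^+ 3 + (- 256) * x ^+ 3 * d
     + 320 * x ^+ 3 * a + 384 * x ^+ 6
     + (- 2176) * x ^+ 6 * d + 2576 * x ^+ 6 * a
     + (- 6408) * x ^+ 9 + (- 2064) * x ^+ 9 * d
     + 1392 * x ^+ 9 * a + 8364 * x ^+ 12 + 12928 * x ^+ 12 * d
     + (- 17024) * x ^+ 12 * a + 408 * x ^+ 15 + 4096 * x ^+ 15 * d
     + 2368 * x ^+ 15 * a + (- 1386) * x ^+ 18 + (- 336) * x ^+ 18 * d
     + 852 * x ^+ 18 * a + (- 120) * x ^+ 21
     + (- 100) * x ^+ 21 * d + (- 172) * x ^+ 21 * a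
     + 24 * x ^+ 24 + 8 * x ^+ 24 * d + 8 * x ^+ 24 * a).
Proof. by move=> /=; ring. Qed.

(** The hypothesis is Q' / Q = k P' / P without denominators. *)
Lemma logderiv_exp (R : comNzRingType) (P Q : {poly R}) (k : nat) m :
  P * Q^`() = k%:R * Q * P^`() -> P * (Q ^+ m)^`() = (k * m)%:R * Q ^+ m * P^`().
Proof.
move=> E; elim: m => [|m IHm]; first by rewrite expr0 derivC muln0 !(mulr0, mul0r).
rewrite exprS derivM mulrDr mulrA E mulrCA IHm mulnS natrD; ring.
Qed.

(** The formula f'' / f = (L / M)^2 + (L / M)' without denominators. *)
Lemma second_logderiv (R : comNzRingType) (f M L : {poly R}) :
    M * f^`() = f * L ->
  M ^+ 2 * f^`()^`() = f * (L ^+ 2 + M * L^`() - M^`() * L).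
Proof.
move=> E; have := congr1 (@deriv R) E; rewrite !derivM => E'.
have -> : M ^+ 2 * f^`()^`() = M * (M^`() * f^`() + M * f^`()^`()) - M^`() * (M * f^`()) by ring.
rewrite E' E; transitivity ((M * f^`()) * L + M * f * L^`() - M^`() * (f * L)); first by ring.
by rewrite E; ring.
Qed.

Section TetraSize.
Variable F : fieldType.
Local Notation Phi := (tPhi F).
Local Notation Psi := (tPsi F).
Local Notation Edge := (tEdge F).
Local Notation U := (tU F).
Local Notation V := (tV F).

Lemma size_polyM_leS (q r : {poly F}) i j :
  (size q <= i.+1)%N -> (size r <= j.+1)%N -> (size (q * r)%R <= (i + j).+1)%N.
Proof. by move=> sq sr; apply: leq_trans (size_polyMleq _ _) _; lia. Qed.

Lemma size_polyX_leS (q : {poly F}) i j :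
  (size q <= i.+1)%N -> (size (q ^+ j)%R <= (i * j).+1)%N.
Proof. by move=> sq; apply: leq_trans (size_poly_exp_leq _ _) _; rewrite ltnS leq_mul2r; lia. Qed.

Let size_nat_le (k : nat) : (size (k%:R : {poly F}) <= 1)%N.
Proof. by rewrite -polyC_natr size_polyC_leq1. Qed.

Let size_natXn_le (k i : nat) : (size (k%:R * 'X^i : {poly F})%R <= i.+1)%N.
Proof. by apply: (@size_polyM_leS _ _ 0); rewrite ?size_polyXn. Qed.

Lemma size_tPhi : size Phi = 5%N.
Proof.
rewrite /tPhi size_polyDl size_polyXn //.
exact: leq_ltn_trans (size_natXn_le 4 1) _.
Qed.

Lemma tPhi_monic : Phi \is monic.
Proof.
rewrite monicE /tPhi lead_coefDl ?lead_coefXn // size_polyXn.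
exact: leq_ltn_trans (size_natXn_le 4 1) _.
Qed.

Let size_Edge_tail : (size (- (10%:R * 'X^3) - 2%:R : {poly F})%R <= 4)%N.
Proof.
apply: leq_trans (size_polyD _ _) _; rewrite geq_max !size_polyN size_natXn_le /=.
exact: leq_trans (size_nat_le 2) _.
Qed.

Lemma size_tEdge : size Edge = 7%N.
Proof.
rewrite /tEdge -addrA size_polyDl size_polyXn //.
exact: leq_ltn_trans size_Edge_tail _.
Qed.

Lemma tEdge_monic : Edge \is monic.
Proof.
rewrite monicE /tEdge -addrA lead_coefDl ?lead_coefXn // size_polyXn.
exact: leq_ltn_trans size_Edge_tail _.
Qed.

Lemma size_tV : (size V <= 10)%N.
Proof.
apply: (@size_polyM_leS _ _ 0 9); rewrite ?size_nat_le //.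
apply: (@size_polyX_leS _ 3 3); apply: leq_trans (size_polyD _ _) _.
by rewrite geq_max size_natXn_le size_polyN size_poly1.
Qed.

Lemma size_tU : (size U <= 13)%N.
Proof. by apply: (@size_polyX_leS _ 4 3); rewrite size_tPhi. Qed.

End TetraSize.

(** The constants cancelled below, such as 4, 8, 32, 972 and 1728, all have this shape. *)
Lemma Fp_smooth_neq0 (p : nat) : prime p -> (3 < p)%N ->
  forall i j, (2 ^ i * 3 ^ j)%:R != 0 :> 'F_p.
Proof.
move=> p_pr p_gt3 i j.
rewrite -(dvdn_pcharf (pchar_Fp p_pr)) Euclid_dvdM // !Euclid_dvdX // !dvdn_prime2 //.
by apply/negP; lia.
Qed.

Section TetraForm.
Variables (p n b : nat) (c : nat -> 'F_p).
Hypotheses (p_pr : prime p) (p_gt3 : (3 < p)%N) (p_mod3 : (p %% 3 = 2)%N).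
Hypotheses (b_le1 : (b <= 1)%N) (pE : p.+1 = (12 * n + 6 * b)%N).
Hypothesis c_n : c n = 1.
Hypothesis c_rec : forall i, (i <= n)%N ->
  rec_lhs 'F_p b i * c i = rec_rhs 'F_p i.+1 * c i.+1.

Local Notation F := 'F_p.
Local Notation Phi := (tPhi F).
Local Notation Psi := (tPsi F).
Local Notation Edge := (tEdge F).
Local Notation U := (tU F).
Local Notation V := (tV F).
Local Notation w := (1728%:R : F).

Let p0 : p%:R = 0 :> F. Proof. exact: pchar_Fp_0. Qed.

Let weight1 : (12 * n + 6 * b)%:R = 1 :> F.
Proof. by rewrite -pE -natr1 p0 add0r. Qed.

Let smooth_neq0 i j : (2 ^ i * 3 ^ j)%:R != 0 :> F := Fp_smooth_neq0 p_pr p_gt3 i j.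

Let n2 : 2%:R != 0 :> F. Proof. exact: (smooth_neq0 1 0). Qed.
Let n4 : 4%:R != 0 :> F. Proof. exact: (smooth_neq0 2 0). Qed.
Let w_neq0 : w != 0. Proof. exact: (smooth_neq0 6 3). Qed.

Definition tmono i := U ^+ i * V ^+ (n - i) * Edge ^+ b.

Let dnat (k : nat) : (k%:R : {poly F})^`() = 0.
Proof. by rewrite derivMn derivC mul0rn. Qed.

Let logderiv_U i : Phi * (U ^+ i)^`() = (3 * i)%:R * U ^+ i * Phi^`().
Proof.
apply: logderiv_exp; rewrite (@logderiv_exp _ _ _ 1) //.
by rewrite mul1r mulrC.
Qed.

Let logderiv_V i : Psi * (V ^+ i)^`() = (3 * i)%:R * V ^+ i * Psi^`().
Proof.
apply: logderiv_exp; rewrite /tV derivM dnat mul0r add0r mulrCA (@logderiv_exp _ _ _ 1).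
  by rewrite mul1n; ring.
by rewrite mul1r mulrC.
Qed.

Let logder0 i : {poly F} :=
  (3 * i)%:R * (4%:R * 'X^3 + 4%:R) * Psi + ((3 * n)%:R - (3 * i)%:R) * Phi * (6%:R * 'X^2).

Let deriv_logder0 i : (logder0 i)^`() =
  (3 * i)%:R * (12%:R * 'X^2 * Psi + (4%:R * 'X^3 + 4%:R) * (6%:R * 'X^2))
  + ((3 * n)%:R - (3 * i)%:R) * ((4%:R * 'X^3 + 4%:R) * (6%:R * 'X^2) + Phi * (12%:R * 'X)).
Proof.
have deriv3 (P Q S : {poly F}) : (P * Q * S)^`() = P^`() * Q * S + P * Q^`() * S + P * Q * S^`().
  by rewrite !derivM; ring.
have dPhi2 : (4%:R * 'X^3 + 4%:R : {poly F})^`() = 12%:R * 'X^2.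
  by rewrite derivD (derivM 4%:R) !dnat derivXn /=; ring.
have dPsi2 : (6%:R * 'X^2 : {poly F})^`() = 12%:R * 'X.
  by rewrite (derivM 6%:R) dnat derivXn /=; ring.
rewrite derivD (deriv3 (3 * i)%:R) (deriv3 _ Phi) (derivB (3 * n)%:R) !dnat deriv_tPhi deriv_tPsi dPhi2 dPsi2.
by ring.
Qed.

Let logderiv_UV i : (i <= n)%N -> Phi * Psi * (U ^+ i * V ^+ (n - i))^`() =
  (U ^+ i * V ^+ (n - i)) * logder0 i.
Proof.
move=> lein; have lU := logderiv_U i; have lV := logderiv_V (n - i).
have dE : (3 * (n - i))%:R = (3 * n)%:R - (3 * i)%:R :> {poly F}.
  by rewrite mulnBr natrB // leq_mul2l.
rewrite derivM; transitivity (Psi * V ^+ (n - i) * (Phi * (U ^+ i)^`())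
       + Phi * U ^+ i * (Psi * (V ^+ (n - i))^`())); first by ring.
by rewrite lU lV dE deriv_tPhi deriv_tPsi /logder0; ring.
Qed.

Let ode_mono i : (i <= n)%N ->
  (Phi * Psi * Edge ^+ b) ^+ 2 * (tmono i)^`()^`() =
  tmono i * Edge ^+ (2 * b) *
   (4%:R * ((3 * (n - i))%:R * ((3 * (n - i))%:R - 1)) * U
    - 4%:R * ((3 * i)%:R * ((3 * i)%:R - 1)) * V).
Proof.
move=> lein.
have -> : (3 * (n - i))%:R = (3 * n)%:R - (3 * i)%:R :> {poly F}.
  by rewrite mulnBr natrB // leq_mul2l.
have hn : 4%:R * (3 * n)%:R + 6%:R * b%:R = 1 :> {poly F}.
  transitivity (((12 * n + 6 * b)%:R : F)%:P); last by rewrite weight1.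
  by rewrite rmorph_nat; ring.
have dEdge2 : (6%:R * 'X^5 - 30%:R * 'X^2 : {poly F})^`() = 30%:R * 'X^4 - 60%:R * 'X.
  by rewrite derivB (derivM 6%:R) (derivM 30%:R) !dnat !derivXn /=; ring.
have L0 := logderiv_UV lein.
rewrite /tmono; case: b b_le1 hn => [|[|//]] _ hn.
  rewrite !expr0 !mulr1 (second_logderiv L0).
  have := @tetra_ode_alg0 _ ('X : {poly F}) (3 * i)%:R (3 * n)%:R.
  have -> : 4%:R * (3 * n)%:R - 1 = 0 :> {poly F} by apply: (addIr 1); rewrite add0r -[RHS]hn; ring.
  rewrite /= mul0r addr0 -/(tPhi F) -/(tPsi F) => E.
  congr (_ * _); transitivity (4%:R * (((3 * n)%:R - (3 * i)%:R) * ((3 * n)%:R - (3 * i)%:R - 1)) * tPhi F ^+ 3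
      - 16%:R * ((3 * i)%:R * ((3 * i)%:R - 1)) * tPsi F ^+ 3); last by rewrite /tU /tV; ring.
  by rewrite -E deriv_logder0 derivM deriv_tPhi deriv_tPsi /logder0; ring.
rewrite expr1 muln1.
pose L := logder0 i * Edge + Phi * Psi * (6%:R * 'X^5 - 30%:R * 'X^2).
have L1 : Phi * Psi * Edge * (U ^+ i * V ^+ (n - i) * Edge)^`() = (U ^+ i * V ^+ (n - i) * Edge) * L.
  rewrite derivM deriv_tEdge; transitivity (Phi * Psi * (U ^+ i * V ^+ (n - i))^`() * Edge ^+ 2
     + Phi * Psi * Edge * (U ^+ i * V ^+ (n - i)) * (6%:R * 'X^5 - 30%:R * 'X^2)); first by ring.
  by rewrite L0 /L; ring.
rewrite (second_logderiv L1) -[RHS]mulrA; congr (_ * _).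
have := @tetra_ode_alg1 _ ('X : {poly F}) (3 * i)%:R (3 * n)%:R.
have -> : 4%:R * (3 * n)%:R + 5%:R = 0 :> {poly F} by apply: (addIr 1); rewrite add0r -[RHS]hn; ring.
rewrite /= mul0r addr0 -/(tPhi F) -/(tPsi F) -/(tEdge F) => E.
transitivity (Edge ^+ 2 * (4%:R * (((3 * n)%:R - (3 * i)%:R) * ((3 * n)%:R - (3 * i)%:R - 1)) * tPhi F ^+ 3
      - 16%:R * ((3 * i)%:R * ((3 * i)%:R - 1)) * tPsi F ^+ 3)); last by rewrite /tU /tV; ring.
have -> : L^`() = (logder0 i)^`() * Edge + logder0 i * Edge^`()
    + ((Phi^`() * Psi + Phi * Psi^`()) * (6%:R * 'X^5 - 30%:R * 'X^2)
       + Phi * Psi * (30%:R * 'X^4 - 60%:R * 'X)).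
  by rewrite -dEdge2 -!derivM -derivD.
have -> : (Phi * Psi * Edge)^`() = (Phi^`() * Psi + Phi * Psi^`()) * Edge + Phi * Psi * Edge^`().
  by rewrite -!derivM.
by rewrite deriv_logder0 deriv_tPhi deriv_tPsi deriv_tEdge -E /L /logder0; ring.
Qed.

(** This is P(1728 U / V) multiplied by V^n to make it a polynomial, and by Edge^b, the counterpart
    of the factor E6^b. *)
Definition tform : {poly F} := \sum_(i < n.+1) (c i * w ^+ i)%:P * tmono i.

Let tform_rec i : (i <= n)%N ->
  4%:R * ((3 * (n - i))%:R * ((3 * (n - i))%:R - 1)) * (c i * w ^+ i) =
  4%:R * ((3 * i.+1)%:R * ((3 * i.+1)%:R - 1)) * (c i.+1 * w ^+ i.+1).
Proof.
move=> lein; apply: (mulfI n4).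
(* The relation 12 n + 6 b = 1 in F_p eliminates n: with X = 12 i + 6 b the left factor becomes (1 -
   X) (1 - X - 4) = (X - 1) (X + 3), which is [rec_lhs]. *)
have bE : 4%:R * (3 * (n - i))%:R = 1 - (12 * i + 6 * b)%:R :> F.
  rewrite mulnBr natrB ?leq_mul2l ?lein ?orbT //.
  by rewrite -[X in _ = X - _]weight1; ring.
transitivity ((4%:R * (3 * (n - i))%:R) * (4%:R * (3 * (n - i))%:R - 4%:R) * (c i * w ^+ i)).
  by ring.
rewrite bE; transitivity (rec_lhs F b i * c i * w ^+ i); first by rewrite /rec_lhs; ring.
by rewrite c_rec // /rec_rhs exprS; ring.
Qed.

Let Phi_neq0 : Phi != 0.
Proof.
apply/eqP => /(congr1 (fun q : {poly F} => q`_4)) /eqP.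
by rewrite /tPhi coefD coefXn mulr_natl coefMn coefX mul0rn addr0 coef0 oner_eq0.
Qed.

Let Psi_neq0 : Psi != 0.
Proof.
apply/eqP => /(congr1 (fun q : {poly F} => q`_0)) /eqP.
by rewrite /tPsi coefB mulr_natl coefMn coefXn mul0rn coef1 sub0r coef0 oppr_eq0 oner_eq0.
Qed.

Let Edge_neq0 : Edge != 0.
Proof.
apply/eqP => /(congr1 (fun q : {poly F} => q`_6)) /eqP.
rewrite /tEdge !coefB mulr_natl coefMn !coefXn mul0rn -polyC_natr coefC.
by rewrite !subr0 coef0 oner_eq0.
Qed.

(** By [ode_mono] the term i contributes to U^(i+1) V^(n-i) and to U^i V^(n+1-i). The recurrence
    makes neighbouring contributions cancel, and the two extreme ones contain the factors n - n and
    0. *)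
Lemma tform_deriv2 : tform^`()^`() = 0.
Proof.
apply: (@mulfI _ ((Phi * Psi * Edge ^+ b) ^+ 2)).
  by rewrite !(expf_neq0, mulf_neq0) ?Phi_neq0 ?Psi_neq0 ?Edge_neq0.
rewrite mulr0 /tform; pose m i := U ^+ i * V ^+ (n.+1 - i) * Edge ^+ b.
pose k j i : {poly F} := (4%:R * ((3 * j)%:R * ((3 * j)%:R - 1)) * (c i * w ^+ i))%:P.
have -> : (\sum_(i < n.+1) (c i * w ^+ i)%:P * tmono i)^`()^`() =
    \sum_(i < n.+1) (c i * w ^+ i)%:P * (tmono i)^`()^`().
  by rewrite !linear_sum /=; apply: eq_bigr => i _; rewrite !deriv_mulC.
rewrite mulr_sumr.
transitivity (Edge ^+ (2 * b) * \sum_(i < n.+1) (k (n - i)%N i * m i.+1 - k i i * m i)).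
  rewrite mulr_sumr; apply: eq_bigr => -[j ltj] _ /=; have lejn : (j <= n)%N by [].
  rewrite mulrCA ode_mono // /k /m /tmono !rmorphM !rmorphB !rmorph_nat rmorph1 subSS subSn //.
  rewrite [V ^+ _.+1]exprS [U ^+ _.+1]exprS; ring.
rewrite sumrB [X in _ - X]big_ord_recl /= [X in X - _]big_ord_recr /=.
have -> : k (n - n)%N n = 0 by rewrite /k subnn muln0 mul0r mulr0 mul0r polyC0.
have -> : k 0%N 0%N = 0 by rewrite /k muln0 mul0r mulr0 mul0r polyC0.
rewrite !mul0r addr0 add0r -sumrB big1 ?mulr0 // => -[j ltj] _ /=.
by rewrite /bump /= -mulrBl /k tform_rec ?subrr ?mul0r // ltnW.
Qed.

Let size_tmono i : (size (tmono i) <= (12 * i + 9 * (n - i) + 6 * b).+1)%N.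
Proof.
apply: size_polyM_leS; last by apply: size_polyX_leS; rewrite size_tEdge.
by apply: size_polyM_leS; apply: size_polyX_leS; rewrite ?size_tU ?size_tV.
Qed.

Let degree_le i : (i <= n)%N -> (12 * i + 9 * (n - i) + 6 * b <= p.+1)%N.
Proof. by rewrite pE; clear; lia. Qed.

Let degree_lt i : (i < n)%N -> (12 * i + 9 * (n - i) + 6 * b < p.+1)%N.
Proof. by rewrite pE; clear; lia. Qed.

Let size_tform : (size tform <= p.+2)%N.
Proof.
apply: leq_trans (size_sum _ _ _) _; apply/bigmax_leqP => -[i lti] _ /=.
apply: (@size_polyM_leS _ _ _ 0 p.+1); first exact: size_polyC_leq1.
by apply: leq_trans (size_tmono i) _; rewrite ltnS degree_le.
Qed.

Let tform_lead : tform`_p.+1 = w ^+ n.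
Proof.
rewrite /tform big_ord_recr /= coefD coef_sum big1 ?add0r => [|[i lti] _ /=]; last first.
  by rewrite coefCM nth_default ?mulr0 //; apply: leq_trans (size_tmono i) (degree_lt lti).
rewrite coefCM c_n mul1r /tmono subnn expr0 mulr1.
have mU : U ^+ n * Edge ^+ b \is monic by rewrite rpredM ?rpredX ?tPhi_monic ?tEdge_monic.
have : size (U ^+ n * Edge ^+ b)%R = p.+2.
  rewrite size_monicM ?rpredX ?tPhi_monic ?monic_neq0 ?rpredX ?tPhi_monic ?tEdge_monic //.
  rewrite -[size (U ^+ n)%R]prednK ?size_poly_gt0 ?monic_neq0 ?rpredX ?tPhi_monic ?tEdge_monic //.
  rewrite -[size (Edge ^+ b)%R]prednK ?size_poly_gt0 ?monic_neq0 ?rpredX ?tPhi_monic ?tEdge_monic //.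
  by rewrite !size_exp size_tEdge size_tPhi pE; clear; lia.
by move=> sE; move: mU; rewrite monicE lead_coefE sE /= => /eqP ->; rewrite mulr1.
Qed.

Let tform_coef3 i : ~~ (3 %| i)%N -> tform`_i = 0.
Proof.
move=> ndvd; suff [g ->] : exists g, tform = g \Po 'X^3.
  by rewrite coef_comp_poly_Xn // (negPf ndvd).
have UE : U = ('X * ('X + (4%:R)%:P) ^+ 3) \Po 'X^3.
  rewrite comp_polyM rmorphXn /= comp_polyD comp_polyC comp_polyX polyC_natr /tU /tPhi.
  by ring.
have VE : V = ((4%:R)%:P * ((2%:R)%:P * 'X - 1%:P) ^+ 3) \Po 'X^3.
  by rewrite comp_polyM rmorphXn /= comp_polyB comp_polyM !comp_polyC comp_polyX !polyC_natr.
have EE : Edge = ('X ^+ 2 - (10%:R)%:P * 'X - (2%:R)%:P) \Po 'X^3.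
  rewrite !comp_polyB rmorphXn /= comp_polyM !comp_polyC comp_polyX !polyC_natr /tEdge.
  by rewrite -exprM.
move: UE VE EE; set u := ('X * _); set v := (_ * _ ^+ 3); set e := (_ - (2%:R)%:P) => UE VE EE.
exists (\sum_(i < n.+1) (c i * w ^+ i)%:P * (u ^+ i * v ^+ (n - i) * e ^+ b)).
rewrite rmorph_sum /=; apply: eq_bigr => j _.
by rewrite comp_polyM comp_polyC !comp_polyM !rmorphXn /= -UE -VE -EE.
Qed.

(** A vanishing second derivative allows, up to degree p + 1, only the exponents 0, 1, p and p + 1.
    Of these, 1 and p are not divisible by 3, as p is 2 modulo 3. *)
Let tform_coef_mid i : (0 < i < p.+1)%N -> tform`_i = 0.
Proof.
move=> iP; case: (boolP (3 %| i)%N) => [dvd3|/tform_coef3//].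
have i2 : (i = (i - 2).+2)%N by clear -iP dvd3; lia.
have := congr1 (fun q : {poly F} => q`_(i - 2)) tform_deriv2.
rewrite !coef_deriv coef0 -i2 -mulrnA => /eqP.
rewrite -mulr_natr mulf_eq0 => /orP[/eqP-> //|].
rewrite -(dvdn_pcharf (pchar_Fp p_pr)) Euclid_dvdM // => /orP[] /dvdn_leq; clear -iP dvd3 i2 p_mod3.
  by move=> h; lia.
by move=> h; lia.
Qed.

Lemma tformE : tform = (w ^+ n)%:P * 'X^(p.+1) + (tform`_0)%:P.
Proof.
apply/polyP => i; rewrite [RHS]coefD coefCM coefXn coefC.
case: (posnP i) => [->|i0]; first by rewrite /= mulr0 add0r.
rewrite /= addr0; case: (ltngtP i p.+1) => [lti|gti|->].
- by rewrite mulr0 tform_coef_mid ?i0.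
- by rewrite mulr0 nth_default //; apply: leq_trans size_tform gti.
- by rewrite mulr1 tform_lead.
Qed.

Let cube_root : exists z : F, z ^+ 3 = - 4%:R.
Proof.
(* For p = 3 q + 2 the exponent e = 2 q + 1 satisfies 3 e + 1 = 2 p, and x^(2p) = x^2 in F_p. *)
exists ((- 4%:R) ^+ (2 * (p %/ 3)).+1); rewrite -exprM.
apply: (@mulIf _ (- 4%:R)); rewrite ?oppr_eq0 // -exprSr.
have -> : ((2 * (p %/ 3)).+1 * 3).+1 = (p * 2)%N by clear -p_mod3; lia.
by rewrite exprM -[X in _ ^+ X ^+ 2](card_Fp p_pr) expf_card expr2.
Qed.

(** At a root z of Phi with z^3 = - 4 the factor U vanishes to order 3, so the value and the first
    derivative of [tform] come from the term i = 0, namely [c 0] V^n Edge^b. For the binomial they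
    are proportional to z^2 + k and z. Comparing logarithmic derivatives gives k z = - 2, that is 2
    k = z^2, whence k^3 = z^6 / 8 = 2. *)
Lemma tform_shape : exists2 k : F, k ^+ 3 = 2%:R & tform = (w ^+ n)%:P * ('X^(p.+1) + k%:P).
Proof.
have [z zE] := cube_root.
have zp : z ^+ p = z by rewrite -[X in _ ^+ X](card_Fp p_pr) expf_card.
have z4 : z ^+ 4 = - 4%:R * z by rewrite exprSr zE.
have z5 : z ^+ 5 = - 4%:R * z ^+ 2 by rewrite (exprD z 3 2) zE.
have z6 : z ^+ 6 = 16%:R by rewrite (exprM z 3 2) zE; ring.
have natE (m : nat) : (m%:R : {poly F}).[z] = m%:R by rewrite -polyC_natr hornerC.
have Phi_z : Phi.[z] = 0.
  by rewrite /tPhi hornerD (hornerM 4%:R) natE hornerXn hornerX z4; ring.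
have Psi_z : Psi.[z] = - 9%:R.
  by rewrite /tPsi hornerD hornerN (natE 1) (hornerM 2%:R) natE hornerXn zE; ring.
have Edge_z : Edge.[z] = 54%:R.
  by rewrite /tEdge !hornerD !hornerN (hornerM 10%:R) !natE !hornerXn zE z6; ring.
have dPsi_z : (Psi^`()).[z] = 6%:R * z ^+ 2.
  by rewrite deriv_tPsi (hornerM 6%:R) natE hornerXn.
have dEdge_z : (Edge^`()).[z] = - 54%:R * z ^+ 2.
  by rewrite deriv_tEdge hornerD hornerN (hornerM 6%:R) (hornerM 30%:R) !natE !hornerXn z5; ring.
pose f := V ^+ n * Edge ^+ b.
have dE : Psi * Edge * f^`() = f * ((3 * n)%:R * Psi^`() * Edge + b%:R * Psi * Edge^`()).
  have lE : Edge * (Edge ^+ b)^`() = (1 * b)%:R * Edge ^+ b * Edge^`().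
    by apply: logderiv_exp; rewrite mul1r mulrC.
  rewrite /f derivM; transitivity ((Psi * (V ^+ n)^`()) * (Edge * Edge ^+ b)
    + V ^+ n * Psi * (Edge * (Edge ^+ b)^`())); first by ring.
  by rewrite logderiv_V lE mul1n; ring.
have [R tformR] : exists R, tform = (c 0%N)%:P * f + U * R.
  exists (\sum_(i < n) (c i.+1 * w ^+ i.+1)%:P * (U ^+ i * V ^+ (n - i.+1) * Edge ^+ b)).
  rewrite /tform big_ord_recl /= /tmono subn0 expr0 mulr1 mul1r mulr_sumr; congr (_ + _).
  by apply: eq_bigr => i _; rewrite [U ^+ _]exprS; ring.
have U_z : U.[z] = 0 by rewrite horner_exp Phi_z expr0n.
have dU_z : (U^`()).[z] = 0.
  by rewrite /tU !exprS expr0 mulr1 !derivM !hornerD !hornerM Phi_z; ring.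
have wn_neq0 : w ^+ n != 0 := expf_neq0 n w_neq0.
have p1 : p.+1%:R = 1 :> F by rewrite -natr1 p0 add0r.
pose k := tform`_0 / w ^+ n.
have kE : tform`_0 = w ^+ n * k by rewrite /k mulrCA (mulfV wn_neq0) mulr1.
have tE : tform = (w ^+ n)%:P * ('X^(p.+1) + k%:P) by rewrite mulrDr -polyCM -kE; exact: tformE.
have tform_z : tform.[z] = w ^+ n * (z ^+ 2 + k).
  by rewrite tE hornerM hornerD !hornerC hornerXn exprS zp expr2.
have dtform_z : (tform^`()).[z] = w ^+ n * z.
  rewrite tE deriv_mulC derivD derivC addr0 derivXn hornerM hornerC hornerMn hornerXn.
  by rewrite -[_ *+ p.+1]mulr_natr p1 mulr1 /= zp.
have g_z : (c 0%N * f.[z]) = w ^+ n * (z ^+ 2 + k).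
  by rewrite -tform_z tformR hornerD (hornerM (c 0%N)%:P) (hornerM U) hornerC U_z mul0r addr0.
have dg_z : (c 0%N * (f^`()).[z]) = w ^+ n * z.
  rewrite -dtform_z tformR derivD deriv_mulC (derivM U) !hornerD (hornerM (c 0%N)%:P).
  by rewrite (hornerM U^`()) (hornerM U) hornerC U_z dU_z; ring.
have key : 2%:R * k = z ^+ 2.
  have z_neq0 : z != 0 by apply: contraTneq n4 => z0; move: zE; rewrite z0 expr0n /= => /eqP;
    rewrite eq_sym oppr_eq0 negbK.
  have := congr1 (fun q : {poly F} => c 0%N * q.[z]) dE.
  rewrite /= (hornerM (Psi * Edge)) (hornerM Psi Edge) (hornerM f).
  rewrite (hornerD ((3 * n)%:R * Psi^`() * Edge)).
  rewrite (hornerM ((3 * n)%:R * Psi^`())) (hornerM (3 * n)%:R) (hornerM (b%:R * Psi)) (hornerM b%:R).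
  rewrite !natE Psi_z Edge_z dPsi_z dEdge_z => E.
  (* The derivative formula yields the factor 972 n + 486 b; twelve times it is 972 (12 n + 6 b),
     and 12 n + 6 b is 1 in F_p. *)
  have {}E : (- 486%:R * (w ^+ n * z)) * 12%:R =
      w ^+ n * (z ^+ 2 + k) * (972%:R * z ^+ 2 * (12 * n + 6 * b)%:R).
    rewrite -dg_z -g_z; transitivity ((c 0%N * (- 9%:R * 54%:R * (f^`()).[z])) * 12%:R); first by ring.
    by rewrite E; ring.
  have n972 : 972%:R != 0 :> F := smooth_neq0 2 5.
  have nz : 972%:R * (w ^+ n * z) != 0 := mulf_neq0 n972 (mulf_neq0 wn_neq0 z_neq0).
  have kz : k * z = - 2%:R.
    apply: (mulfI nz); rewrite weight1 in E.
    transitivity (w ^+ n * (z ^+ 2 + k) * (972%:R * z ^+ 2 * 1) - 972%:R * w ^+ n * z ^+ 4); first by ring.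
    by rewrite -E z4; ring.
  apply: (mulfI n2).
  transitivity (- (k * z ^+ 3)); first by rewrite zE; ring.
  by transitivity (- (k * z) * z ^+ 2); [ring | rewrite kz; ring].
exists k => //.
apply: (mulfI (smooth_neq0 3 0)).
transitivity ((2%:R * k) ^+ 3); first by ring.
by rewrite key -exprM z6; ring.
Qed.

End TetraForm.

(** * The roots of the polynomial *)

Lemma homogenize_prod (R : comNzRingType) (rs : seq R) (x y : {poly R}) :
  \sum_(i < (size rs).+1) ((\prod_(r <- rs) ('X - r%:P))`_i)%:P * (x ^+ i * y ^+ (size rs - i))
  = \prod_(r <- rs) (x - r%:P * y).
Proof.
elim: rs => [|r rs IHrs].
  by rewrite !big_nil big_ord_recl big_ord0 coef1 !mulr1 addr0 polyC1.
rewrite !big_cons -IHrs /=; set q := \prod_(_ <- _) _.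
have coefE i : (('X - r%:P) * q)`_i = (if i is j.+1 then q`_j else 0) - r * q`_i.
  by rewrite mulrBl coefB coefXM coefCM; case: i.
rewrite (eq_bigr (fun i : 'I_(size rs).+2 =>
   ((if i : nat is j.+1 then q`_j else 0)%:P * (x ^+ i * y ^+ ((size rs).+1 - i))
    - (r * q`_i)%:P * (x ^+ i * y ^+ ((size rs).+1 - i))))); last first.
  by move=> i _; rewrite coefE polyCB mulrBl.
rewrite sumrB big_ord_recl [X in _ - X]big_ord_recr /= polyC0 mul0r add0r.
have -> : q`_(size rs).+1 = 0 by rewrite nth_default // size_prod_XsubC.
rewrite mulr0 polyC0 mul0r addr0 mulrBl !mulr_sumr; congr (_ - _); apply: eq_bigr => -[i lti] _ /=.
  by rewrite /bump add1n subSS exprS; ring.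
by rewrite subSn // exprS polyCM; ring.
Qed.

Section Roots.
Variables (p n b : nat) (c : nat -> 'F_p).
Hypotheses (p_pr : prime p) (p_gt3 : (3 < p)%N) (p_mod3 : (p %% 3 = 2)%N).
Hypotheses (b_le1 : (b <= 1)%N) (pE : p.+1 = (12 * n + 6 * b)%N).
Hypothesis c_n : c n = 1.
Hypothesis c_rec : forall i, (i <= n)%N ->
  rec_lhs 'F_p b i * c i = rec_rhs 'F_p i.+1 * c i.+1.
Variables (K : closedFieldType) (iota : {rmorphism 'F_p -> K}) (rs : seq K).
Hypothesis rsE : map_poly iota (\poly_(i < n.+1) c i) = \prod_(r <- rs) ('X - r%:P).

Local Notation w := (1728%:R : K).
Local Notation U := (tU K).
Local Notation V := (tV K).
Local Notation Edge := (tEdge K).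

Let smooth_neq0 i j : (2 ^ i * 3 ^ j)%:R != 0 :> K.
Proof. by rewrite -(rmorph_nat iota) fmorph_eq0 Fp_smooth_neq0. Qed.

Let p0 : p%:R = 0 :> K.
Proof. by rewrite -(rmorph_nat iota) pchar_Fp_0 ?rmorph0. Qed.

Let w_neq0 : w != 0. Proof. exact: (smooth_neq0 6 3). Qed.

Let size_rs : size rs = n.
Proof.
have /(congr1 (fun q : {poly K} => size q)) := rsE.
by rewrite size_prod_XsubC size_map_poly size_poly_eq ?c_n ?oner_eq0 // => -[].
Qed.

Let map_tPhi : map_poly iota (tPhi 'F_p) = tPhi K.
Proof. by rewrite /tPhi !mulr_natl rmorphD rmorphMn /= map_polyXn map_polyX. Qed.
Let map_tPsi : map_poly iota (tPsi 'F_p) = tPsi K.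
Proof. by rewrite /tPsi !mulr_natl rmorphB rmorphMn /= map_polyXn rmorph1. Qed.
Let map_tEdge : map_poly iota (tEdge 'F_p) = Edge.
Proof. by rewrite /tEdge !mulr_natl !rmorphB rmorphMn /= !map_polyXn rmorph_nat. Qed.
Let map_tU : map_poly iota (tU 'F_p) = U.
Proof. by rewrite /tU rmorphXn /= map_tPhi. Qed.
Let map_tV : map_poly iota (tV 'F_p) = V.
Proof. by rewrite /tV rmorphM rmorphXn /= map_tPsi rmorph_nat. Qed.

Let map_tmono i : map_poly iota (tmono p n b i) = U ^+ i * V ^+ (n - i) * Edge ^+ b.
Proof.
rewrite /tmono; move: map_tU map_tV map_tEdge.
by move: (tU 'F_p) (tV 'F_p) (tEdge 'F_p) => u v e <- <- <-; rewrite !rmorphM !rmorphXn.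
Qed.

Let factorization : exists2 k : K, k ^+ 3 = 2%:R &
  Edge ^+ b * \prod_(r <- rs) (w%:P * U - r%:P * V) = (w ^+ n)%:P * ('X^(p.+1) + k%:P).
Proof.
have [k k3 formE] := tform_shape p_pr p_gt3 p_mod3 b_le1 pE c_n c_rec.
exists (iota k); first by rewrite -rmorphXn k3 rmorph_nat.
have -> : (w ^+ n)%:P * ('X^(p.+1) + (iota k)%:P) = map_poly iota (tform n b c).
  rewrite formE rmorphM rmorphD /= map_polyXn !map_polyC /=.
  by rewrite (rmorphXn iota) (rmorph_nat iota 1728).
rewrite -homogenize_prod size_rs -rsE /tform rmorph_sum /= mulr_sumr.
apply: eq_bigr => -[i lti] _ /=.
rewrite coef_map coef_poly lti rmorphM /= map_tmono map_polyC /=.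
rewrite (rmorphM iota) (rmorphXn iota) (rmorph_nat iota 1728) /= polyCM polyC_exp exprMn; ring.
Qed.

(** In characteristic p the derivative of X^(p+1) + k is X^p, whose only root 0 is not a root of the
    binomial, as k^3 = 2 is nonzero. *)
Let squarefree (k : K) (q : {poly K}) : k ^+ 3 = 2%:R -> size q != 1 ->
  ~~ (q ^+ 2 %| (w ^+ n)%:P * ('X^(p.+1) + k%:P)).
Proof.
move=> k3 /closed_rootP[s /factor_theorem[q' ->]]; apply/negP.
rewrite mul_polyC dvdpZr ?expf_neq0 // => /dvdpP[T TE].
pose L := T * q' ^+ 2 * ('X - s%:P).
have {}TE : 'X^(p.+1) + k%:P = L * ('X - s%:P) by rewrite TE /L; ring.
have p1 : p.+1%:R = 1 :> K by rewrite -natr1 p0 add0r.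
have := congr1 (fun h : {poly K} => h.[s]) TE.
have := congr1 (fun h : {poly K} => h^`().[s]) TE.
rewrite /= derivD derivC addr0 derivXn derivM derivXsubC mulr1 hornerMn hornerXn hornerD /=.
rewrite /L !(hornerM _ ('X - s%:P)) hornerXsubC subrr !mulr0 addr0.
rewrite -[_ *+ p.+1]mulr_natr p1 mulr1 => /eqP; rewrite expf_eq0 => /andP[_ /eqP ->].
rewrite hornerD hornerXn hornerC => /eqP.
rewrite expr0n /= add0r => /eqP k0; move: k3; rewrite k0 expr0n /= => /eqP.
by rewrite eq_sym (negPf (smooth_neq0 1 0)).
Qed.

Let size_U : size U = 13.
Proof.
have sU : (0 < size U)%N by rewrite size_poly_gt0 monic_neq0 // rpredX ?tPhi_monic.
by rewrite -(prednK sU) size_exp size_tPhi.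
Qed.

Let size_UV r : size (w%:P * U - r%:P * V) = 13.
Proof.
have sU : size (w%:P * U) = 13 by rewrite mul_polyC size_scale ?size_U.
rewrite size_polyDl sU // size_polyN mul_polyC.
exact: leq_ltn_trans (size_scale_leq _ _) (leq_ltn_trans (size_tV K) _).
Qed.

(** A repeated root r would make the square of w U - r V, a polynomial of degree 12, divide the
    squarefree binomial. *)
Lemma hex_roots_uniq : uniq rs.
Proof.
have [k k3 E] := factorization.
apply/negPn/negP => /(uniqPn 0)[i [j [ltij ltj rij]]].
have ltis : (i < size rs)%N := ltn_trans ltij ltj.
pose q := w%:P * U - (rs`_i)%:P * V.
have sq : size q != 1 by rewrite size_UV.
have /negP[] := squarefree k3 sq; rewrite -E dvdp_mull //.
rewrite (big_nth 0) big_mkord (bigD1 (Ordinal ltis)) //= (bigD1 (Ordinal ltj)) /=; last first.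
  by rewrite -val_eqE /= gtn_eqF.
by rewrite -rij mulrA -expr2 dvdp_mulr.
Qed.

Let root_UV r : r \in rs ->
  exists2 s, (w%:P * U - r%:P * V).[s] = 0 & exists2 k, k ^+ 3 = 2%:R & s ^+ p.+1 = - k.
Proof.
move=> r_rs; have [k k3 E] := factorization.
have [s /eqP rt] : exists s, root (w%:P * U - r%:P * V) s by apply/closed_rootP; rewrite size_UV.
exists s => //; exists k => //.
have := congr1 (fun h : {poly K} => h.[s]) E.
rewrite (big_rem r) //= !hornerM rt mul0r mulr0 hornerD !hornerC hornerXn => /esym/eqP.
by rewrite mulf_eq0 expf_eq0 (negPf w_neq0) andbF /= addr_eq0 => /eqP.
Qed.

(** For r = w the factor w U - r V is w (U - V) = w Edge^2, a square up to a constant. *)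
Lemma hex_root_neq r : r \in rs -> r != w.
Proof.
move=> r_rs; have [k k3 E] := factorization.
apply: contraTneq isT => rw; have sE : size Edge != 1 by rewrite size_tEdge.
have /negP[] := squarefree k3 sE; rewrite -E dvdp_mull // (big_rem r) //= dvdp_mulr //.
by rewrite rw -mulrBr tUV_edge dvdp_mull.
Qed.

(** Let t = s^3 for a point s above r. Then t^(p+1) = (- k)^3 = - 2, so Frobenius sends t to - 2 /
    t. This involution exchanges U = t (t + 4)^3 and V = 4 (2 t - 1)^3 up to a common factor, hence
    inverts U / V = r / w. *)
Lemma hex_root_conj r : r \in rs -> r ^+ p * r = w ^+ 2.
Proof.
move=> /root_UV[s rt [k k3 sk]].
have chK : p \in [pchar K] by rewrite inE p_pr p0 eqxx.
pose phi : {rmorphism K -> K} := pFrobenius_aut chK.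
have phiE x : phi x = x ^+ p by [].
pose t := s ^+ 3; pose t' := t ^+ p.
have tt' : t' * t = - 2%:R.
  by rewrite -exprSr -exprM mulnC exprM sk exprNn k3; ring.
have E : w * (t * (t + 4%:R) ^+ 3) = r * (4%:R * (2%:R * t - 1) ^+ 3).
  have natE (m : nat) : (m%:R : {poly K}).[s] = m%:R by rewrite -polyC_natr hornerC.
  apply/eqP; rewrite -subr_eq0 -[X in _ == X]rt hornerD hornerN (hornerM w%:P) (hornerM r%:P) !hornerC.
  rewrite /tU /tV (hornerM 4%:R) !horner_exp /tPhi /tPsi !hornerD hornerN (hornerM 4%:R) (hornerM 2%:R).
  by rewrite !natE (natE 1) !hornerXn hornerX /t; apply/eqP; ring.
clearbody t.
have E' : w * (t' * (t' + 4%:R) ^+ 3) = r ^+ p * (4%:R * (2%:R * t' - 1) ^+ 3).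
  have := congr1 phi E.
  rewrite (rmorphM phi w) (rmorphM phi t) (rmorphM phi r) (rmorphM phi 4%:R) !(rmorphXn phi).
  rewrite (rmorphD phi t) (rmorphB phi) (rmorphM phi 2%:R) (rmorph1 phi).
  by rewrite !(rmorph_nat phi) !phiE.
(* V does not vanish at s: for 2 t = 1 the equation [E] would give t (t + 4)^3 = 0, whereas 16 t (t
   + 4)^3 = 2 t (2 t + 8)^3 would be 9^3. *)
have nt : (2%:R * t - 1) != 0.
  apply/eqP => t0.
  have /eqP : 16%:R * (w * (t * (t + 4%:R) ^+ 3)) = 0 by rewrite E t0; ring.
  have -> : 16%:R * (w * (t * (t + 4%:R) ^+ 3)) = w * ((2%:R * t - 1 + 1) * (2%:R * t - 1 + 9%:R) ^+ 3) by ring.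
  rewrite t0 !add0r mul1r mulf_eq0 (negPf w_neq0) expf_eq0 /=.
  by rewrite (negPf (smooth_neq0 0 2)).
apply: (mulIf (expf_neq0 3 nt)).
have n32 : 32%:R != 0 :> K := smooth_neq0 5 0.
apply: (mulfI n32).
transitivity (8%:R * r ^+ p * (r * (4%:R * (2%:R * t - 1) ^+ 3))); first by ring.
rewrite -E.
have E'' : (t ^+ 4) * (w * (t' * (t' + 4%:R) ^+ 3)) = t ^+ 4 * (r ^+ p * (4%:R * (2%:R * t' - 1) ^+ 3)).
  by rewrite E'.
have L1 : (t ^+ 4) * (w * (t' * (t' + 4%:R) ^+ 3)) = w * ((t' * t) * (t' * t + 4%:R * t) ^+ 3) by ring.
have L2 : t ^+ 4 * (r ^+ p * (4%:R * (2%:R * t' - 1) ^+ 3)) =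
    4%:R * r ^+ p * t * (2%:R * (t' * t) - t) ^+ 3 by ring.
rewrite L1 L2 tt' in E''.
transitivity (- 2%:R * w * (4%:R * r ^+ p * t * (2%:R * (- 2%:R) - t) ^+ 3)); first by ring.
by rewrite -E''; ring.
Qed.

End Roots.

(** * Factorization over the prime field *)

Section Factorization.
Variables (p : nat) (p_pr : prime p).
Local Notation F := 'F_p.
Variables (K : closedFieldType) (iota : {rmorphism F -> K}) (w : F).
Hypothesis w_neq0 : w != 0.

Let chK : p \in [pchar K].
Proof. by rewrite inE p_pr -(rmorph_nat iota) pchar_Fp_0 ?rmorph0 ?eqxx. Qed.

Let Fp_frob (x : F) : x ^+ p = x.
Proof. by rewrite -[X in _ ^+ X](card_Fp p_pr) expf_card. Qed.

Let map_XsubC a : map_poly iota ('X - a%:P) = 'X - (iota a)%:P.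
Proof. by rewrite rmorphB /= map_polyX map_polyC. Qed.

Lemma Fp_image (x : K) : x ^+ p = x -> exists a, x = iota a.
Proof.
move=> xp; have := congr1 (fun q : {poly F} => (map_poly iota q).[x]) (finField_genPoly F).
rewrite rmorphB /= map_polyXn map_polyX hornerD hornerN hornerXn hornerX card_Fp // xp subrr.
rewrite rmorph_prod horner_prod => /esym/eqP; rewrite prodf_seq_eq0 => /hasP[a _ /=].
by rewrite map_XsubC hornerXsubC subr_eq0 => /eqP; exists a.
Qed.

Let root_frob (Q : {poly F}) x : root (map_poly iota Q) x -> root (map_poly iota Q) (x ^+ p).
Proof.
pose phi : {rmorphism K -> K} := pFrobenius_aut chK.
have -> : x ^+ p = phi x by [].
have {2}<- : map_poly phi (map_poly iota Q) = map_poly iota Q.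
  apply/polyP => i; rewrite !coef_map /=.
  by transitivity (iota (Q`_i) ^+ p) => //; rewrite -rmorphXn Fp_frob.
by rewrite /root => /eqP Qx; rewrite horner_map Qx rmorph0.
Qed.

Let conj_facts r : r ^+ p * r = iota w ^+ 2 -> (r ^+ p) ^+ p = r.
Proof.
move=> E; have rp_neq0 : r ^+ p != 0.
  by apply: contra_neq (expf_neq0 2 w_neq0) => rp0; apply: (fmorph_inj iota);
    rewrite rmorphXn -E rp0 mul0r rmorph0.
apply: (mulIf rp_neq0); rewrite -exprMn E -!rmorphXn Fp_frob rmorphXn -E mulrC //.
Qed.

(** By induction on the number of roots, one removes either a root fixed by Frobenius, for which r^2
    = w^2 forces r = - w, or a conjugate pair r, w^2 / r, whose quadratic polynomial has constant
    term w^2. The equation between sizes later yields the parity of the multiplicity of - w. *)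
Lemma conj_factorization (Q : {poly F}) (rs : seq K) :
    map_poly iota Q = \prod_(r <- rs) ('X - r%:P) ->
    (forall r, r \in rs -> r ^+ p * r = iota w ^+ 2 /\ r != iota w) ->
  exists s : seq {poly F},
    [/\ forall g, g \in s -> irreducible_quadratic g,
        size rs = (count_mem (- iota w) rs + 2 * size s)%N
      & Q = ('X + w%:P) ^+ count_mem (- iota w) rs * \prod_(g <- s) g].
Proof.
have [m] := ubnP (size rs); elim: m Q rs => // m IHm Q rs; rewrite ltnS => le_m QE conj_rs.
case: rs => [|r rs0] in le_m QE conj_rs *.
  exists [::]; split=> //; apply: (map_poly_inj iota).
  by rewrite QE !big_nil expr0 mulr1 rmorph1.
have [r_conj r_neq] := conj_rs r (mem_head _ _).
have r_p2 := conj_facts r_conj.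
have map_XaddC : map_poly iota ('X + w%:P) = 'X - (- iota w)%:P.
  by rewrite rmorphD /= map_polyX map_polyC polyCN opprK.
have [rp | rp] := eqVneq (r ^+ p) r.
  have rE : r = - iota w.
    move: r_conj; rewrite rp -expr2 => /eqP; rewrite eqf_sqr (negPf r_neq) /=.
    by move/eqP.
  have /dvdpP[Q' Q'E] : 'X + w%:P %| Q.
    by rewrite -(dvdp_map iota) map_XaddC QE big_cons rE dvdp_mulr.
  have Q'rs : map_poly iota Q' = \prod_(z <- rs0) ('X - z%:P).
    apply: (mulIf (negbT (polyXsubC_eq0 (- iota w)))).
    transitivity (map_poly iota Q); first by rewrite Q'E rmorphM /= map_XaddC.
    by rewrite QE big_cons rE mulrC.
  have [|z z_rs|s [s_irr s_size Q'fac]] := IHm Q' rs0 _ Q'rs _.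
  - by move: le_m.
  - by apply: conj_rs; rewrite inE z_rs orbT.
  exists s; split=> //=; first by rewrite rE eqxx s_size add1n addSn.
  by rewrite rE eqxx Q'E Q'fac mulrC exprS mulrA.
have rp_rs0 : r ^+ p \in rs0.
  have : root (map_poly iota Q) (r ^+ p).
    by apply: root_frob; rewrite QE root_prod_XsubC mem_head.
  by rewrite QE root_prod_XsubC inE (negPf rp).
have perm_rs := perm_to_rem rp_rs0; set rs1 := rem _ _ in perm_rs.
have [a aE] : exists a, r + r ^+ p = iota a.
  apply: Fp_image; rewrite -(pFrobenius_autE chK) rmorphD /= !pFrobenius_autE r_p2.
  exact: addrC.
pose g0 : {poly F} := 'X^2 - a%:P * 'X + (w ^+ 2)%:P.
have g0E : map_poly iota g0 = ('X - r%:P) * ('X - (r ^+ p)%:P).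
  rewrite rmorphD rmorphB (rmorphM _ a%:P) /= map_polyXn map_polyX !map_polyC /= -aE.
  by rewrite rmorphXn -r_conj polyCM polyCD; ring.
have size_g0 : size g0 = 3.
  by rewrite -(size_map_poly iota) g0E size_monicM ?monicXsubC ?polyXsubC_eq0 // !size_XsubC.
have g0_irr : irreducible_quadratic g0.
  split=> //; apply: cubic_irreducible; first by rewrite size_g0.
  move=> x; apply/negP; rewrite -(mapf_root iota) g0E rootM !root_XsubC => /orP[] /eqP xE.
    by move: rp; rewrite -xE -rmorphXn Fp_frob eqxx.
  by move: rp; rewrite -[in X in _ != X]r_p2 -xE -rmorphXn Fp_frob eqxx.
have QE1 : map_poly iota Q = map_poly iota g0 * \prod_(z <- rs1) ('X - z%:P).
  by rewrite QE big_cons (perm_big _ perm_rs) big_cons g0E mulrA.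
have /dvdpP[Q' Q'E] : g0 %| Q by rewrite -(dvdp_map iota) QE1 dvdp_mulr.
have g0_neq0 : map_poly iota g0 != 0 by rewrite -size_poly_eq0 size_map_poly size_g0.
have Q'rs : map_poly iota Q' = \prod_(z <- rs1) ('X - z%:P).
  by apply: (mulfI g0_neq0); rewrite -QE1 Q'E rmorphM mulrC.
have size_rs0 : size rs0 = (size rs1).+1 by rewrite (perm_size perm_rs).
have [|z z_rs|s [s_irr s_size Q'fac]] := IHm Q' rs1 _ Q'rs _.
- by move: le_m; rewrite /= size_rs0; apply: ltnW.
- by apply: conj_rs; rewrite inE (perm_mem perm_rs) inE z_rs !orbT.
have neq_w z : z ^+ p != z -> z == - iota w = false.
  by move=> zp; apply: contraNF zp => /eqP->; rewrite -rmorphN -rmorphXn Fp_frob.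
have countE : count_mem (- iota w) (r :: rs0) = count_mem (- iota w) rs1.
  by rewrite /= (permP perm_rs) /= !neq_w // r_p2 eq_sym.
exists (g0 :: s); split.
- by move=> g; rewrite inE => /orP[/eqP-> //|]; apply: s_irr.
- by rewrite countE /= size_rs0 s_size mulnS addnCA -addn2 addnC.
- by rewrite countE Q'E Q'fac big_cons; ring.
Qed.

(* Squarefreeness puts Q below X ^ (p ^ 2) - X, whose roots are the elements of L. *)
Lemma conj_splits (Q : {poly F}) (rs : seq K) :
    map_poly iota Q = \prod_(r <- rs) ('X - r%:P) -> uniq rs ->
    (forall r, r \in rs -> r ^+ p * r = iota w ^+ 2) ->
  forall L : fieldExtType F, \dim {: L} = 2%N ->
    exists ls : seq L, map_poly (in_alg L) Q = \prod_(l <- ls) ('X - l%:P).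
Proof.
move=> QE rs_uniq conj_rs L dimL.
have Q_monic : Q \is monic.
  by rewrite -(map_monic iota) QE monic_prod // => r _; apply: monicXsubC.
have Q_dvd : Q %| 'X^(p ^ 2) - 'X.
  rewrite -(dvdp_map iota) QE rmorphB /= map_polyXn map_polyX.
  apply: uniq_roots_dvdp; last by rewrite uniq_rootsE.
  apply/allP => r r_rs; rewrite /root hornerD hornerN hornerXn hornerX.
  by rewrite (exprM r p p) conj_facts ?subrr // conj_rs.
have prodL : 'X^(p ^ 2) - 'X = \prod_(x : finvect_type L) ('X - (x : L)%:P) :> {poly L}.
  have cardL : #|finvect_type L| = (p ^ 2)%N.
    transitivity #|(fullv : {vspace finvect_type L})|.
      by apply: eq_card => x; rewrite memvf.
    by rewrite card_vspace dimL card_Fp.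
  by have := finField_genPoly (finvect_type L); rewrite cardL.
have : map_poly (in_alg L) Q %| \prod_(x : finvect_type L) ('X - (x : L)%:P).
  by rewrite -prodL; move: Q_dvd; rewrite -(dvdp_map (in_alg L)) rmorphB /= map_polyXn map_polyX.
move=> /dvdp_prod_XsubC[m Em].
exists [seq (x : L) | x <- mask m (index_enum (finvect_type L))].
rewrite big_map; apply/eqP; rewrite -eqp_monic ?map_monic //.
by rewrite monic_prod // => r _; apply: monicXsubC.
Qed.

End Factorization.

Lemma hex_polynomial_mod_p (p : nat) (c : nat -> int) :
    prime p -> (p %% 12 = 5)%N \/ (p %% 12 = 11)%N -> c (nk p.+1).+1 = 0 ->
    fps_O (nk p.+1).+1 (hex_form (nk p.+1) (bk p.+1) c - theta_hex) ->
  let Q := reduce_mod p (\poly_(i < (nk p.+1).+1) c i) in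
  [/\ size Q = (nk p.+1).+1,
      forall L : fieldExtType 'F_p, \dim {: L} = 2%N ->
        exists rs : seq L, map_poly (in_alg L) Q = \prod_(r <- rs) ('X - r%:P),
      ~~ odd (nk p.+1) ->
        exists2 s : seq {poly 'F_p},
          forall g, g \in s -> irreducible_quadratic g & Q = \prod_(g <- s) g
    & odd (nk p.+1) ->
        exists2 s : seq {poly 'F_p},
          forall g, g \in s -> irreducible_quadratic g
          & Q = ('X + 1728%:R%:P) * \prod_(g <- s) g].
Proof.
move=> p_pr p12; have p_gt1 := prime_gt1 p_pr.
(* In both cases 6 divides p + 1, so a_k = 0; and b_k is 1 or 0 according as p is 5 or 11 modulo
   12. *)
have [nE bE pE] : [/\ nk p.+1 = (p.+1 %/ 12)%N, (bk p.+1 <= 1)%N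
    & p.+1 = (12 * nk p.+1 + 6 * bk p.+1)%N].
  case: p12 => p12.
    have [-> _ ->] := @weight_decomp_uniq p.+1 (p.+1 %/ 12)%N 0 1 ltac:(lia) isT isT.
    by split=> //; lia.
  have [-> _ ->] := @weight_decomp_uniq p.+1 (p.+1 %/ 12)%N 0 0 ltac:(lia) isT isT.
  by split=> //; lia.
have p_gt3 : (3 < p)%N by lia.
have p_mod3 : (p %% 3 = 2)%N by lia.
move: (nk p.+1) (bk p.+1) bE pE {nE p12} => n b b_le1 pE c_n1 formO.
pose cp i : 'F_p := (c i)%:~R.
have QE : reduce_mod p (\poly_(i < n.+1) c i) = \poly_(i < n.+1) cp i.
  by apply/polyP => i; rewrite coef_map !coef_poly; case: ifP.
have cp_n : cp n = 1 by rewrite /cp (hex_form_lead formO).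
have cp_rec := hex_form_recurrence p_pr p_gt3 b_le1 pE c_n1 formO.
have size_Q : size (\poly_(i < n.+1) cp i) = n.+1.
  by rewrite size_poly_eq // cp_n oner_eq0.
rewrite /= QE; set Q := \poly_(i < _) _ in size_Q *.
have Q_monic : Q \is monic by rewrite monicE lead_coefE size_Q /= coef_poly ltnSn cp_n.
have [K [iota _]] := countable_algebraic_closure 'F_p.
have [rs] := closed_field_poly_normal (map_poly iota Q).
have -> : lead_coef (map_poly iota Q) = 1 by apply/eqP; rewrite -monicE map_monic.
rewrite scale1r => rsE.
have rs_uniq := hex_roots_uniq p_pr p_gt3 p_mod3 b_le1 pE cp_n cp_rec rsE.
have rs_neq := hex_root_neq p_pr p_gt3 p_mod3 b_le1 pE cp_n cp_rec rsE.
have rs_conj := hex_root_conj p_pr p_gt3 p_mod3 b_le1 pE cp_n cp_rec rsE.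
have w_neq0 : 1728%:R != 0 :> 'F_p := Fp_smooth_neq0 p_pr p_gt3 6 3.
have iota_w : iota 1728%:R = 1728%:R := rmorph_nat iota 1728.
have {}rs_conj r : r \in rs -> r ^+ p * r = iota 1728%:R ^+ 2.
  by move=> /rs_conj->; rewrite iota_w.
have [|s [s_irr size_rs Qfac]] := conj_factorization p_pr w_neq0 rsE.
  by move=> r r_rs; split; [exact: rs_conj | rewrite iota_w; exact: rs_neq].
have size_rsE : size rs = n.
  by move/(congr1 (fun q : {poly K} => size q)): rsE; rewrite size_prod_XsubC size_map_poly size_Q => -[].
(* As the roots are simple, - 1728 occurs at most once; since its multiplicity has the parity of n,
   it is 1 exactly for odd n. *)
have count_le1 : (count_mem (- iota 1728%:R) rs <= 1)%N.
  by rewrite count_uniq_mem // leq_b1.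
have count_odd : count_mem (- iota 1728%:R) rs = odd n :> nat.
  move: size_rs count_le1; rewrite size_rsE => ->.
  by rewrite oddD oddM /= addbF; case: (count_mem _ rs) => [|[|m]].
split=> //.
- by have := conj_splits p_pr w_neq0 rsE rs_uniq rs_conj.
- by move=> n_even; exists s => //; rewrite Qfac count_odd (negPf n_even) expr0 mul1r.
- by move=> n_odd; exists s => //; rewrite Qfac count_odd n_odd expr1.
Qed.

(** * Asymptotic expansions at 0+ *)

Section Asymptotic.
Local Open Scope classical_set_scope.
Variable R : realType.
Implicit Types (phi psi : R -> R) (a b : fps R) (pol : {poly R}).

(* phi(q) = sum_(i < N) a_i q ^ i + O(q ^ N) as q -> 0+ *)
Definition asym (N : nat) phi a := exists2 pol : {poly R},
  forall i, (i < N)%N -> pol`_i = a i &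
  exists C : R, \forall q \near 0^'+, `|phi q - pol.[q]| <= C * q ^+ N.

Lemma poly_bounded01 pol : exists2 B : R, 0 <= B & forall q, 0 < q < 1 -> `|pol.[q]| <= B.
Proof.
exists (\sum_(i < size pol) `|pol`_i|); first exact: sumr_ge0.
move=> q /andP[q0 q1]; rewrite horner_coef; apply: le_trans (ler_norm_sum _ _ _) _.
apply: ler_sum => i _; rewrite normrM normrX (ger0_norm (ltW q0)) ler_piMr //.
by rewrite exprn_ile1 // ltW.
Qed.

Lemma near0_01 : \forall q \near (0 : R)^'+, 0 < q < 1.
Proof.
by near=> q; apply/andP; split; near: q; [exact: nbhs_right_gt | exact: nbhs_right_lt].
Unshelve. all: by end_near. Qed.

Lemma asym_const N (x : R) : asym N (fun=> x) (fpsC x).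
Proof.
exists x%:P => [i _|]; first by rewrite coefC /fpsC; case: i.
by exists 0; near=> q; rewrite hornerC subrr normr0 mul0r.
Unshelve. all: by end_near. Qed.

Lemma asym_near N phi psi a :
  (\forall q \near 0^'+, phi q = psi q) -> asym N phi a -> asym N psi a.
Proof.
move=> E [pol pola [C HC]]; exists pol => //; exists C.
by apply: filterS2 E HC => q <-.
Qed.

Lemma asym_eq N phi a b : (forall i, (i < N)%N -> a i = b i) -> asym N phi a -> asym N phi b.
Proof. by move=> ab [pol pola HC]; exists pol => // i ltiN; rewrite pola ?ab. Qed.

Lemma asymD N phi psi a b : asym N phi a -> asym N psi b ->
  asym N (fun q => phi q + psi q) (a + b).
Proof.
move=> [p1 p1a [C1 H1]] [p2 p2b [C2 H2]]; exists (p1 + p2).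
  by move=> i ltiN; rewrite coefD p1a ?p2b.
exists (C1 + C2); apply: filterS2 H1 H2 => q H1 H2.
by rewrite hornerD opprD addrACA mulrDl; apply: le_trans (ler_normD _ _) (lerD H1 H2).
Qed.

Lemma asymM N phi psi a b : asym N phi a -> asym N psi b ->
  asym N (fun q => phi q * psi q) (a * b).
Proof.
move=> [p1 p1a [C1 H1]] [p2 p2b [C2 H2]]; exists (p1 * p2).
  move=> i ltiN; rewrite coefM fps_coefM; apply: eq_bigr => j _.
  by rewrite p1a ?p2b //; have := ltn_ord j; lia.
have [B1 B1_ge0 HB1] := poly_bounded01 p1; have [B2 B2_ge0 HB2] := poly_bounded01 p2.
exists (`|C1| * (B2 + `|C2|) + B1 * `|C2|).
apply: filterS3 near0_01 H1 H2 => q q01 H1 H2; rewrite hornerM.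
have /andP[q0 q1] := q01; have qN0 : 0 <= q ^+ N by rewrite exprn_ge0 // ltW.
have qN1 : q ^+ N <= 1 by rewrite exprn_ile1 // ltW.
have {}H1 : `|phi q - p1.[q]| <= `|C1| * q ^+ N.
  by apply: le_trans H1 _; rewrite ler_wpM2r // ler_norm.
have {}H2 : `|psi q - p2.[q]| <= `|C2| * q ^+ N.
  by apply: le_trans H2 _; rewrite ler_wpM2r // ler_norm.
have psiB : `|psi q| <= B2 + `|C2|.
  rewrite -[psi q](subrK p2.[q]) addrC; apply: le_trans (ler_normD _ _) _.
  by rewrite lerD ?HB2 //; apply: le_trans H2 _; rewrite ler_piMr.
have -> : phi q * psi q - p1.[q] * p2.[q] = (phi q - p1.[q]) * psi q + p1.[q] * (psi q - p2.[q]).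
  by ring.
apply: le_trans (ler_normD _ _) _; rewrite !normrM mulrDl; apply: lerD.
  by rewrite mulrAC ler_pM.
by rewrite -mulrA ler_pM ?HB1.
Qed.

Lemma asymX N phi a m : asym N phi a -> asym N (fun q => phi q ^+ m) (a ^+ m).
Proof.
move=> H; elim: m => [|m IHm]; last first.
  by rewrite exprS; apply: asym_near (asymM H IHm); near=> q; rewrite exprS.
apply: asym_eq (asym_const N 1) => i _; by rewrite expr0 fps_coef1 /fpsC.
Unshelve. all: by end_near. Qed.

Lemma asym_sum N m (phi : nat -> R -> R) (a : nat -> fps R) :
  (forall i, asym N (phi i) (a i)) ->
  asym N (fun q => \sum_(i < m) phi i q) (\sum_(i < m) a i).
Proof.
move=> H; elim: m => [|m IHm]; last first.
  by rewrite big_ord_recr; apply: asym_near (asymD IHm (H m)); near=> q; rewrite big_ord_recr.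
rewrite big_ord0; apply: asym_near (asym_eq _ (asym_const N 0)).
  by near=> q; rewrite big_ord0.
by move=> i _; rewrite /fpsC mul0rn.
Unshelve. all: by end_near. Qed.

(** After division by q^m the nonzero constant term dominates every multiple of q near 0. Such a
    polynomial is thus not O(q^(m+1)), which yields the uniqueness of expansions. *)
Lemma poly_lower_bound pol m (C : R) : (forall i, (i < m)%N -> pol`_i = 0) -> pol`_m != 0 ->
  \forall q \near 0^'+, C * q ^+ m.+1 < `|pol.[q]|.
Proof.
move=> pol0 polm; pose s := drop_poly m pol; pose r := drop_poly 1 s.
have polE : pol = s * 'X^m.
  rewrite -[LHS](poly_take_drop m) [X in X + _](_ : _ = 0) ?add0r //.
  by apply/polyP => j; rewrite coef_take_poly coef0; case: ifP => // ji; rewrite pol0.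
have s0 : s`_0 = pol`_m by rewrite coef_drop_poly add0n.
have sE : s = r * 'X + (s`_0)%:P.
  rewrite -[LHS](poly_take_drop 1) addrC expr1; congr (_ + _).
  by apply/polyP => j; rewrite coef_take_poly coefC; case: j.
have [B B0 HB] := poly_bounded01 r.
(* For q < e one has (|C| + B + 1) q < |s(0)|, which leaves room for both the error B q and the
   bound C q. *)
pose e := `|s`_0| / (`|C| + B + 1).
have CB0 : 0 < `|C| + B + 1 by rewrite ltr_wpDl ?addr_ge0.
have e0 : 0 < e by rewrite divr_gt0 // normr_gt0 s0.
apply: filterS2 near0_01 (nbhs_right_lt e0) => q q01 qe; have /andP[q0 q1] := q01.
have qm0 : 0 < q ^+ m by rewrite exprn_gt0.
rewrite {1}polE hornerM hornerXn normrM (gtr0_norm qm0) exprS mulrA ltr_pM2r //.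
have rq : `|r.[q] * q| <= B * q by rewrite normrM (gtr0_norm q0) ler_wpM2r ?HB // ltW.
have : `|s`_0| <= `|s.[q]| + B * q.
  have -> : s`_0 = s.[q] - r.[q] * q.
    by rewrite {2}sE hornerD hornerM hornerX hornerC addrC addKr.
  by apply: le_trans (ler_normB _ _) _; rewrite lerD2l.
move: qe; rewrite ltr_pdivlMr // => qe le_s.
have : C * q <= `|C| * q by rewrite ler_wpM2r ?ler_norm // ltW.
by move: (`|C|) (`|s`_0|) (`|s.[q]|) qe le_s => c x y; lra.
Qed.

Lemma asym_uniq N phi a b : asym N phi a -> asym N phi b -> forall i, (i < N)%N -> a i = b i.
Proof.
move=> [p1 p1a [C1 H1]] [p2 p2b [C2 H2]] i ltiN; rewrite -p1a // -p2b //.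
apply/eqP; rewrite -subr_eq0 -coefB; set pol := p1 - p2; apply/eqP.
pose C := `|C1| + `|C2|; have C0 : 0 <= C by rewrite addr_ge0.
have H : \forall q \near 0^'+, `|pol.[q]| <= C * q ^+ N.
  apply: filterS3 near0_01 H1 H2 => q /andP[q0 _] H1 H2.
  have qN0 : 0 <= q ^+ N by rewrite exprn_ge0 // ltW.
  have -> : pol.[q] = (phi q - p2.[q]) - (phi q - p1.[q]) by rewrite /pol hornerD hornerN; ring.
  rewrite /C mulrDl [leRHS]addrC; apply: le_trans (ler_normB _ _) _; apply: lerD.
    by apply: le_trans H2 _; rewrite ler_wpM2r // ler_norm.
  by apply: le_trans H1 _; rewrite ler_wpM2r // ler_norm.
elim/ltn_ind: i ltiN => i IHi ltiN; apply: contrapT => /eqP x_neq0.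
have pol0 j : (j < i)%N -> pol`_j = 0 by move=> ltji; rewrite IHi // (ltn_trans ltji).
have /filter_ex[q [[q01 Hq] qC]] : \forall q \near 0^'+,
    ((0 < q < 1) /\ `|pol.[q]| <= C * q ^+ N) /\ C * q ^+ i.+1 < `|pol.[q]|.
  by apply: filterI (poly_lower_bound C pol0 x_neq0); apply: filterI near0_01 H.
have /andP[q0 q1] := q01.
have := lt_le_trans qC Hq; apply/negP; rewrite -leNgt; apply: ler_wpM2l => //.
by rewrite ler_wiXn2l // ltW.
Qed.

Lemma asym_neq0 m phi a : asym m.+1 phi a -> fps_O m a -> a m != 0 ->
  \forall q \near 0^'+, phi q != 0.
Proof.
move=> [pol pola [C H]] aO am; have lower : \forall q \near 0^'+, C * q ^+ m.+1 < `|pol.[q]|.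
  apply: poly_lower_bound => [i ltim|]; last by rewrite pola.
  by rewrite pola ?aO // (ltn_trans ltim).
apply: filterS2 H lower => q le_q lt_q; apply: contraTneq (le_lt_trans le_q lt_q) => ->.
by rewrite sub0r normrN ltxx.
Qed.

End Asymptotic.

(** * Convergent power series and their values on the imaginary axis *)

Section PowerSeries.
Variable R : realType.
Local Open Scope classical_set_scope.

Lemma geometric_tail (t : R) N k : 0 <= t <= 2^-1 ->
  \sum_(N <= i < N + k) t ^+ i <= 2%:R * t ^+ N.
Proof.
move=> /andP[t0 t1]; suff : \sum_(N <= i < N + k) t ^+ i + 2%:R * t ^+ (N + k) <= 2%:R * t ^+ N.
  by apply: le_trans; rewrite lerDl mulr_ge0 // exprn_ge0.
elim: k => [|k IHk]; first by rewrite addn0 big_geq // add0r.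
rewrite addnS big_nat_recr /= ?leq_addr //; apply: le_trans IHk.
rewrite -addrA lerD2l exprSr; have := exprn_ge0 (N + k) t0.
by move: (t ^+ _) => x x0; nra.
Qed.

(** Convergence at q = r bounds |a_n| r^n. For q < r / 2 the terms from N on are then dominated by a
    geometric series of ratio at most 1/2, so the partial sums, and with them the limit, differ from
    the truncation by O(q^N). *)
Lemma asym_pseries (a : nat -> R) (phi : R -> R) (r : R) N : 0 < r ->
    (forall q, 0 < q <= r -> series (fun n => a n * q ^+ n) @ \oo --> phi q) ->
  asym N phi a.
Proof.
move=> r0 cvg_phi; exists (\poly_(i < N) a i).
  by move=> i ltiN; rewrite coef_poly ltiN.
have rr : 0 < r <= r by rewrite r0 lexx.
have /cvg_series_cvg_0 u0 : cvgn (series (fun n => a n * r ^+ n)).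
  by apply/cvg_ex; exists (phi r); apply: cvg_phi.
have [M [_ HM]] := cvg_seq_bounded (cvgP _ u0).
pose B := `|M| + 1.
have {}HM n : `|a n| * r ^+ n <= B.
  have := HM B; rewrite ltr_pwDr ?ler_norm // => /(_ isT n I) /=.
  by rewrite normrM normrX (gtr0_norm r0).
exists (2%:R * B / r ^+ N); have r20 : 0 < r / 2%:R by rewrite divr_gt0.
near=> q; have q0 : 0 < q by near: q; exact: nbhs_right_gt.
have qr : q < r / 2%:R by near: q; exact: nbhs_right_lt.
have qr' : q <= r by apply: ltW; apply: lt_trans qr _; lra.
have t01 : 0 <= q / r <= 2^-1.
  apply/andP; split; first exact: divr_ge0 (ltW q0) (ltW r0).
  by rewrite ler_pdivrMr // mulrC; exact: ltW.
have tail n : (N <= n)%N ->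
    `|series (fun n => a n * q ^+ n) n - (\poly_(i < N) a i).[q]| <= 2%:R * B / r ^+ N * q ^+ N.
  move=> leNn; rewrite horner_poly /series /=.
  rewrite -(subnKC leNn) -[\sum_(i < N) _](big_mkord xpredT (fun i => a i * q ^+ i)).
  rewrite (big_cat_nat (n := N)) ?leq_addr //= addrC addrK.
  apply: le_trans (ler_norm_sum _ _ _) _.
  apply: (@le_trans _ _ (\sum_(N <= i < N + (n - N)) B * (q / r) ^+ i)).
    apply: ler_sum => i _; rewrite normrM normrX (gtr0_norm q0) expr_div_n.
    rewrite mulrA ler_pdivlMr ?exprn_gt0 // mulrAC.
    by apply: ler_wpM2r (HM i); apply: exprn_ge0 (ltW q0).
  rewrite -mulr_sumr; apply: le_trans (ler_wpM2l _ (geometric_tail N (n - N) t01)) _.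
    by rewrite addr_ge0.
  by rewrite expr_div_n mulrCA mulrA -!mulrA [_ * q ^+ N]mulrC.
have /cvgrPdist_lt cvg_q : series (fun n => a n * q ^+ n) @ \oo --> phi q.
  by apply: cvg_phi; rewrite q0.
apply/ler_addgt0Pr => e e0.
have [n0 _ Hn0] := cvg_q e e0.
have lt_e := Hn0 (maxn n0 N) (leq_maxl _ _).
have le_t := tail (maxn n0 N) (leq_maxr _ _).
rewrite -(subrK (series (fun n => a n * q ^+ n) (maxn n0 N)) (phi q)) -addrA addrC.
by apply: le_trans (ler_normD _ _) _; apply: lerD le_t _; apply: ltW.
Unshelve. all: by end_near. Qed.

Lemma cvg_pseries (a : nat -> R) (M s q : R) :
    (forall n, `|a n| <= M * s ^+ n) -> 0 <= q -> 0 <= s -> s * q <= 2^-1 ->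
  cvgn (series (fun n => a n * q ^+ n)).
Proof.
move=> aM q0 s0 sq; apply: normed_cvg.
apply: (@series_le_cvg _ _ (geometric M (2^-1))) => //.
- by move=> n; apply: normr_ge0.
- move=> n; rewrite /geometric /= mulr_ge0 // ?exprn_ge0 //.
  by have := aM 0%N; rewrite expr0 mulr1; apply: le_trans.
- move=> n; rewrite /geometric /= normrM normrX (ger0_norm q0).
  apply: le_trans (ler_wpM2r _ (aM n)) _; first exact: exprn_ge0.
  rewrite -mulrA -exprMn ler_wpM2l //.
    by have := aM 0%N; rewrite expr0 mulr1; apply: le_trans.
  by rewrite lerXn2r // nnegrE ?mulr_ge0 // invr_ge0.
apply: is_cvg_geometric_series; rewrite ger0_norm ?invr_ge0 //.
by rewrite invf_lt1 // ltr1n.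
Qed.

Lemma cvg_Re (u : nat -> CC R) (l : CC R) : u @ \oo --> l ->
  (fun n => complex.Re (u n)) @ \oo --> complex.Re l.
Proof.
move=> /cvgrPdist_lt ul; apply/cvgrPdist_lt => e e0.
have e0C : 0 < e%:C%C :> CC R by rewrite ltcR.
near=> n; rewrite -ltcR.
have : `|l - u n| < e%:C%C by near: n; exact: ul.
apply: le_lt_trans; apply: le_trans (normc_ge_Re _).
by rewrite raddfB.
Unshelve. all: by end_near. Qed.

Lemma cvg_realC (u : nat -> R) (l : R) : u @ \oo --> l ->
  (fun n => (u n)%:C%C : CC R) @ \oo --> (l%:C%C : CC R).
Proof.
move=> /cvgrPdist_lt ul; apply/cvgrPdist_lt => -[e e'].
rewrite ltcE /= => /andP[/eqP -> e0].
near=> n; rewrite -rmorphB /= normc_def /= expr0n /= addr0 sqrtr_sqr ltcR.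
by near: n; exact: ul.
Unshelve. all: by end_near. Qed.

Definition qtau (q : R) : CC R := (0 +i* (- (ln q / (2%:R * pi))))%C.

Lemma qtau_uhp q : 0 < q < 1 -> upper_half_plane (qtau q).
Proof.
move=> /andP[q0 q1]; rewrite /upper_half_plane /= oppr_gt0.
by rewrite pmulr_llt0 ?ln_lt0 ?q0 // invr_gt0 mulr_gt0 // pi_gt0.
Qed.

Lemma qpar_qtau q : 0 < q -> qpar (qtau q) = q%:C%C.
Proof.
move=> q0; rewrite /qpar /= mulr0 cos0 sin0 mulr1 mulrN opprK.
rewrite mulrCA mulfV ?mulr1 ?lnK //.
by rewrite mulf_neq0 // gt_eqF // pi_gt0.
Qed.

(** The coefficients of a q-expansion are a priori complex; at real q one may pass to real parts,
    which loses nothing in the comparison with the real coefficients of the theta series. *)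
Lemma has_qexpansion_real (f : CC R -> CC R) c q : has_qexpansion f c -> 0 < q < 1 ->
  series (fun n => complex.Re (c n) * q ^+ n) @ \oo --> complex.Re (f (qtau q)).
Proof.
move=> fc q01; have := cvg_Re (fc _ (qtau_uhp q01)).
suff -> : (fun n => complex.Re (series (fun n => c n * qpar (qtau q) ^+ n) n)) =
    series (fun n => complex.Re (c n) * q ^+ n) by [].
apply/funext => n; rewrite /series /= raddf_sum /=.
apply: eq_bigr => i _; rewrite qpar_qtau; last by case/andP: q01.
by rewrite -rmorphXn /=; case: (c i) => x y /=; rewrite mulr0 subr0.
Qed.

(** [Eis] is a value of [limn], which is informative only once convergence is known; the exponential
    bound on the coefficients provides it for small q. *)
Lemma Eis_real k (a : nat -> R) (M s q : R) :
    (forall n, ratr (eisenstein_coef k n) = a n) ->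
    (forall n, `|a n| <= M * s ^+ n) -> 0 < q -> 0 <= s -> s * q <= 2^-1 ->
  Eis k (qtau q) = (limn (series (fun n => a n * q ^+ n)))%:C%C.
Proof.
move=> aE aM q0 s0 sq; rewrite /Eis; apply: cvg_lim; first exact: norm_hausdorff.
have := cvg_realC (cvg_pseries aM (ltW q0) s0 sq).
suff -> : (fun n => (series (fun n => a n * q ^+ n) n)%:C%C : CC R) =
    series (fun n => ratr (eisenstein_coef k n) * qpar (qtau q) ^+ n) by [].
apply/funext => n; rewrite /series /= rmorph_sum /=.
apply: eq_bigr => i _; rewrite qpar_qtau // rmorphM rmorphXn /= -aE.
by rewrite fmorph_rat.
Qed.

End PowerSeries.

(** * From the modular form to an integral identity of power series *)

Lemma bernoulli_seqS m : let s := bernoulli_seq m in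
  bernoulli_seq m.+1 =
  rcons s (((m == 0)%N%:R - \sum_(i < m) 'C(m.+1, i)%:R * s`_i) / m.+1%:R).
Proof. by []. Qed.

Lemma bernoulli_4_6 : bernoulli 4 = - (1 / 30%:R) /\ bernoulli 6 = 1 / 42%:R.
Proof.
have s1 : bernoulli_seq 1 = [:: 1] by rewrite bernoulli_seqS big_ord0 subr0 divr1.
have s2 : bernoulli_seq 2 = [:: 1; - (1 / 2%:R)].
  rewrite bernoulli_seqS s1 /=; congr [:: _; _].
  rewrite (_ : \sum_(i < _) _ =
    0 + 1%:R * 1);
    last by rewrite !big_ord_recr big_ord0.
  by field.
have s3 : bernoulli_seq 3 = [:: 1; - (1 / 2%:R); 1 / 6%:R].
  rewrite bernoulli_seqS s2 /=; congr [:: _; _; _].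
  rewrite (_ : \sum_(i < _) _ =
    0 + 1%:R * 1 + 3%:R * (- (1 / 2%:R)));
    last by rewrite !big_ord_recr big_ord0.
  by field.
have s4 : bernoulli_seq 4 = [:: 1; - (1 / 2%:R); 1 / 6%:R; 0].
  rewrite bernoulli_seqS s3 /=; congr [:: _; _; _; _].
  rewrite (_ : \sum_(i < _) _ =
    0 + 1%:R * 1 + 4%:R * (- (1 / 2%:R)) + 6%:R * (1 / 6%:R));
    last by rewrite !big_ord_recr big_ord0.
  by field.
have s5 : bernoulli_seq 5 = [:: 1; - (1 / 2%:R); 1 / 6%:R; 0; - (1 / 30%:R)].
  rewrite bernoulli_seqS s4 /=; congr [:: _; _; _; _; _].
  rewrite (_ : \sum_(i < _) _ =
    0 + 1%:R * 1 + 5%:R * (- (1 / 2%:R))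
    + 10%:R * (1 / 6%:R) + 10%:R * 0);
    last by rewrite !big_ord_recr big_ord0.
  by field.
have s6 : bernoulli_seq 6 = [:: 1; - (1 / 2%:R); 1 / 6%:R; 0; - (1 / 30%:R); 0].
  rewrite bernoulli_seqS s5 /=; congr [:: _; _; _; _; _; _].
  rewrite (_ : \sum_(i < _) _ =
    0 + 1%:R * 1 + 6%:R * (- (1 / 2%:R))
    + 15%:R * (1 / 6%:R) + 20%:R * 0 + 15%:R * (- (1 / 30%:R)));
    last by rewrite !big_ord_recr big_ord0.
  by field.
have s7 : bernoulli_seq 7 = [:: 1; - (1 / 2%:R); 1 / 6%:R; 0; - (1 / 30%:R); 0; 1 / 42%:R].
  rewrite bernoulli_seqS s6 /=; congr [:: _; _; _; _; _; _; _].
  rewrite (_ : \sum_(i < _) _ =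
    0 + 1%:R * 1 + 7%:R * (- (1 / 2%:R))
    + 21%:R * (1 / 6%:R) + 35%:R * 0 + 35%:R * (- (1 / 30%:R)) + 21%:R * 0);
    last by rewrite !big_ord_recr big_ord0.
  by field.
by split; rewrite /bernoulli (s5, s7).
Qed.

Lemma eisenstein_coef_sigma k n : (0 < n)%N ->
  eisenstein_coef k n = - ((2 * k)%:R / bernoulli k) * (sigma k.-1 n)%:~R.
Proof.
rewrite /eisenstein_coef /sigma /divs; case: n => // n _ /=; congr (_ * _).
rewrite natr_sum rmorph_sum /=; apply: eq_bigr => d _.
by rewrite natrX rmorphXn.
Qed.

Lemma eisenstein_coef_4 n : eisenstein_coef 4 n = (E4 n)%:~R.
Proof.
case: (posnP n) => [->|n0]; first by rewrite E4_0.
rewrite eisenstein_coef_sigma // /E4 fps_coefD (fps_coef_natM 240) fps_coef1 gtn_eqF // add0r.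
by rewrite (proj1 bernoulli_4_6) rmorphM /=; congr (_ * _); field.
Qed.

Lemma eisenstein_coef_6 n : eisenstein_coef 6 n = (E6 n)%:~R.
Proof.
case: (posnP n) => [->|n0]; first by rewrite E6_0.
rewrite eisenstein_coef_sigma // /E6 fps_coefB (fps_coef_natM 504) fps_coef1 gtn_eqF // sub0r.
by rewrite (proj2 bernoulli_4_6) rmorphN rmorphM /= -mulNr; congr (_ * _).
Qed.

(** There are at most n divisors and each power is at most n^5, so the sum is at most n^6 <=
    (2^n)^6. This crude bound is enough, as only small q matter. *)
Lemma sigma_bound k n : (k <= 5)%N -> 0 <= sigma k n <= 64%:Z ^+ n.
Proof.
move=> k5; apply/andP; split; first by apply: sumr_ge0 => d _; rewrite exprn_ge0.
have size_divs : (size (divs n) <= n)%N.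
  rewrite -[leqRHS](size_iota 1); apply: uniq_leq_size; first exact: divs_uniq.
  by move=> d; rewrite mem_divs mem_iota => /andP[n0 dn]; have := dvdn_leq n0 dn; have := dvdn_gt0 n0 dn; lia.
apply: (@le_trans _ _ (\sum_(d <- divs n) n%:Z ^+ 5)).
  rewrite /sigma big_seq [leRHS]big_seq; apply: ler_sum => d.
  rewrite mem_divs => /andP[n0 dn]; have dn' := dvdn_leq n0 dn.
  apply: (@le_trans _ _ (n%:Z ^+ k)); first by rewrite lerXn2r.
  by rewrite ler_weXn2l.
rewrite sumr_const_seq -mulr_natl natz.
apply: (@le_trans _ _ (n%:Z ^+ 6)); first by rewrite exprS ler_wpM2r ?exprn_ge0.
have -> : 64%:Z ^+ n = (2%:Z ^+ n) ^+ 6 by rewrite -exprM mulnC exprM.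
by rewrite lerXn2r ?nnegrE ?exprn_ge0 // -[2%:Z]natz -natrX natz lez_nat ltnW // ltn_expl.
Qed.

Lemma E4_bound (R : realType) n : `|(E4 n)%:~R : R| <= 504%:R * 64%:R ^+ n.
Proof.
have [|s0 s1] := andP (@sigma_bound 3 n _) => //.
have : `|E4 n| <= 504 * 64%:Z ^+ n.
  rewrite /E4 fps_coefD (fps_coef_natM 240) fps_coef1 /sigma_fps.
  have : 1 <= 64%:Z ^+ n by apply: exprn_ege1.
  by case: (n == 0%N); rewrite ?mulr1n ?mulr0n; lia.
by rewrite -intr_norm -(ler_int R) rmorphM rmorphXn.
Qed.

Lemma E6_bound (R : realType) n : `|(E6 n)%:~R : R| <= 505%:R * 64%:R ^+ n.
Proof.
have [|s0 s1] := andP (@sigma_bound 5 n _) => //.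
have : `|E6 n| <= 505 * 64%:Z ^+ n.
  rewrite /E6 fps_coefB (fps_coef_natM 504) fps_coef1 /sigma_fps.
  have : 1 <= 64%:Z ^+ n by apply: exprn_ege1.
  by case: (n == 0%N); rewrite ?mulr1n ?mulr0n; lia.
by rewrite -intr_norm -(ler_int R) rmorphM rmorphXn.
Qed.

Lemma thetaH_hex n : (thetaH n)%:Z = theta_hex n.
Proof.
rewrite /theta_hex /thetaH; congr Posz.
have -> : fset_set (hexagonal_vectors n) = [fset v in hexvecs n]%fset.
  apply/fsetP => -[x y]; rewrite in_fset_set; last exact: finite_hexagonal_vectors.
  rewrite !inE /= mem_hexvecs; apply/idP/eqP; first by move/set_mem.
  by move=> E; apply/mem_set.
by rewrite card_fseq undup_id ?hexvecs_uniq.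
Qed.

Section RealIdentity.
Variable R : realType.
Local Open Scope classical_set_scope.
Local Notation intrR := (intr : {rmorphism int -> R}).

Definition rE4 (q : R) : R := limn (series (fun n => (E4 n)%:~R * q ^+ n)).
Definition rE6 (q : R) : R := limn (series (fun n => (E6 n)%:~R * q ^+ n)).
Definition rDelta (q : R) : R := (rE4 q ^+ 3 - rE6 q ^+ 2) / 1728%:R.

(** With coefficients bounded by a multiple of 64^n, the range q <= 1/128 gives the ratio 64 q <=
    1/2 that [cvg_pseries] asks for. *)
Let r128 : R := 128%:R^-1.
Let r128_gt0 : 0 < r128. Proof. by rewrite invr_gt0. Qed.

Let small (q : R) : q <= r128 -> 64%:R * q <= 2^-1.
Proof. by rewrite /r128 => qr; lra. Qed.

Let cvgE4 (q : R) : 0 <= q <= r128 -> series (fun n => (E4 n)%:~R * q ^+ n) @ \oo --> rE4 q.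
Proof. by move=> /andP[q0 /small q1]; apply: (cvg_pseries (E4_bound R) q0). Qed.

Let cvgE6 (q : R) : 0 <= q <= r128 -> series (fun n => (E6 n)%:~R * q ^+ n) @ \oo --> rE6 q.
Proof. by move=> /andP[q0 /small q1]; apply: (cvg_pseries (E6_bound R) q0). Qed.

Lemma asym_rE4 N : asym N rE4 (fps_map intrR E4).
Proof.
by apply: (asym_pseries N r128_gt0) => q /andP[q0 q1]; apply: cvgE4; rewrite ltW.
Qed.

Lemma asym_rE6 N : asym N rE6 (fps_map intrR E6).
Proof.
by apply: (asym_pseries N r128_gt0) => q /andP[q0 q1]; apply: cvgE6; rewrite ltW.
Qed.

Lemma asym_rDelta N : asym N rDelta (fps_map intrR DeltaZ).
Proof.
have divide m : m.+1%:R != 0 :> R ->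
    fps_map intrR (m.+1%:R * DeltaZ) * fpsC (m.+1%:R^-1) = fps_map intrR DeltaZ.
  move=> m0; apply/funext => n; rewrite mulrC fps_coef_CM /fps_map fps_coef_natM rmorphM.
  by rewrite rmorph_nat mulKf.
have E : fps_map intrR DeltaZ = (fps_map intrR E4 ^+ 3 + fpsC (-1) * fps_map intrR E6 ^+ 2) * fpsC (1728%:R^-1).
  have <- : fps_map intrR (1728%:R * DeltaZ) = fps_map intrR E4 ^+ 3 + fpsC (-1) * fps_map intrR E6 ^+ 2.
    rewrite DeltaZE rmorphB !rmorphXn /=; congr (_ + _).
    by apply/funext => n; rewrite fps_coef_CM mulN1r.
  have w0 : 1728%:R != 0 :> R by rewrite pnatr_eq0.
  exact/esym/(divide 1727%N w0).
rewrite E; apply: asym_near (asymM (asymD (asymX 3 (asym_rE4 N))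
  (asymM (asym_const N (-1)) (asymX 2 (asym_rE6 N)))) (asym_const N _)).
by near=> q; rewrite /rDelta mulN1r.
Unshelve. all: by end_near. Qed.

Let Eis4 (q : R) : 0 < q <= r128 -> Eis 4 (qtau q) = (rE4 q)%:C%C.
Proof.
move=> /andP[q0 /small q1]; apply: (Eis_real _ (E4_bound R)) => // n.
by rewrite eisenstein_coef_4 ratr_int.
Qed.

Let Eis6 (q : R) : 0 < q <= r128 -> Eis 6 (qtau q) = (rE6 q)%:C%C.
Proof.
move=> /andP[q0 /small q1]; apply: (Eis_real _ (E6_bound R)) => // n.
by rewrite eisenstein_coef_6 ratr_int.
Qed.

Let Delta_real (q : R) : 0 < q <= r128 -> Delta (qtau q) = (rDelta q)%:C%C.
Proof.
move=> q01; rewrite /Delta Eis4 // Eis6 // /rDelta.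
by rewrite rmorphM rmorphB !rmorphXn fmorphV rmorph_nat.
Qed.

(** The letters [x], [d], [y] stand for the real values of E4, Delta, E6, and the exponent 0 is a_k.
    Multiplying the defining identity of P by its denominator turns (x^3 / d)^i into x^(3i) d^(n-i)
    y^b. *)
Lemma jpoly_real_alg (x y d : R) (v : CC R) n b (P : {poly rat}) :
    d != 0 -> y != 0 -> (size P <= n.+1)%N ->
    ((d%:C%C : CC R) ^+ n * (x%:C%C : CC R) ^+ 0 * (y%:C%C : CC R) ^+ b != 0 ->
     v / ((d%:C%C : CC R) ^+ n * (x%:C%C : CC R) ^+ 0 * (y%:C%C : CC R) ^+ b) =
     (map_poly ratr P).[(x%:C%C : CC R) ^+ 3 / d%:C%C]) ->
  complex.Re v = \sum_(i < n.+1) ratr P`_i * (x ^+ (3 * i) * d ^+ (n - i) * y ^+ b).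
Proof.
move=> d0 y0 size_P; pose D := d ^+ n * y ^+ b.
have D0 : D != 0 by rewrite mulf_neq0 ?expf_neq0.
have -> : (d%:C%C : CC R) ^+ n * (x%:C%C : CC R) ^+ 0 * (y%:C%C : CC R) ^+ b = (D%:C%C : CC R).
  by rewrite expr0 mulr1 -!rmorphXn -rmorphM.
have -> : (x%:C%C : CC R) ^+ 3 / d%:C%C = ((x ^+ 3 / d)%:C%C : CC R).
  by rewrite -rmorphXn -fmorphV -rmorphM.
rewrite fmorph_eq0 => /(_ D0) /(canRL (mulfVK _)) ->; last by rewrite fmorph_eq0.
have -> : (map_poly ratr P).[((x ^+ 3 / d)%:C%C : CC R)] =
    ((\sum_(i < n.+1) ratr P`_i * (x ^+ 3 / d) ^+ i)%:C%C : CC R).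
  rewrite (horner_coef_wide _ (n := n.+1)) ?size_map_poly // rmorph_sum /=.
  by apply: eq_bigr => i _; rewrite coef_map /= [RHS]rmorphM [in RHS]rmorphXn /= fmorph_rat.
rewrite -rmorphM /= mulr_suml; apply: eq_bigr => i _.
have lei : (i <= n)%N by rewrite -ltnS.
have dn : d ^+ n = d ^+ (n - i) * d ^+ i by rewrite -exprD subnK.
rewrite /D dn expr_div_n -exprM.
have di : d ^+ i != 0 by rewrite expf_neq0.
by field.
Qed.

Lemma jpoly_real k f P : ak k = 0%N -> is_jpoly k f P ->
  \forall q \near 0^'+, complex.Re (f (qtau q)) =
    \sum_(i < (nk k).+1) ratr P`_i * (rE4 q ^+ (3 * i) * rDelta q ^+ (nk k - i) * rE6 q ^+ bk k).
Proof.
move=> a0 [_ size_P jP].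
(* The identity that defines P is available only where its denominator does not vanish; near q = 0
   this follows from the leading coefficients 1 of E6 and Delta. *)
have E6_neq0 : \forall q \near 0^'+, rE6 q != 0.
  by apply: (asym_neq0 (asym_rE6 1)) => //; rewrite /fps_map E6_0 oner_eq0.
have D_neq0 : \forall q \near 0^'+, rDelta q != 0.
  apply: (asym_neq0 (asym_rDelta 2)); first exact/fps_map_O/DeltaZ_O.
  by rewrite /fps_map DeltaZ_1 oner_eq0.
near=> q; have q01 : 0 < q < 1 by near: q; apply: near0_01.
have q0 : 0 < q by case/andP: q01.
have q128 : 0 < q <= r128 by rewrite q0 /=; near: q; apply: nbhs_right_le.
have e6 : rE6 q != 0 by near: q.
have d0 : rDelta q != 0 by near: q.
have H := jP _ (qtau_uhp q01); cbv zeta in H; rewrite a0 /jinv (Delta_real q128) (Eis4 q128) (Eis6 q128) in H.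
exact: jpoly_real_alg d0 e6 size_P H.
Unshelve. all: by end_near. Qed.

Definition mono_form n b i : fps int := E4 ^+ (3 * i) * DeltaZ ^+ (n - i) * E6 ^+ b.

(** The real part of f on the imaginary axis has two expansions up to q^n, the theta series by
    definition of C_k and the combination of E4, Delta, E6 with the coefficients of P; expansions at
    0+ being unique, they agree. *)
Lemma jpoly_identity k (f : CC R -> CC R) P : ak k = 0%N ->
    is_Ck k (fun n => (thetaH n)%:R) f -> is_jpoly k f P ->
  fps_O (nk k).+1 (\sum_(i < (nk k).+1) fpsC (ratr P`_i) * fps_map intrR (mono_form (nk k) (bk k) i)
    - fps_map intrR theta_hex).
Proof.
move=> a0 [_ [c fc c_theta]] jP n ltn; rewrite fps_coefB; apply/eqP; rewrite subr_eq0; apply/eqP.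
set N := (nk k).+1 in ltn *.
have A1 : asym N (fun q => complex.Re (f (qtau q))) (fps_map intrR theta_hex).
  apply: (@asym_eq _ _ _ (fun i => complex.Re (c i))) => [i lti|].
    by rewrite c_theta // /fps_map -thetaH_hex -(rmorph_nat (real_complex R)).
  apply: (asym_pseries N (r := 2^-1)); first by rewrite invr_gt0.
  move=> q /andP[q0 q1]; apply: has_qexpansion_real => //.
  by rewrite q0 (le_lt_trans q1) // invf_lt1 // ltr1n.
apply: (asym_uniq _ A1 ltn).
apply: (@asym_near _ _ (fun q =>
  \sum_(i < N) ratr P`_i * (rE4 q ^+ (3 * i) * rDelta q ^+ (nk k - i) * rE6 q ^+ bk k))).
  by apply: filterS (jpoly_real a0 jP) => q ->.
apply: (@asym_sum _ N N (fun i q => ratr P`_i * (rE4 q ^+ (3 * i) * rDelta q ^+ (nk k - i) * rE6 q ^+ bk k))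
  (fun i => fpsC (ratr P`_i) * fps_map intrR (mono_form (nk k) (bk k) i))) => i.
apply: asymM; first exact: asym_const.
rewrite /mono_form !rmorphM !rmorphXn /=.
by apply: asymM; [apply: asymM; apply: asymX; [exact: asym_rE4 | exact: asym_rDelta] | apply/asymX/asym_rE6].
Qed.

End RealIdentity.

(** * Integrality of the coefficients of the polynomial *)

Lemma mono_form_O n b i : fps_O (n - i) (mono_form n b i).
Proof.
rewrite /mono_form mulrC; apply/fps_OMl; apply: fps_OMl.
exact/fps_OX/DeltaZ_O.
Qed.

Lemma mono_form_lead n b i : mono_form n b i (n - i)%N = 1.
Proof.
rewrite /mono_form mulrC mulrA [E6 ^+ b * _]mulrC.
rewrite (@fps_coefM_lead _ 0 (n - i)) //; last exact/fps_OX/DeltaZ_O.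
rewrite fps_coef0M !fps_coef0X E4_0 E6_0 fps_coefX_lead ?DeltaZ_1 ?expr1n ?mulr1 //.
exact: DeltaZ_O.
Qed.

(** The monomials have integer coefficients and leading coefficient 1 at q^(n-i). The triangular
    system for the [d i] is therefore solved from i = n downwards without any division. *)
Lemma form_integral (R : realType) n b (d : nat -> R) (g : fps int) :
    fps_O n.+1 (\sum_(i < n.+1) fpsC (d i) * fps_map (intr : {rmorphism int -> R}) (mono_form n b i)
      - fps_map (intr : {rmorphism int -> R}) g) ->
  forall i, (i <= n)%N -> d i \is a Num.int.
Proof.
move=> O i lein; have [j lejn ->] : exists2 j, (j <= n)%N & i = (n - j)%N.
  by exists (n - i)%N; lia.
elim/ltn_ind: j lejn {i lein} => j IHj lejn.
have := O j; rewrite ltnS => /(_ lejn); rewrite fps_coefB fps_coef_sum => /eqP.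
have ltnj : (n - j < n.+1)%N by lia.
have lead : mono_form n b (n - j) j = 1.
  by have := mono_form_lead n b (n - j); rewrite subKn.
rewrite (bigD1 (Ordinal ltnj)) //= fps_coef_CM /fps_map lead mulr1.
rewrite -addrA addr_eq0 => /eqP ->; rewrite rpredN rpredB ?intr_int // rpred_sum // => k neq.
rewrite fps_coef_CM; have {}neq : k != (n - j)%N :> nat by apply: contraNneq neq => kE; apply/eqP/val_inj.
have lekn : (k <= n)%N by rewrite -ltnS.
case: (ltnP (n - k) j) => [lt|le].
  by rewrite rpredM ?intr_int // -(subKn lekn) IHj // leq_subr.
have ltj : (j < n - k)%N by lia.
by rewrite mono_form_O ?mulr0 ?rpred0.
Qed.

Theorem theorem1p11 (R : realType) (p : nat) (f : CC R -> CC R) (P : {poly rat}) :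
  prime p ->
  (p %% 12 = 5)%N \/ (p %% 12 = 11)%N ->
  is_Ck p.+1 (fun n => (thetaH n)%:R) f ->
  is_jpoly p.+1 f P ->
  exists Q : {poly int},
    [/\ P = map_poly intr Q,
        size (reduce_mod p Q) = (nk p.+1).+1,
        forall L : fieldExtType 'F_p, \dim {: L} = 2%N ->
          exists rs : seq L,
            map_poly (in_alg L) (reduce_mod p Q)
              = \prod_(r <- rs) ('X - r%:P),
        ~~ odd (nk p.+1) ->
          exists2 s : seq {poly 'F_p},
            forall g, g \in s -> irreducible_quadratic g
            & reduce_mod p Q = \prod_(g <- s) g
      & odd (nk p.+1) ->
          exists2 s : seq {poly 'F_p},
            forall g, g \in s -> irreducible_quadratic g
            & reduce_mod p Q = ('X + 1728%:R%:P) * \prod_(g <- s) g].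
Proof.
move=> p_pr p12 f_Ck P_j; have p_gt1 := prime_gt1 p_pr.
have ak0 : ak p.+1 = 0%N.
  case: p12 => p12.
    by have [] := @weight_decomp_uniq p.+1 (p.+1 %/ 12)%N 0 1 ltac:(lia) isT isT.
  by have [] := @weight_decomp_uniq p.+1 (p.+1 %/ 12)%N 0 0 ltac:(lia) isT isT.
have formO := jpoly_identity ak0 f_Ck P_j.
have [_ size_P _] := P_j.
have P_int i : exists z : int, P`_i = z%:~R.
  case: (leqP i (nk p.+1)) => [lei|lti]; last first.
    by exists 0; rewrite nth_default //; apply: leq_trans size_P lti.
  have /intrP[z zE] := form_integral (d := fun i => ratr P`_i) formO lei.
  by exists z; apply: (fmorph_inj (ratr : {rmorphism rat -> R})); rewrite /= zE ratr_int.
have [c0 c0E] := choice P_int.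
pose c i := if (i <= nk p.+1)%N then c0 i else 0.
have c_n1 : c (nk p.+1).+1 = 0 by rewrite /c ltnn.
have formZ : fps_O (nk p.+1).+1 (hex_form (nk p.+1) (bk p.+1) c - theta_hex).
  move=> i lti; have := formO i lti; rewrite /hex_form !fps_coefB !fps_coef_sum => E.
  apply: (@intr_inj R); rewrite intrB (rmorph_sum (intr : {rmorphism int -> R})) -[RHS]E; congr (_ - _).
  apply: eq_bigr => -[k ltk] _ /=; rewrite !fps_coef_CM rmorphM /fps_map.
  by rewrite c0E ratr_int /c -ltnS ltk.
have [Q_size Q_split Q_even Q_odd] := hex_polynomial_mod_p p_pr p12 c_n1 formZ.
exists (\poly_(i < (nk p.+1).+1) c i); split=> //.
apply/polyP => i; rewrite coef_map coef_poly c0E /c ltnS; case: (leqP i _) => // lti.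
by rewrite -c0E nth_default //; apply: leq_trans size_P lti.
Qed.
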